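(* Suppose the billiard boundary is of class $\mathcal{C}^3$, let $P^3$ be the set of three-period orbits of the billiard map, and assume that the Hausdorff dimension of $P^3$ equals $1$. Then the set $P^3$ has a tangent line at $\mathcal{H}^1$-almost every point $p\in P^3$.
   Context: Billiard setting: consider a (classical, planar) billiard whose boundary is a closed curve of length $l$, not necessarily convex, parametrized by arc length $t$; the parameter circle $\mathbb{R}/l\mathbb{Z}$ is denoted $S^1$. An outgoing trajectory is described by $(t,\theta)$, where $t$ is the boundary point it leaves from and $\theta\in I=(0,\pi)$ is the angle it makes with the tangent to the boundary there. The billiard map $T$ sends $(t_1,\theta_1)$ to $(t_2,\theta_2)$, where $t_2$ is the next boundary point hit by the trajectory and $\theta_2$ is the angle with the tangent of the trajectory leaving $t_2$ after reflection (angle of incidence equals angle of reflection). It is defined for segments that are transversal to the boundary at both ends; the segments that are not transversal are disregarded. The phase space is the open annulus $U=S^1\times I$, which may be regarded as smoothly embedded in the plane $\mathbb{R}^2$. The set $P^3\subseteq U$ of three-period orbits is the set of points $p=(t,\theta)\in U$ with $T^3(p)=p$. Hausdorff measure: for $E\subseteq\mathbb{R}^2$, $0\le s<\infty$ and $\delta>0$, $\mathcal{H}^s_\delta(E)=\inf\sum_{i}\operatorname{diam}(U_i)^s$, the infimum over all countable covers $\{U_i\}$ of $E$ with $0<\operatorname{diam}(U_i)\le\delta$, and $\mathcal{H}^s(E)=\lim_{\delta\to0+}\mathcal{H}^s_\delta(E)$. The Hausdorff dimension of $E$ is the unique $s_0$ such that $\mathcal{H}^s(E)=\infty$ for $0\le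 s<s_0$ and $\mathcal{H}^s(E)=0$ for $s>s_0$. A property holds at $\mathcal{H}^s$-almost every point of an $\mathcal{H}^s$-measurable set $E$ if there is a subset $F\subseteq E$ with $\mathcal{H}^s(E\setminus F)=0$ such that the property holds at every point of $F$. Tangent lines: $B(p,r)$ is the closed disc of radius $r$ centered at $p$, and for $\gamma\in\mathbb{R}$, $\rho,\eta>0$, $W_p(\gamma;\rho,\eta)=\{p+te^{i\theta}: 0\le t\le\rho,\ |\theta-\gamma|\le\eta\}$ (identifying $\mathbb{R}^2$ with $\mathbb{C}$). The upper density is $D^{s}(E,p)=\limsup_{r\to0+}\mathcal{H}^s(E\cap B(p,r))/(2r)^s$. An $\mathcal{H}^s$-measurable set $E\subseteq\mathbb{R}^2$ has a tangent line at $p$ in direction $\gamma\in\mathbb{R}$ if $D^s(E,p)>0$ and for every $\eta>0$, $$\lim_{r\to0+}\frac{\mathcal{H}^s\big(E\cap(B(p,r)\setminus(W_p(\gamma;r,\eta)\cup W_p(\gamma+\pi;r,\eta)))\big)}{r^s}=0.$$ It has a tangent line at $p$ if this holds for some $\gamma$. In this statement the notion is used with $s=1$. *)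

(* Defs.v *)
From HB Require Import structures.
From mathcomp Require Import all_boot all_order all_algebra.
From mathcomp Require Import all_classical all_reals all_analysis.

Set Implicit Arguments.
Unset Strict Implicit.
Unset Printing Implicit Defensive.

Import Order.TTheory GRing.Theory Num.Theory.
Import numFieldNormedType.Exports.

Local Open Scope ring_scope.
Local Open Scope classical_set_scope.

(* The product topology on R * R is the usual one, but the library's norm there
   is the sup norm, so the Euclidean distance is spelled out. *)
Notation plane R := (R * R)%type (only parsing).

Section HausdorffMeasure.
Context {R : realType}.
Implicit Types (E V : set (plane R)) (p q : plane R) (s d r : R).

Definition eucl_dist p q : R :=
  Num.sqrt ((p.1 - q.1) ^+ 2 + (p.2 - q.2) ^+ 2).

(* diam set0 = -oo *)
Definition diam V : \bar R :=
  ereal_sup [set (eucl_dist pq.1 pq.2)%:E | pq in V `*` V].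

(* A countable family of sets is given by an index set C.1 of natural numbers
   and the members C.2 i for i in C.1, so that finite covers are allowed even
   though every member must have positive diameter. *)
Definition delta_cover d E (C : set nat * (nat -> set (plane R))) : Prop :=
  (forall i, C.1 i -> (0 < diam (C.2 i) <= d%:E)%E) /\
  E `<=` \bigcup_(i in C.1) C.2 i.

Definition hausdorff_pre s d E : \bar R :=
  ereal_inf [set (\esum_(i in C.1) (diam (C.2 i) `^ s))%E |
              C in delta_cover d E].

Definition hausdorff_measure s E : \bar R :=
  lim (hausdorff_pre s d E @[d --> 0^'+]).

Definition has_hausdorff_dim E (s0 : R) : Prop :=
  0 <= s0 /\
  forall s, 0 <= s ->
    (s < s0 -> hausdorff_measure s E = +oo%E) /\
    (s0 < s -> hausdorff_measure s E = 0%E).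

Definition hausdorff_ae s E (P : plane R -> Prop) : Prop :=
  (hausdorff_measure s).-caratheodory E /\
  exists F : set (plane R),
    [/\ F `<=` E, hausdorff_measure s (E `\` F) = 0%E & F `<=` P].

End HausdorffMeasure.

Section TangentLine.
Context {R : realType}.
Implicit Types (E : set (plane R)) (p : plane R) (s r phi rho eta : R).

Definition closed_disc p r : set (plane R) := [set q | eucl_dist p q <= r].

Definition wedge p phi rho eta : set (plane R) :=
  [set q | exists t theta : R,
    [/\ 0 <= t <= rho, `|theta - phi| <= eta
      & q = p + t *: (cos theta, sin theta)]].

Definition upper_density s E p : \bar R :=
  limf_esup
    (fun r => hausdorff_measure s (E `&` closed_disc p r)
              / ((2 * r) `^ s)%:E)%E
    (0 : R)^'+.

Definition has_tangent_line_dir s E p phi : Prop :=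
  [/\ (hausdorff_measure s).-caratheodory E,
      (0 < upper_density s E p)%E
    & forall eta, 0 < eta ->
        (hausdorff_measure s
           (E `&` (closed_disc p r `\`
                   (wedge p phi r eta `|` wedge p (phi + pi) r eta)))
         / (r `^ s)%:E)%E @[r --> (0 : R)^'+] --> (0 : \bar R)].

Definition has_tangent_line s E p : Prop :=
  exists phi : R, has_tangent_line_dir s E p phi.

End TangentLine.

Section Billiard.
Context {R : realType}.
Implicit Types (l t : R) (gamma : R -> plane R) (D : set (plane R))
  (p q : plane R).

Definition tangent gamma t : plane R := derive1 gamma t.

Definition rot90 (v : plane R) : plane R := (- v.2, v.1).

(* gamma is the arc length parametrization, lifted from R/lZ to an l-periodic
   map on R, of a simple closed curve of length l; D is the region it bounds,
   and the orientation is the one for which D lies to the left of gamma. *)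
Record billiard_table l gamma D : Prop := BilliardTable {
  table_length : 0 < l;
  table_closed : forall t, gamma (t + l) = gamma t;
  table_simple : forall t t', gamma t = gamma t' ->
    exists k : int, t' = t + k%:~R * l;
  table_derivable : forall t, derivable gamma t 1;
  table_arclength : forall t, eucl_dist (tangent gamma t) 0 = 1;
  table_open : open D;
  table_connected : connected D;
  table_bounded : bounded_set D;
  table_boundary : closure D `\` interior D = range gamma;
  table_left : forall t,
    \forall s \near (0 : R)^'+, D (gamma t + s *: rot90 (tangent gamma t))
}.

Definition curve_Cn (n : nat) gamma : Prop :=
  (forall k t, (k < n)%N -> derivable gamma^`(k) t 1) /\
  continuous gamma^`(n).

(* The phase space S^1 * (0, pi), lifted to the strip R * (0, pi). *)
Definition phase_strip : set (plane R) := [set p | 0 < p.2 < pi].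

Definition same_phase_point l p q : Prop :=
  (exists k : int, q.1 = p.1 + k%:~R * l) /\ q.2 = p.2.

Definition outgoing gamma p : plane R :=
  cos p.2 *: tangent gamma p.1 + sin p.2 *: rot90 (tangent gamma p.1).

Definition incoming gamma q : plane R :=
  cos q.2 *: tangent gamma q.1 - sin q.2 *: rot90 (tangent gamma q.1).

(* T p = q, as a relation between lifts which is l-periodic in the first
   coordinates of both p and q.  The trajectory stays in the open region D until
   it first meets the boundary, at gamma q.1; its direction there is
   [incoming gamma q], the mirror image of [outgoing gamma q] in the tangent.
   Transversality at both ends is 0 < p.2 < pi and 0 < q.2 < pi. *)
Definition billiard_map gamma D p q : Prop :=
  [/\ phase_strip p, phase_strip q
    & exists2 tau : R, 0 < tau &
      [/\ forall s : R, 0 < s < tau -> D (gamma p.1 + s *: outgoing gamma p),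
          gamma q.1 = gamma p.1 + tau *: outgoing gamma p
        & outgoing gamma p = incoming gamma q]].

Definition three_period gamma D : set (plane R) :=
  [set p | exists q r, [/\ billiard_map gamma D p q,
    billiard_map gamma D q r & billiard_map gamma D r p]].

Fixpoint Cn_on (n : nat) (A : set (plane R)) (f : plane R -> R) : Prop :=
  match n with
  | 0%N => forall p, A p -> {for p, continuous f}
  | m.+1 =>
      [/\ forall p, A p -> derivable f p (1, 0) /\ derivable f p (0, 1),
          Cn_on m A (fun p => 'D_((1 : R), (0 : R)) f p)
        & Cn_on m A (fun p => 'D_((0 : R), (1 : R)) f p)]
  end.

Definition jacobian (f : plane R -> plane R) p : R :=
  'D_((1 : R), (0 : R)) (fun x => (f x).1) p *
  'D_((0 : R), (1 : R)) (fun x => (f x).2) p -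
  'D_((0 : R), (1 : R)) (fun x => (f x).1) p *
  'D_((1 : R), (0 : R)) (fun x => (f x).2) p.

(* A smooth embedding of the annulus (R/lZ) * (0, pi) in the plane, given by its
   lift to the strip: a smooth injective immersion with continuous inverse. *)
Record annulus_embedding l (iota : plane R -> plane R) : Prop :=
  AnnulusEmbedding {
  embedding_smooth : forall n, Cn_on n phase_strip (fun p => (iota p).1) /\
                               Cn_on n phase_strip (fun p => (iota p).2);
  embedding_immersion : forall p, phase_strip p -> jacobian iota p != 0;
  embedding_injective : forall p q, phase_strip p -> phase_strip q ->
    iota p = iota q <-> same_phase_point l p q;
  embedding_inverse : forall p, phase_strip p -> forall e : R, 0 < e ->
    exists2 d : R, 0 < d & forall q, phase_strip q ->
      eucl_dist (iota p) (iota q) < d ->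
      exists2 q', same_phase_point l q q' & eucl_dist p q' < e
}.

End Billiard.

(* Main.v *)
From HB Require Import structures.
Require Import Defs.
From mathcomp Require Import all_boot all_order all_algebra.
From mathcomp Require Import all_classical all_reals all_analysis.
From mathcomp Require Import ring lra.

Set Implicit Arguments.
Unset Strict Implicit.
Unset Printing Implicit Defensive.

Import Order.TTheory GRing.Theory Num.Theory.
Import numFieldNormedType.Exports.

Local Open Scope ring_scope.
Local Open Scope classical_set_scope.

(* A three-period orbit is a critical point of the perimeter of triangles inscribed
   in the boundary.  Along any sequence of such orbits converging to an orbit p, the
   direction of approach lies in the kernel of the Hessian of the perimeter at p, and
   the next order of the expansion shows that the third derivative vanishes on it,
   even when one of its three arguments is an arbitrary vector of the kernel.  Two
   independent limit directions would make the Hessian of rank one, which determines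
   the curvatures at the vertices, and would make the cubic form vanish on its whole
   kernel; this contradicts the triangle inequality.  So the set of these orbits has
   at most one limit direction at each of its points: close to any p it lies in
   arbitrarily thin double cones, a property preserved by the embedding.  Such a set
   is a countable union of subsets of Lipschitz graphs, hence H^1-sigma-finite, so
   that its upper density is positive at almost every point, while the cone condition
   makes the measures in the definition of a tangent line vanish for small radii.
   The set is measurable because it is F_sigma: quantitative bounds on the
   transversality, on the lengths and on the clearance of the three segments cut it
   into countably many compact sets. *)

(** The difficulty is the passage to the next order. Along orbits approaching p, the rescaled
    displacements x of the vertices converge to a limit u at no known rate, so in an expansion H x +
    (small parameter) * (quadratic part) = 0 the first term may hide the second although H u = 0.
    Pairing the three reflection equations with a vector v of the kernel removes the first term
    exactly, for every orbit and not only in the limit, because H is symmetric; what survives is the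
    third derivative at u, u, v. This is why the cubic form is controlled against kernel vectors
    only, and why this is enough: two independent limit directions lie in the kernel and test each
    other. The expansion is made on the reflection law, written as a polynomial identity between
    chords and unit tangents, rather than on the perimeter itself. Ultrafilters replace
    subsequences: every bounded quantity converges along them, so all the rescaled displacements
    have limits at the same time. *)

(** * Euclidean distance and the Hausdorff measure of dimension one *)

Section EuclideanDistance.
Context {R : realType}.
Implicit Types (p q r : plane R).

Lemma eucl_dist_ge0 p q : 0 <= eucl_dist p q.
Proof. exact: sqrtr_ge0. Qed.

Lemma eucl_dist_sqr p q :
  eucl_dist p q ^+ 2 = (p.1 - q.1) ^+ 2 + (p.2 - q.2) ^+ 2.
Proof. by rewrite sqr_sqrtr// addr_ge0 ?sqr_ge0. Qed.

Lemma eucl_distxx p : eucl_dist p p = 0.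
Proof. by rewrite /eucl_dist !subrr expr0n/= addr0 sqrtr0. Qed.

Lemma eucl_distC p q : eucl_dist p q = eucl_dist q p.
Proof.
by rewrite /eucl_dist -(sqrrN (p.1 - _)) -(sqrrN (p.2 - _)) !opprB.
Qed.

Lemma eucl_dist_le_l1 p q : eucl_dist p q <= `|p.1 - q.1| + `|p.2 - q.2|.
Proof.
rewrite -ler_sqr ?nnegrE ?eucl_dist_ge0 ?addr_ge0// eucl_dist_sqr.
rewrite -(real_normK (num_real (p.1 - q.1))) -(real_normK (num_real (p.2 - q.2))).
have := normr_ge0 (p.1 - q.1); have := normr_ge0 (p.2 - q.2).
by move: `|p.1 - q.1| `|p.2 - q.2| => a b *; nra.
Qed.

Lemma ler_eucl_dist1 p q : `|p.1 - q.1| <= eucl_dist p q.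
Proof.
rewrite -ler_sqr ?nnegrE ?eucl_dist_ge0// eucl_dist_sqr real_normK ?num_real//.
by rewrite lerDl sqr_ge0.
Qed.

Lemma ler_eucl_dist2 p q : `|p.2 - q.2| <= eucl_dist p q.
Proof.
rewrite -ler_sqr ?nnegrE ?eucl_dist_ge0// eucl_dist_sqr real_normK ?num_real//.
by rewrite lerDr sqr_ge0.
Qed.

Lemma eucl_dist_eq0 p q : eucl_dist p q = 0 -> p = q.
Proof.
move=> pq0; have := ler_eucl_dist1 p q; have := ler_eucl_dist2 p q.
rewrite pq0 !normr_le0 !subr_eq0 => /eqP p2 /eqP p1.
by case: p q p1 p2 {pq0} => p1 p2 [q1 q2] /= -> ->.
Qed.

Lemma eucl_dist_triangle q p r :
  eucl_dist p r <= eucl_dist p q + eucl_dist q r.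
Proof.
have b0 := eucl_dist_ge0 q r; have a0 := eucl_dist_ge0 p q.
have bE := eucl_dist_sqr q r; have aE := eucl_dist_sqr p q.
rewrite -[_ <= _ + _]ler_sqr ?nnegrE ?addr_ge0 ?eucl_dist_ge0//.
rewrite (eucl_dist_sqr p r); move: (eucl_dist p q) (eucl_dist q r) a0 b0 aE bE => a b a0 b0.
set x := q.1 - r.1; set y := q.2 - r.2; set z := p.1 - q.1; set t := p.2 - q.2.
have -> : p.1 - r.1 = x + z by rewrite /x /z; ring.
have -> : p.2 - r.2 = y + t by rewrite /y /t; ring.
move=> aE bE.
suff : x * z + y * t <= a * b by nra.
rewrite leNgt; apply/negP => lt_ab.
have : (a * b) ^+ 2 < (x * z + y * t) ^+ 2.
  have ab0 : 0 <= a * b by exact: mulr_ge0.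
  by rewrite ltr_sqr ?nnegrE// (le_trans ab0 (ltW lt_ab)).
rewrite exprMn aE bE ltNge => /negP; apply.
rewrite -subr_ge0.
have -> : (z ^+ 2 + t ^+ 2) * (x ^+ 2 + y ^+ 2) - (x * z + y * t) ^+ 2 =
  (x * t - y * z) ^+ 2 by ring.
exact: sqr_ge0.
Qed.

End EuclideanDistance.

Section Diameter.
Context {R : realType}.
Implicit Types (p q : plane R) (V : set (plane R)) (r : R).

Lemma dist_le_diam V p q : V p -> V q -> ((eucl_dist p q)%:E <= diam V)%E.
Proof. by move=> Vp Vq; apply: ereal_sup_ubound; exists (p, q). Qed.

Lemma diam_le V (x : \bar R) :
  (forall p q, V p -> V q -> ((eucl_dist p q)%:E <= x)%E) -> (diam V <= x)%E.
Proof. by move=> Vx; apply: ge_ereal_sup => _ [[p q] [Vp Vq] <-]; exact: Vx. Qed.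

Lemma diam_ge0 V p : V p -> (0 <= diam V)%E.
Proof. by move=> Vp; have := dist_le_diam Vp Vp; rewrite eucl_distxx. Qed.

Lemma diam_gt0 V : (0 < diam V)%E -> V !=set0.
Proof.
move=> V0; apply/set0P; apply: contraTN V0 => /eqP ->.
rewrite -leNgt; exact: diam_le.
Qed.

End Diameter.

(* Carathéodory's construction from the weight [diam], cut off at scale d; the
   sigma-algebra of all subsets turns the plane into a type on which [mu_ext]
   ranges over arbitrary countable covers. *)
Section HausdorffOuterMeasure.
Context {R : realType}.
Local Open Scope ereal_scope.
Implicit Types (E A B V : set (plane R)) (d : R).

Let plane_discrete := g_sigma_algebraType [set: set (plane R)].

(** The value [+oo] on large sets turns the bound on the size of the members of a cover into a
    penalty, so that the infimum runs over all sequences of sets, as in [mu_ext]. The empty set is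
    separated because its [diam] is [-oo]. *)
Definition diam_weight d V : \bar R :=
  if V == set0 then 0 else if diam V <= d%:E then diam V else +oo.

Lemma diam_weight0 d : diam_weight d set0 = 0.
Proof. by rewrite /diam_weight eqxx. Qed.

Lemma diam_weight_ge0 d V : 0 <= diam_weight d V.
Proof.
rewrite /diam_weight; case: eqVneq => // /set0P[p Vp].
by case: ifPn => // _; exact: diam_ge0 Vp.
Qed.

Lemma diam_weightE d V : V !=set0 -> diam V <= d%:E -> diam_weight d V = diam V.
Proof. by rewrite /diam_weight => /set0P/negPf -> ->. Qed.

Lemma diam_le_weight d V : diam V <= diam_weight d V.
Proof.
rewrite /diam_weight; case: eqVneq => [->|_]; first exact: diam_le.
by case: ifPn => // _; rewrite leey.
Qed.

Lemma diam_weight_fin d V : diam_weight d V < +oo -> (0 <= d)%R ->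
  diam V <= d%:E.
Proof.
rewrite /diam_weight; case: eqVneq => [-> _ d0|_].
  by rewrite (@diam_le _ _ d%:E).
by case: ifPn => // _; rewrite ltxx.
Qed.

Lemma diam_weight_le d V (r : R) : (0 <= r <= d)%R ->
  (forall p q, V p -> V q -> (eucl_dist p q <= r)%R) -> diam_weight d V <= r%:E.
Proof.
move=> /andP[r0 rd] Vr; rewrite /diam_weight; case: eqVneq => _.
  by rewrite lee_fin.
have Vr' : diam V <= r%:E by apply: diam_le => p q Vp Vq; rewrite lee_fin Vr.
by rewrite (le_trans Vr')// lee_fin.
Qed.

Definition cover_weight d E : \bar R :=
  ereal_inf [set \sum_(k <oo) diam_weight d (V k) |
    V in [set V : (set (plane R))^nat | E `<=` \bigcup_k V k]].

Lemma cover_weight_mu_ext d :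
  cover_weight d = mu_ext (T := plane_discrete) (diam_weight d).
Proof.
apply/funext => E; rewrite /cover_weight /mu_ext; congr (ereal_inf (_ @` _)).
apply/seteqP; split => V //= => [EV|[]//]; split => // i.
exact: sub_sigma_algebra.
Qed.

Lemma cover_weight_ge0 d E : 0 <= cover_weight d E.
Proof. rewrite cover_weight_mu_ext; apply: mu_ext_ge0; exact: diam_weight_ge0. Qed.

Lemma le_cover_weight d A B : A `<=` B -> cover_weight d A <= cover_weight d B.
Proof. rewrite cover_weight_mu_ext; exact: (@le_mu_ext _ plane_discrete). Qed.

Lemma cover_weight_set0 d : cover_weight d set0 = 0.
Proof.
rewrite cover_weight_mu_ext; apply: mu_ext0; first exact: diam_weight0.
exact: diam_weight_ge0.
Qed.

Lemma cover_weight_sigma_subadditive d : sigma_subadditive (cover_weight d).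
Proof.
rewrite cover_weight_mu_ext.
apply: (@mu_ext_sigma_subadditive _ plane_discrete).
exact: diam_weight_ge0.
Qed.

Lemma cover_weight_le d E (V : (set (plane R))^nat) :
  E `<=` \bigcup_k V k -> cover_weight d E <= \sum_(k <oo) diam_weight d (V k).
Proof. by move=> EV; apply: ereal_inf_lbound; exists V. Qed.

Lemma cover_weight_nincr d d' E : (d <= d')%R ->
  cover_weight d' E <= cover_weight d E.
Proof.
move=> dd'; apply: le_ereal_inf_tmp => _ [V EV <-].
rewrite (le_trans (cover_weight_le d' EV))//.
apply: lee_nneseries => [k _ _|k _]; first exact: diam_weight_ge0.
rewrite /diam_weight; case: eqVneq => // _.
have [Vd|_] := boolP (diam (V k) <= d%:E); last by rewrite leey.
by rewrite (le_trans Vd)// lee_fin.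
Qed.

End HausdorffOuterMeasure.

Section HausdorffMeasureOne.
Context {R : realType}.
Local Open Scope ereal_scope.
Implicit Types (E A B V : set (plane R)) (d : R).

(** The two infima differ in their covers: [hausdorff_pre] asks for positive diameters,
    [cover_weight] admits points and empty members. A degenerate [V k] is therefore replaced by a
    pair of points at distance [r k], at most [e / 2 ^ k.+1], at a total cost of [e]; conversely,
    the indices outside [C.1] are filled with [set0]. *)
Lemma hausdorff_pre1E d E : (0 < d)%R -> hausdorff_pre 1 d E = cover_weight d E.
Proof.
move=> d0; apply/eqP; rewrite eq_le; apply/andP; split.
- apply: le_ereal_inf_tmp => _ [V EV <-].
  apply/lee_addgt0Pr => e e0.
  have [Voo|] := eqVneq (\sum_(k <oo) diam_weight d (V k)) +oo.
    by rewrite Voo addye// leey.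
  rewrite -ltey => Vfin.
  have Vk k : diam (V k) <= d%:E.
    apply: diam_weight_fin (ltW d0); apply: le_lt_trans Vfin.
    rewrite (@nneseriesD1 _ _ k)//; last by move=> *; exact: diam_weight_ge0.
    by rewrite leeDl// nneseries_ge0// => *; exact: diam_weight_ge0.
  pose r k : R := Num.min d (e / (2 ^ k.+1)%:R)%R.
  have r0 k : (0 < r k)%R.
    by rewrite /r lt_min d0/= divr_gt0// ltr0n expn_gt0.
  pose p k := xget (0%R, 0%R) (V k).
  pose V' k : set (plane R) := if 0 < diam (V k) then V k
    else [set p k; (p k + (r k, 0))%R].
  have prE k : eucl_dist (p k) (p k + (r k, 0))%R = r k.
    rewrite /eucl_dist/= addr0 subrr expr0n addr0 -sqrrN opprB.
    by rewrite (addrC _ (r k)) addrK sqrtr_sqr gtr0_norm.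
  have dV' k : ~~ (0 < diam (V k)) -> diam (V' k) = (r k)%:E.
    rewrite /V' => /negPf ->; apply/eqP; rewrite eq_le; apply/andP; split.
      by apply: diam_le => x y [->|->] [->|->];
        rewrite lee_fin ?(eucl_distC (p k + _)%R (p k)) ?prE ?eucl_distxx
          ?lexx ?(ltW (r0 k)).
    by rewrite -{1}prE; apply: dist_le_diam; [left|right].
  have V'0 k : 0 < diam (V' k).
    case: (boolP (0 < diam (V k))) => [Vk0|/dV' ->]; last by rewrite lte_fin.
    by rewrite /V' Vk0.
  have V'd k : diam (V' k) <= d%:E.
    case: (boolP (0 < diam (V k))) => [Vk0|/dV' ->]; first by rewrite /V' Vk0.
    by rewrite lee_fin /r ge_min lexx.
  have VV' k : V k `<=` V' k.
    rewrite /V'; case: ifPn => [_ x //|Vk0 x Vx]; left.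
    have Vp : V k (p k) by apply: (@xgetPex _ _ (V k)); exists x.
    apply: eucl_dist_eq0; apply/eqP; rewrite eq_le eucl_dist_ge0 andbT.
    by rewrite -lee_fin (le_trans (dist_le_diam Vx Vp))// leNgt.
  apply: (@le_trans _ _ (\sum_(k <oo) diam (V' k))).
    apply: ereal_inf_lbound; exists (setT, V'); last first.
      rewrite -nneseries_esumT//=; last by move=> k; rewrite poweR_ge0.
      by apply: eq_eseriesr => k _; rewrite poweRe1// ltW.
    split => /= [i _|x /EV[k _ /VV' Vx]]; last by exists k.
    by rewrite V'0 V'd.
  apply: le_trans (epsilon_trick _ _ (ltW e0)); last first.
    by move=> *; exact: diam_weight_ge0.
  apply: lee_nneseries => [k _ _|k _]; first exact: ltW.
  case: (boolP (0 < diam (V k))) => [Vk0|nVk].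
    by rewrite /V' Vk0 (le_trans (diam_le_weight d _))// leeDl// lee_fin divr_ge0// ltW.
  by rewrite dV'// (@le_trans _ _ (e / (2 ^ k.+1)%:R)%:E)//
    ?lee_fin ?ge_min ?lexx ?orbT// leeDr// diam_weight_ge0.
- apply: le_ereal_inf_tmp => _ [C [Cd EC] <-].
  pose V k := if k \in C.1 then C.2 k else set0.
  have EV : E `<=` \bigcup_k V k.
    by move=> x /EC[k Ck Cx]; exists k => //; rewrite /V mem_set.
  apply: le_trans (cover_weight_le d EV) _.
  rewrite nneseries_esumT; last by move=> k; exact: diam_weight_ge0.
  rewrite [leRHS]esum_mkcond; apply: le_esum => k _; rewrite /V.
  case: ifPn => [|_]; last by rewrite diam_weight0.
  rewrite inE => /Cd /andP[Ck0 Ckd].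
  by rewrite diam_weightE ?poweRe1// ?ltW//; exact: diam_gt0.
Qed.

Let cover_weight_cvg_sup E : cover_weight d E @[d --> 0^'+] -->
  ereal_sup [set cover_weight d E | d in `]0%R, 1%R[].
Proof.
apply: (@nonincreasing_at_right_cvge _ (cover_weight ^~ E) 0%R (BLeft 1%R)).
  by rewrite bnd_simp.
by move=> x y _ _; exact: cover_weight_nincr.
Qed.

Lemma hausdorff_measure1E E :
  hausdorff_measure 1 E = ereal_sup [set cover_weight d E | d in `]0%R, 1%R[].
Proof.
have H : hausdorff_pre 1 d E @[d --> 0^'+] -->
    ereal_sup [set cover_weight d E | d in `]0%R, 1%R[].
  apply: cvg_trans; last exact: cover_weight_cvg_sup.
  apply: near_eq_cvg; near=> d; rewrite hausdorff_pre1E//.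
by rewrite /hausdorff_measure; exact/cvg_lim.
Unshelve. all: by end_near. Qed.

Lemma cover_weight_cvg E :
  cover_weight d E @[d --> 0^'+] --> hausdorff_measure 1 E.
Proof. by rewrite hausdorff_measure1E; exact: cover_weight_cvg_sup. Qed.

Lemma cover_weight_le_hausdorff d E : (0 < d)%R ->
  cover_weight d E <= hausdorff_measure 1 E.
Proof.
move=> d0; rewrite hausdorff_measure1E.
(* The supremum runs over scales below 1 only, hence the cap at [2^-1]. *)
apply: (@le_trans _ _ (cover_weight (Num.min d (2^-1)%R) E)).
  by apply: cover_weight_nincr; rewrite ge_min lexx.
apply: ereal_sup_ubound; exists (Num.min d (2^-1)%R); last by [].
by rewrite /= in_itv/= lt_min d0 invr_gt0 ltr0n/= gt_min invf_lt1 ?ltr1n ?orbT.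
Qed.

Lemma hausdorff_le E (x : \bar R) (e : R) : (0 < e)%R ->
  (forall d, (0 < d < e)%R -> cover_weight d E <= x) ->
  hausdorff_measure 1 E <= x.
Proof.
move=> e0 Hx; rewrite hausdorff_measure1E.
apply: ge_ereal_sup => _ [d + <-]; rewrite /= in_itv/= => /andP[d0 d1].
apply: (@le_trans _ _ (cover_weight (Num.min d (e / 2)%R) E)).
  by apply: cover_weight_nincr; rewrite ge_min lexx.
by apply: Hx; rewrite lt_min d0 divr_gt0//= gt_min ltr_pdivrMr// ltr_pMr ?ltr1n ?orbT.
Qed.

Lemma hausdorff_ge0 E : 0 <= hausdorff_measure 1 E.
Proof. by rewrite (le_trans _ (cover_weight_le_hausdorff E ltr01))// cover_weight_ge0. Qed.

Lemma hausdorff_set0 : hausdorff_measure 1 (set0 : set (plane R)) = 0.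
Proof.
apply/eqP; rewrite eq_le hausdorff_ge0 andbT.
by apply: (@hausdorff_le _ _ 1) => // d _; rewrite cover_weight_set0.
Qed.

Lemma le_hausdorff A B : A `<=` B -> hausdorff_measure 1 A <= hausdorff_measure 1 B.
Proof.
move=> AB; apply: (@hausdorff_le _ _ 1) => // d /andP[d0 _].
by rewrite (le_trans (le_cover_weight d AB))// cover_weight_le_hausdorff.
Qed.

Lemma hausdorff_sigma_subadditive :
  sigma_subadditive (hausdorff_measure 1 : set (plane R) -> \bar R).
Proof.
move=> F; apply: (@hausdorff_le _ _ 1) => // d /andP[d0 _].
rewrite (le_trans (cover_weight_sigma_subadditive d F))//.
apply: lee_nneseries => [k _ _|k _]; first exact: cover_weight_ge0.
by exact: cover_weight_le_hausdorff.
Qed.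

HB.instance Definition _ := isOuterMeasure.Build R (plane R)
  (hausdorff_measure 1) hausdorff_set0 hausdorff_ge0 le_hausdorff
  hausdorff_sigma_subadditive.

(** At scales below [r] no member of a cover meets both sets, so a cover of the union splits into a
    cover of [A] and one of [B]. This makes [hausdorff_measure 1] a metric outer measure. *)
Lemma hausdorff_separated A B (r : R) : (0 < r)%R ->
  (forall x y, A x -> B y -> (r <= eucl_dist x y)%R) ->
  hausdorff_measure 1 A + hausdorff_measure 1 B <= hausdorff_measure 1 (A `|` B).
Proof.
move=> r0 AB.
have step d : (0 < d < r)%R ->
    cover_weight d A + cover_weight d B <= cover_weight d (A `|` B).
  move=> /andP[d0 dr]; apply: le_ereal_inf_tmp => _ [V ABV <-].
  have [Voo|] := eqVneq (\sum_(k <oo) diam_weight d (V k)) +oo.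
    by rewrite Voo leey.
  rewrite -ltey => Vfin.
  have Vd k : diam (V k) <= d%:E.
    apply: diam_weight_fin (ltW d0); apply: le_lt_trans Vfin.
    rewrite (@nneseriesD1 _ _ k)//; last by move=> *; exact: diam_weight_ge0.
    by rewrite leeDl// nneseries_ge0// => *; exact: diam_weight_ge0.
  pose W S k := if `[< V k `&` S !=set0 >] then V k else set0.
  have SW S : S `<=` A `|` B -> S `<=` \bigcup_k W S k.
    move=> SAB x Sx; have [k _ Vx] := ABV _ (SAB _ Sx).
    by exists k => //; rewrite /W asboolT//; exists x.
  apply: le_trans; first apply: leeD.
  - by apply: (@cover_weight_le _ d _ (W A)); apply: SW; exact: subsetUl.
  - by apply: (@cover_weight_le _ d _ (W B)); apply: SW; exact: subsetUr.
  rewrite -nneseriesD; [|by move=> *; exact: diam_weight_ge0..].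
  apply: lee_nneseries => [k _ _|k _]; first by rewrite adde_ge0// diam_weight_ge0.
  rewrite /W; case: asboolP => [[x [Vx Ax]]|_]; last first.
    by rewrite diam_weight0 add0e; case: ifPn; rewrite ?diam_weight0 ?diam_weight_ge0.
  case: asboolP => [[y [Vy By]]|_]; last by rewrite diam_weight0 adde0.
  have := le_trans (dist_le_diam Vx Vy) (Vd k).
  by rewrite lee_fin leNgt (lt_le_trans dr)// AB.
have cvA := @cover_weight_cvg A; have cvB := @cover_weight_cvg B.
have cvAB : cover_weight d A + cover_weight d B @[d --> 0%R^'+] -->
    hausdorff_measure 1 A + hausdorff_measure 1 B.
  apply: cvgeD => //; rewrite ge0_adde_def// inE; exact: hausdorff_ge0.
apply: cvge_to_le cvAB _; near=> d.
 rewrite (le_trans (step _ _))//; last exact: cover_weight_le_hausdorff.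
by apply/andP; split.
Unshelve. all: by end_near. Qed.

End HausdorffMeasureOne.

(** * Closed sets are Carathéodory measurable *)

Section CaratheodoryCriterion.
Context {R : realType}.
Local Open Scope ereal_scope.
Local Notation H := (hausdorff_measure 1).
Variables (X F : set (plane R)).

Definition away n : set (plane R) :=
  [set x | X x /\ forall y, F y -> (n.+1%:R^-1 <= eucl_dist x y)%R].

Definition ring_at n : set (plane R) := away n.+1 `\` away n.

Lemma away_subset n : away n `<=` X. Proof. by move=> x []. Qed.

Lemma le_away m n : (m <= n)%N -> away m `<=` away n.
Proof.
move=> mn x [Xx Fx]; split=> // y /Fx; apply: le_trans.
by rewrite lef_pV2 ?posrE ?ltr0n// ler_nat.
Qed.

(** A point of the ring has a point of [F] at distance less than [n.+2%:R^-1], whereas the points of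
    [away n] are at distance at least [n.+1%:R^-1] from it; the index skipped in between creates the
    gap that separates the two sets. *)
Lemma hausdorff_away_ring n : H (away n) + H (ring_at n.+1) <= H (away n.+2).
Proof.
apply: (@le_trans _ _ (H (away n `|` ring_at n.+1))).
  apply: (@hausdorff_separated _ _ _ (n.+1%:R^-1 - n.+2%:R^-1)%R).
    by rewrite subr_gt0 ltf_pV2 ?posrE ?ltr0n// ltr_nat.
  move=> x z [_ xF] [[Xz _] zF].
  have [y Fy zy] : exists2 y, F y & (eucl_dist z y < n.+2%:R^-1)%R.
    apply: contrapT => noy; apply: zF; split=> // y Fy.
    by rewrite leNgt; apply/negP => zy; apply: noy; exists y.
  have := xF _ Fy; have := eucl_dist_triangle z x y.
  move: zy; move: (n.+1%:R^-1)%R (n.+2%:R^-1)%R (eucl_dist z y) (eucl_dist x y).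
  by move=> *; lra.
apply: le_hausdorff => x [|[]//]; exact/le_away/leq_trans/leqnSn.
Qed.

(** Rings with indices of the same parity are separated from each other, so their measures add up;
    [i] is 0 or 1 in use. Adjacent rings may touch, which is why the two parities are summed
    apart. *)
Lemma sum_rings_le m i :
  \sum_(j < m) H (ring_at (j.*2 + i)%N) <= H X.
Proof.
case: m => [|m]; first by rewrite big_ord0 hausdorff_ge0.
apply: (@le_trans _ _ (H (away (m.*2 + i)%N.+1))); last first.
  exact/le_hausdorff/away_subset.
elim: m => [|m IH].
  by rewrite big_ord1; apply: le_hausdorff => x [].
rewrite big_ord_recr/= (le_trans (leeD2r _ IH))//.
by rewrite doubleS !addSn; exact: hausdorff_away_ring.
Qed.

(** A point outside [F] enters the sets [away] at a first index [N]. Either [N <= n.*2], or the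
    point is in the ring of index [N - 1], which is [j.*2] or [j.*2.+1] for some [j >= n]. *)
Lemma setI_setC_away n : (forall x, ~ F x -> exists2 r : R, (0 < r)%R &
    forall y, F y -> (r <= eucl_dist x y)%R) ->
  X `&` ~` F `<=` away n.*2 `|`
    \bigcup_(j in ~` `I_n) (ring_at j.*2 `|` ring_at j.*2.+1).
Proof.
move=> Fcl x [Xx /Fcl[r r0 Fr]].
have exN : exists N, `[< away N x >].
  have [N rN] := ltr_add_invr r0; exists N; apply/asboolP; split=> // y Fy.
  by apply: le_trans (Fr _ Fy); rewrite add0r in rN; exact: ltW.
have /ex_minnP[N /asboolP NA minN] := exN.
have [Nn|nN] := leqP N n.*2; first by left; exact: le_away Nn _ NA.
case: N nN NA minN {exN} => // N nN NA minN; right.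
have ringN : ring_at N x.
  by split=> // /asboolP/minN; rewrite ltnn.
exists N./2.
  by move: nN; rewrite ltnS => nN; apply/negP; rewrite -leqNgt -[n]doubleK half_leq.
have := odd_double_half N; case: (odd N) => /= NE; [right|left].
  by rewrite -add1n NE.
by rewrite add0n in NE; rewrite NE.
Qed.

End CaratheodoryCriterion.

Section ClosedMeasurable.
Context {R : realType}.
Local Open Scope ereal_scope.
Local Notation H := (hausdorff_measure 1).

Lemma closed_dist_gt0 (F : set (plane R)) x : closed F -> ~ F x ->
  exists2 r : R, (0 < r)%R & forall y, F y -> (r <= eucl_dist x y)%R.
Proof.
move=> /closed_openC; rewrite openE => /(_ x) Fo /Fo.
rewrite /interior nbhs_ballP => -[r /= r0 xr]; exists r => // y Fy.
rewrite leNgt; apply/negP => xy; apply: (xr y) Fy.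
split; rewrite /ball/= ; apply: le_lt_trans xy.
  exact: ler_eucl_dist1.
exact: ler_eucl_dist2.
Qed.

Lemma closed_caratheodory (F : set (plane R)) : closed F ->
  (hausdorff_measure 1).-caratheodory F.
Proof.
move=> Fcl; apply: le_caratheodory_measurable => X.
change (H (X `&` F) + H (X `&` ~` F) <= H X).
have [->|] := eqVneq (H X) +oo; first by rewrite leey.
rewrite -ltey => Xfin.
have XF n : H (X `&` F) + H (away X F n) <= H X.
  apply: (@le_trans _ _ (H ((X `&` F) `|` away X F n))).
    apply: (@hausdorff_separated _ _ _ n.+1%:R^-1); first by rewrite invr_gt0.
    by move=> x y [_ Fx] [_ yF]; rewrite eucl_distC; exact: yF.
  by apply: le_hausdorff => x [[]//|[]].
pose a j := H (ring_at X F j.*2) + H (ring_at X F j.*2.+1).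
have a0 j : 0 <= a j by rewrite adde_ge0// hausdorff_ge0.
have pa m : \sum_(0 <= j < m) a j <= H X + H X.
  rewrite big_mkord big_split/= leeD//.
    rewrite (le_trans _ (sum_rings_le X F m 0%N))//.
    by apply: lee_sum => j _; rewrite addn0.
  rewrite (le_trans _ (sum_rings_le X F m 1%N))//.
  by apply: lee_sum => j _; rewrite addn1.
have cva := @is_cvg_nneseries _ a xpredT 0%N (fun n _ _ => a0 n).
have S2 : \sum_(j <oo) a j <= H X + H X.
  by apply: lime_le => //; exact: nearW.
have Sfin : \sum_(j <oo) a j \is a fin_num.
  rewrite ge0_fin_numE; last by rewrite nneseries_ge0.
  by rewrite (le_lt_trans S2)// lte_add_pinfty.
rewrite -(leeD2rE _ _ Sfin).
have cvp : H (X `&` F) + H (X `&` ~` F) + \sum_(0 <= j < n) a j @[n --> \oo] -->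
    H (X `&` F) + H (X `&` ~` F) + \sum_(j <oo) a j.
  apply: cvgeD; [|exact: cvg_cst|exact: cva].
  by rewrite fin_num_adde_defl.
apply: cvge_to_le cvp _; apply: nearW => n.
rewrite [X in _ <= _ + X](nneseries_split 0 n)// add0n.
rewrite [X in _ <= _ + X]addeC addeA leeD2r//.
apply: le_trans (leeD2r _ (XF n.*2)).
rewrite -addeA leeD2l//.
apply: (@le_trans _ _ (H (away X F n.*2 `|`
    \bigcup_(j in ~` `I_n) (ring_at X F j.*2 `|` ring_at X F j.*2.+1)))).
  by apply: le_hausdorff; apply: setI_setC_away => x; exact: closed_dist_gt0.
rewrite (le_trans (outer_measureU2 _ _ _))// leeD2l//.
rewrite (le_trans (outer_measure_sigma_subadditive_tail _ _ _))//.
apply: lee_nneseries => [k _ _|k _]; first exact: hausdorff_ge0.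
exact: outer_measureU2.
Qed.

Lemma Fsigma_caratheodory (F : (set (plane R))^nat) :
  (forall n, closed (F n)) ->
  (hausdorff_measure 1).-caratheodory (\bigcup_n F n).
Proof.
move=> Fcl; apply: caratheodory_measurable_bigcup => n.
exact: closed_caratheodory.
Qed.

End ClosedMeasurable.

(** * Positivity of the upper density *)

Section UpperDensity.
Context {R : realType}.
Local Open Scope ereal_scope.
Local Notation H := (hausdorff_measure 1).
Implicit Types (E S : set (plane R)).

(** A density below 1/4 leaves at most [2 * r / 4] in the disc of radius [r]. Any threshold below
    1/2 would do: the sequel needs a fixed fraction of [r] less than one. *)
Lemma upper_density_le0 E p : ~ (0 < upper_density 1 E p) ->
  exists2 d : R, (0 < d)%R & forall r, (0 < r < d)%R ->
    H (E `&` closed_disc p r) <= (r / 2)%:E.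
Proof.
move=> /negP; rewrite -leNgt => ud0.
have : upper_density 1 E p < (4^-1)%:E.
  by rewrite (le_lt_trans ud0)// lte_fin invr_gt0.
rewrite /upper_density /limf_esup => /ereal_inf_lt[_ [V V0 <-] Vlt].
move: V0; rewrite /at_right /within/= => /nbhs_ballP[d /= d0 dV].
exists d => // r /andP[r0 rd].
have Vr : V r.
  by apply: (dV r) => //; rewrite /ball/= sub0r normrN gtr0_norm.
have := le_lt_trans (ereal_sup_ubound (ex_intro2 _ _ r Vr erefl)) Vlt.
have r20 : (0 < 2 * r)%R by rewrite mulr_gt0.
rewrite /= powRr1 ?(ltW r20)// inver gt_eqF//.
rewrite lte_pdivrMr// => /ltW/le_trans; apply.
by rewrite -EFinM lee_fin; lra.
Qed.

(* The points where small discs carry less than half of their radius can be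
   covered, with arbitrarily fine covers, by discs carrying in total at most half
   of the sum of the diameters; hence their measure is at most half of itself. *)
Lemma upper_density_gt0_ae E S : S `<=` E -> H S < +oo ->
  H (S `&` [set p | ~ (0 < upper_density 1 E p)]) = 0.
Proof.
move=> SE Sfin.
pose A n : set (plane R) := [set p | S p /\ forall r, (0 < r < n.+1%:R^-1)%R ->
  H (E `&` closed_disc p r) <= (r / 2)%:E].
have A0 n : H (A n) = 0.
  have Afin : H (A n) \is a fin_num.
    rewrite ge0_fin_numE ?hausdorff_ge0//; apply: le_lt_trans Sfin.
    by apply: le_hausdorff => p [].
  suff half : H (A n) <= (2^-1)%:E * H (A n).
    apply/eqP; rewrite eq_le hausdorff_ge0 andbT.
    by move: half; rewrite -(fineK Afin) -EFinM !lee_fin; lra.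
  apply: (@le_trans _ _ ((2^-1)%:E * cover_weight (n.+2%:R^-1) (A n))); last first.
    by rewrite lee_pmul2l// ?cover_weight_le_hausdorff// lte_fin invr_gt0.
  rewrite -lee_pdivrMl ?invr_gt0//.
  apply: le_ereal_inf_tmp => _ [V AV <-].
  rewrite lee_pdivrMl ?invr_gt0//.
  have [Voo|] := eqVneq (\sum_(k <oo) diam_weight (n.+2%:R^-1) (V k)) +oo.
    by rewrite Voo gt0_muley ?leey// lte_fin invr_gt0.
  rewrite -ltey => Vfin.
  have Vd k : diam (V k) <= (n.+2%:R^-1)%:E.
    apply: diam_weight_fin; last by rewrite invr_ge0.
    apply: le_lt_trans Vfin.
    rewrite (@nneseriesD1 _ _ k)//; last by move=> *; exact: diam_weight_ge0.
    by rewrite leeDl// nneseries_ge0// => *; exact: diam_weight_ge0.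
  apply: (@le_trans _ _ (H (\bigcup_k (A n `&` V k)))).
    by apply: le_hausdorff => p Ap; have [k _ Vp] := AV _ Ap; exists k.
  rewrite (le_trans (hausdorff_sigma_subadditive _))//.
  rewrite -nneseriesZl; last by move=> *; exact: diam_weight_ge0.
  apply: lee_nneseries => [k _ _|k _]; first exact: hausdorff_ge0.
  have [[p [Ap Vp]]|/set0P/negP/negPn/eqP ->] := pselect (A n `&` V k !=set0); last first.
    by rewrite hausdorff_set0 mule_ge0 ?diam_weight_ge0// lee_fin invr_ge0.
  rewrite diam_weightE//; last by exists p.
  have dfin : diam (V k) \is a fin_num.
    by rewrite ge0_fin_numE ?(diam_ge0 Vp)// (le_lt_trans (Vd k))// ltey.
  have Vdk := Vd k; have d0 := diam_ge0 Vp.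
  rewrite -(fineK dfin) lee_fin in Vdk; rewrite -(fineK dfin) lee_fin in d0.
  have AVd r : (fine (diam (V k)) <= r)%R ->
      A n `&` V k `<=` E `&` closed_disc p r.
    move=> dr q [[Sq _] Vq]; split; first exact: SE.
    rewrite /closed_disc/=; apply: le_trans dr.
    by rewrite -lee_fin fineK// dist_le_diam.
  apply/lee_addgt0Pr => e e0.
  (* The disc has to contain [V k], so its radius is at least the diameter; [e] makes it positive
     when the diameter is zero, and the mean of the two inverses keeps it below [n.+1%:R^-1]. This
     is the room left by covering at the finer scale [n.+2%:R^-1]. *)
  pose r := Num.min (fine (diam (V k)) + e)%R ((n.+1%:R^-1 + n.+2%:R^-1) / 2)%R.
  have nn : (n.+2%:R^-1 < n.+1%:R^-1 :> R)%R.
    by rewrite ltf_pV2 ?posrE ?ltr0n// ltr_nat.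
  have n20 : (0 < n.+2%:R^-1 :> R)%R by rewrite invr_gt0 ltr0n.
  have r0 : (0 < r < n.+1%:R^-1)%R.
    rewrite /r; move: d0 nn n20 e0.
    move: (fine _) (n.+1%:R^-1)%R (n.+2%:R^-1)%R => a b c *.
    by rewrite lt_min gt_min; apply/andP; split;
      [apply/andP; split|apply/orP; right]; lra.
  have dr : (fine (diam (V k)) <= r)%R.
    rewrite /r; move: Vdk nn e0.
    move: (fine _) (n.+1%:R^-1)%R (n.+2%:R^-1)%R => a b c *.
    by rewrite le_min; apply/andP; split; lra.
  apply: (le_trans (le_hausdorff (AVd _ dr))).
  apply: (le_trans (Ap.2 _ r0)).
  rewrite -(fineK dfin) -EFinM -EFinD lee_fin.
  have : (r <= fine (diam (V k)) + e)%R by rewrite /r ge_min lexx.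
  lra.
apply/eqP; rewrite eq_le hausdorff_ge0 andbT.
apply: (@le_trans _ _ (H (\bigcup_n A n))).
  apply: le_hausdorff => p [Sp /upper_density_le0[d d0 Hd]].
  have [N rN] := ltr_add_invr d0; rewrite add0r in rN.
  exists N => //; split=> // r /andP[r0 rN']; apply: Hd.
  by rewrite r0 (lt_trans rN').
rewrite (le_trans (hausdorff_sigma_subadditive _))//.
by rewrite eseries0// => i _ _; exact: A0.
Qed.

End UpperDensity.

(** * The cone condition, sigma-finiteness and tangent lines *)

(** The axis is the kernel of a nonzero linear form rather than an angle, so that a linear change of
    coordinates acts on it by composition. At an isolated point of [E] any form will do. *)
Definition cone_at (R : realType) (E : set (plane R)) (p : plane R) : Prop :=
  exists a b : R, (a != 0) || (b != 0) /\
  forall e, 0 < e -> exists2 d, 0 < d & forall q, E q -> eucl_dist p q < d ->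
    `|a * (q.1 - p.1) + b * (q.2 - p.2)| <= e * eucl_dist p q.

Section ConeSigmaFinite.
Context {R : realType}.
Implicit Types (E S : set (plane R)) (p q : plane R).

(** The coordinate with the larger coefficient is controlled by the other one: if |b| <= |a|, a cone
    of opening |a| / 2 gives |u| / 2 <= 3 / 2 * |v|, hence the factor 3. *)
Lemma cone_at_slope E p : cone_at E p -> exists2 d, 0 < d &
  (forall q, E q -> eucl_dist p q < d -> `|q.1 - p.1| <= 3 * `|q.2 - p.2|) \/
  (forall q, E q -> eucl_dist p q < d -> `|q.2 - p.2| <= 3 * `|q.1 - p.1|).
Proof.
move=> [a [b [ab0 cone]]].
have key (x y u v : R) : `|y| <= `|x| -> x != 0 ->
    `|x * u + y * v| <= `|x| / 2 * (`|u| + `|v|) -> `|u| <= 3 * `|v|.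
  move=> yx x0 H; have x0' : 0 < `|x| by rewrite normr_gt0.
  have : `|x * u| <= `|x * u + y * v| + `|y * v|.
    by rewrite -[X in `|X| <= _](addrK (y * v)) ler_normB.
  rewrite !normrM => H'.
  have H2 : `|y| * `|v| <= `|x| * `|v| by rewrite ler_wpM2r.
  rewrite -(ler_pM2l x0'); nra.
have [ba|ab] := leP `|b| `|a|.
- have a0 : a != 0.
    apply: contraTneq ba => a0; rewrite a0 eqxx/= in ab0.
    by rewrite a0 normr0 normr_le0.
  have [d d0 Hd] := cone (`|a| / 2) ltac:(by rewrite divr_gt0// normr_gt0).
  exists d => //; left=> q Eq pq; apply: key ba a0 _.
  rewrite (le_trans (Hd q Eq pq))// ler_wpM2l ?divr_ge0//.
  by rewrite eucl_distC eucl_dist_le_l1.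
- have b0 : b != 0 by rewrite -normr_gt0 (le_lt_trans _ ab).
  have [d d0 Hd] := cone (`|b| / 2) ltac:(by rewrite divr_gt0// normr_gt0).
  exists d => //; right=> q Eq pq; apply: key (ltW ab) b0 _.
  rewrite addrC (le_trans (Hd q Eq pq))// ler_wpM2l ?divr_ge0// addrC.
  by rewrite eucl_distC eucl_dist_le_l1.
Qed.

(** [S] is parametrized by the values of [f] through a map of Lipschitz constant [c]. Cutting the
    interval of values into [N] equal parts gives pieces of diameter at most [c * w / N], with sum
    [c * w] whatever [N]; the scale [d] only decides how large [N] is. *)
Lemma hausdorff_lipschitz_fin S (f : plane R -> R) (c y w : R) : 0 <= c -> 0 < w ->
  (forall p q, S p -> S q -> eucl_dist p q <= c * `|f p - f q|) ->
  (forall p, S p -> y <= f p <= y + w) ->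
  (hausdorff_measure 1 S < +oo)%E.
Proof.
move=> c0 w0 Sf fS.
apply: (@le_lt_trans _ _ (c * w)%:E); last exact: ltey.
apply: (@hausdorff_le _ _ _ 1) => // d /andP[d0 _].
pose N := (Num.truncn (c * w / d)).+1.
have N0 : 0 < N%:R :> R by rewrite ltr0n.
have Nd : c * (w / N%:R) <= d.
  rewrite mulrA ler_pdivrMr// [d * _]mulrC -ler_pdivrMr//.
  have cwd : 0 <= c * w / d by rewrite divr_ge0 ?mulr_ge0// ltW.
  by have /andP[_ /ltW] := truncn_itv cwd.
pose V k : set (plane R) := [set p | S p /\ (k < N)%N /\
  y + k%:R * (w / N%:R) <= f p <= y + k.+1%:R * (w / N%:R)].
have SV : S `<=` \bigcup_k V k.
  move=> p Sp; have /andP[yf fy] := fS p Sp.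
  have wN0 : 0 < w / N%:R by rewrite divr_gt0.
  have z0 : 0 <= (f p - y) / (w / N%:R) by rewrite divr_ge0 ?subr_ge0// ltW.
  pose k := Num.truncn ((f p - y) / (w / N%:R)).
  have /andP[k1 k2] := truncn_itv z0; rewrite -/k in k1 k2.
  have [kN|Nk] := ltnP k N.
    exists k => //; split=> //; split=> //; apply/andP; split.
      by rewrite addrC -lerBrDr -ler_pdivlMr.
    by rewrite addrC -lerBlDr -ler_pdivrMr// ltW.
  (* Only the right end of the interval, [f p = y + w], is sent to the index [N]; it is put in the
     last piece. *)
  exists N.-1 => //; split=> //; split; first by rewrite /N.
  have NE : N%:R * (w / N%:R) = w by rewrite mulrC divfK// gt_eqF.
  rewrite prednK// NE fy andbT addrC -lerBrDr -ler_pdivlMr//.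
  by rewrite (le_trans _ k1)// ler_nat (leq_trans _ Nk)// leq_pred.
rewrite (le_trans (cover_weight_le d SV))//.
rewrite (nneseries_split 0 N)//; last by move=> k _; exact: diam_weight_ge0.
rewrite [X in (_ + X)%E]eseries0; last first.
  move=> k; rewrite /= add0n => Nk _; have -> : V k = set0.
    by apply/seteqP; split => // p [_ [kN _]]; move: kN; rewrite ltnNge Nk.
  exact: diam_weight0.
rewrite adde0 add0n.
apply: (@le_trans _ _ (\sum_(0 <= k < N) (c * (w / N%:R))%:E)%E).
  rewrite !big_mkord; apply: lee_sum => k _; apply: diam_weight_le.
    by rewrite Nd mulr_ge0// divr_ge0// ltW.
  move=> p q [Sp [_ /andP[p1 p2]]] [Sq [_ /andP[q1 q2]]].
  rewrite (le_trans (Sf _ _ Sp Sq))// ler_wpM2l// ler_norml.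
  by move: p1 p2 q1 q2; rewrite -natr1 mulrDl mul1r => *; apply/andP; split; lra.
rewrite big_mkord sumEFin lee_fin sumr_const card_ord -[leLHS]mulr_natl.
have -> : N%:R * (c * (w / N%:R)) = c * w by field; rewrite gt_eqF.
exact: lexx.
Qed.

(** The radius [n.+1%:R^-1] on which the slope bound holds and the coordinate [b] chosen as
    parameter are countable data. Cutting further by a grid of half this side puts any two points of
    a piece within reach of each other, so that their distance is at most 1 + 3 times the variation
    of the parameter. *)
Lemma cone_sigma_finite E : (forall p, E p -> cone_at E p) ->
  exists S : (set (plane R))^nat,
    [/\ E `<=` \bigcup_k S k, forall k, S k `<=` E &
        forall k, (hausdorff_measure 1 (S k) < +oo)%E].
Proof.
move=> Econe.
pose slope (b : bool) p q := if b then `|q.1 - p.1| <= 3 * `|q.2 - p.2|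
  else `|q.2 - p.2| <= 3 * `|q.1 - p.1|.
pose M n : R := (2 * n.+1)%:R.
have M0 n : 0 < M n by rewrite ltr0n.
pose P (x : nat * bool * int * int) : set (plane R) :=
  let: (n, b, i, j) := x in
  [set p | [/\ E p, forall q, E q -> eucl_dist p q < n.+1%:R^-1 -> slope b p q,
    Num.floor (M n * p.1) = i & Num.floor (M n * p.2) = j]].
have PE x : P x `<=` E by case: x => [[[n b] i] j] p [].
have Pfin x : (hausdorff_measure 1 (P x) < +oo)%E.
  case: x => [[[n b] i] j].
  have cell (x y : R) k : Num.floor (M n * x) = k -> Num.floor (M n * y) = k ->
      `|x - y| < (M n)^-1.
    move=> xk yk; have := floor_itv (M n * x); have := floor_itv (M n * y).
    rewrite xk yk !intrD1 => /andP[y1 y2] /andP[x1 x2].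
    rewrite -(ltr_pM2l (M0 n)) divff ?gt_eqF// -{1}(gtr0_norm (M0 n)) -normrM.
    by rewrite mulrBr ltr_norml; apply/andP; split; lra.
  have near p q : P (n, b, i, j) p -> P (n, b, i, j) q -> slope b p q.
    move=> [Ep ps pi pj] [Eq qs qi qj]; apply: ps => //.
    rewrite (le_lt_trans (eucl_dist_le_l1 _ _))//.
    have -> : n.+1%:R^-1 = (M n)^-1 + (M n)^-1 :> R.
      by rewrite /M natrM invfM -mulrDl (_ : 2^-1 + 2^-1 = 1) ?mul1r//; field.
    by exact: ltrD (cell _ _ i pi qi) (cell _ _ j pj qj).
  pose f (p : plane R) := if b then p.2 else p.1.
  pose k := if b then j else i.
  apply: (@hausdorff_lipschitz_fin _ f 4 (k%:~R / M n) (M n)^-1) => //.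
  - by rewrite invr_gt0.
  - move=> p q Pp Pq; rewrite (le_trans (eucl_dist_le_l1 _ _))//.
    have := near q p Pq Pp; rewrite /slope /f; case: b {near f k cell Pp Pq} => *; lra.
  - move=> p [_ _ pi pj]; rewrite /f /k; case: b {near f k cell}.
      have := floor_itv (M n * p.2); rewrite pj intrD1 => /andP[h1 h2].
      by rewrite ler_pdivrMr// mulrC h1/= -[X in _ + X]mul1r -mulrDl ler_pdivlMr// mulrC ltW.
    have := floor_itv (M n * p.1); rewrite pi intrD1 => /andP[h1 h2].
    by rewrite ler_pdivrMr// mulrC h1/= -[X in _ + X]mul1r -mulrDl ler_pdivlMr// mulrC ltW.
pose S k : set (plane R) := if unpickle k is Some x then P x else set0.
exists S; split.
- move=> p Ep; have [d d0 Hd] := cone_at_slope (Econe p Ep).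
  have [n nd] := ltr_add_invr d0; rewrite add0r in nd.
  have [b Hb] : exists b, forall q, E q -> eucl_dist p q < n.+1%:R^-1 -> slope b p q.
    by case: Hd => Hd; [exists true|exists false] => q Eq pq; apply: Hd => //;
      exact: lt_trans nd.
  exists (pickle (n, b, Num.floor (M n * p.1), Num.floor (M n * p.2))) => //.
  by rewrite /S pickleK.
- by move=> k; rewrite /S; case: unpickle => // x; exact: PE.
- by move=> k; rewrite /S; case: unpickle => [x|]; rewrite ?hausdorff_set0.
Qed.

End ConeSigmaFinite.

Section ConeTangent.
Context {R : realType}.
Implicit Types (E S : set (plane R)) (p q : plane R).

Lemma polar_angle (x y : R) : x ^+ 2 + y ^+ 2 = 1 ->
  exists phi, cos phi = x /\ sin phi = y.
Proof.
move=> xy1; have x1 : -1 <= x <= 1.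
  by rewrite -ler_norml -(@expr_le1 _ 2)// real_normK ?num_real// -xy1 lerDl sqr_ge0.
have s2 : sin (acos x) = `|y|.
  by rewrite sin_acos// -xy1 addrC addKr sqrtr_sqr.
have [y0|y0] := leP 0 y.
  by exists (acos x); rewrite acosK// s2 ger0_norm.
by exists (- acos x); rewrite cosN sinN acosK// s2 ltr0_norm// opprK.
Qed.

(** The quantity bounded is the distance from [q] to the line through [p], that is, the distance to
    [p] times the sine of the angle; continuity of [asin] at 0 turns it into a bound on the angle.
    The sign of the component along the line selects the wedge. *)
Lemma wedge_of_small_angle (phi eta : R) : 0 < eta -> exists2 e, 0 < e &
  forall p q r, eucl_dist p q <= r ->
    `|cos phi * (q.2 - p.2) - sin phi * (q.1 - p.1)| <= e * eucl_dist p q ->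
    (wedge p phi r eta `|` wedge p (phi + pi) r eta) q.
Proof.
move=> eta0.
have /cvgrPdist_lt/(_ _ eta0) : asin x @[x --> (0 : R)] --> asin 0.
  by apply: continuous_asin; rewrite ltrN10 ltr01.
move=> /nbhs_ballP[e /= e0 He].
(* The bound [2^-1] keeps the sine [w] in the domain of [asin]. *)
exists (Num.min (e / 2) 2^-1); first by rewrite lt_min divr_gt0//= invr_gt0.
move=> p q r pqr.
have [pq0|pq0] := eqVneq (eucl_dist p q) 0.
  move=> _; left; exists 0, phi; split.
  - by rewrite lexx -pq0.
  - by rewrite subrr normr0 ltW.
  - by rewrite scale0r addr0 (eucl_dist_eq0 pq0).
set rho := eucl_dist p q => H.
have rho0 : 0 < rho by rewrite lt_neqAle eq_sym pq0 eucl_dist_ge0.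
pose v1 := (q.1 - p.1) / rho; pose v2 := (q.2 - p.2) / rho.
pose u := cos phi * v1 + sin phi * v2.
pose w := cos phi * v2 - sin phi * v1.
have cs := cos2Dsin2 phi.
have v12 : v1 ^+ 2 + v2 ^+ 2 = 1.
  rewrite /v1 /v2 !expr_div_n -mulrDl -sqrrN opprB -(sqrrN (q.2 - _)) opprB.
  by rewrite -eucl_dist_sqr divff// expf_neq0.
have uw : u ^+ 2 + w ^+ 2 = 1.
  have -> : u ^+ 2 + w ^+ 2 =
    (cos phi ^+ 2 + sin phi ^+ 2) * (v1 ^+ 2 + v2 ^+ 2) by rewrite /u /w; ring.
  by rewrite cs v12 mulr1.
have wE : w = (cos phi * (q.2 - p.2) - sin phi * (q.1 - p.1)) / rho.
  by rewrite /w /v1 /v2; field.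
have wle : `|w| <= Num.min (e / 2) 2^-1.
  by rewrite wE normrM normfV (gtr0_norm rho0) ler_pdivrMr.
have we : `|w| < e.
  by rewrite (le_lt_trans wle)// gt_min ltr_pdivrMr// ltr_pMr ?ltr1n.
have w1 : -1 <= w <= 1.
  by rewrite -ler_norml (le_trans wle)// ge_min invf_le1 ?ler1n ?orbT.
have asw : `|asin w| <= eta.
  have asin0 : asin (0 : R) = 0.
    by rewrite -{1}sin0 sinK// in_itv/= oppr_le0 divr_ge0// pi_ge0.
  have := He w; rewrite /ball/= sub0r normrN asin0 sub0r normrN => /(_ we).
  exact: ltW.
have cosw : cos (asin w) = `|u| by rewrite cos_asin// -uw addrK sqrtr_sqr.
have qE t : cos t = v1 -> sin t = v2 -> q = p + rho *: (cos t, sin t).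
  move=> -> ->; rewrite [RHS]surjective_pairing [LHS]surjective_pairing/=.
  by rewrite /v1 /v2; congr (_, _); rewrite /GRing.scale/= mulrC divfK// addrC subrK.
have v1E : v1 = cos phi * u - sin phi * w.
  have -> : cos phi * u - sin phi * w = (cos phi ^+ 2 + sin phi ^+ 2) * v1.
    by rewrite /u /w; ring.
  by rewrite cs mul1r.
have v2E : v2 = sin phi * u + cos phi * w.
  have -> : sin phi * u + cos phi * w = (cos phi ^+ 2 + sin phi ^+ 2) * v2.
    by rewrite /u /w; ring.
  by rewrite cs mul1r.
have [u0|u0] := leP 0 u.
- left; exists rho, (phi + asin w); split.
  + by rewrite ltW.
  + by rewrite addrC addKr.
  + by apply: qE; rewrite (cosD, sinD) asinK// cosw (ger0_norm u0) (v1E, v2E).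
- right; exists rho, (phi + pi - asin w); split.
  + by rewrite ltW.
  + by rewrite addrC addKr normrN.
  + apply: qE.
      by rewrite cosB cosDpi sinDpi asinK// cosw (ltr0_norm u0) v1E; ring.
    by rewrite sinB cosDpi sinDpi asinK// cosw (ltr0_norm u0) v2E; ring.
Qed.

Lemma cone_tangent_line E p : (hausdorff_measure 1).-caratheodory E ->
  (0 < upper_density 1 E p)%E -> cone_at E p -> has_tangent_line 1 E p.
Proof.
move=> mE dE [a [b [ab0 cone]]].
pose N := Num.sqrt (a ^+ 2 + b ^+ 2).
have N20 : 0 < a ^+ 2 + b ^+ 2.
  by case/orP: ab0 => ab0; [apply: ltr_pwDl|apply: ltr_wpDl];
    rewrite ?sqr_ge0// lt_neqAle sqr_ge0 eq_sym sqrf_eq0 ab0.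
have N0 : 0 < N by rewrite sqrtr_gt0.
have N2 : N ^+ 2 = a ^+ 2 + b ^+ 2 by rewrite sqr_sqrtr// ltW.
(* The unit vector that spans the kernel of the form with coefficients [a] and [b]. *)
have [phi [cphi sphi]] : exists phi, cos phi = - b / N /\ sin phi = a / N.
  apply: polar_angle; rewrite !expr_div_n -mulrDl sqrrN addrC -N2 divff//.
  by rewrite expf_neq0// gt_eqF.
exists phi; split=> // eta eta0.
have [e e0 He] := wedge_of_small_angle phi eta0.
have [d d0 Hd] := cone (e * N) (mulr_gt0 e0 N0).
apply: cvg_near_cst; near=> r.
have -> : E `&` (closed_disc p r `\`
    (wedge p phi r eta `|` wedge p (phi + pi) r eta)) = set0.
  apply/seteqP; split => // q [Eq [pqr]]; apply.
  apply: He => //; rewrite cphi sphi.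
  have -> : - b / N * (q.2 - p.2) - a / N * (q.1 - p.1) =
    - ((a * (q.1 - p.1) + b * (q.2 - p.2)) / N) by field; rewrite gt_eqF.
  rewrite normrN normrM normfV (gtr0_norm N0) ler_pdivrMr// mulrAC.
  apply: Hd => //; apply: le_lt_trans pqr _.
  by near: r; exact: nbhs_right_lt.
by rewrite hausdorff_set0 mul0e.
Unshelve. all: by end_near. Qed.

(** Finiteness of the measure is known on the pieces [S k] only, while the density is that of the
    whole of [E]; this is why [upper_density_gt0_ae] is stated for a subset [S] of [E]. *)
Lemma cone_ae_tangent_line E : (hausdorff_measure 1).-caratheodory E ->
  (forall p, E p -> cone_at E p) ->
  hausdorff_ae 1 E (has_tangent_line 1 E).
Proof.
move=> mE Econe; split=> //.
have [S [ES SE Sfin]] := cone_sigma_finite Econe.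
exists [set p | E p /\ (0 < upper_density 1 E p)%E]; split.
- by move=> p [].
- apply/eqP; rewrite eq_le hausdorff_ge0 andbT.
  apply: (@le_trans _ _ (hausdorff_measure 1
      (\bigcup_k (S k `&` [set p | ~ (0 < upper_density 1 E p)%E])))).
    apply: le_hausdorff => p [Ep np]; have [k _ Skp] := ES _ Ep.
    by exists k => //; split=> // dp; apply: np.
  rewrite (le_trans (hausdorff_sigma_subadditive _))//.
  by rewrite eseries0// => k _ _; apply: upper_density_gt0_ae.
- by move=> p [Ep dp]; apply: cone_tangent_line => //; exact: Econe.
Qed.

End ConeTangent.

(** * Algebra of the second and third derivatives of the perimeter *)

(* [k i] and [s i] are the cosine and sine of the angle at the i-th vertex, [a],
   [b], [c] the lengths of the sides opposite to the vertices 1, 2, 3 and [kap i]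
   the curvatures.  The [H ij] and [L ijk] are the second and third derivatives of
   the perimeter as a function of the arc length parameters of the vertices; the
   [L iii] involve the derivative of the curvature, and remain arbitrary. *)
Section PerimeterAlgebra.
Context {R : realFieldType}.
Variables (k1 k2 k3 s1 s2 s3 a b c kap1 kap2 kap3 L111 L222 L333 : R).

Let H11 := s1 ^+ 2 * (b^-1 + c^-1) - 2 * kap1 * s1.
Let H22 := s2 ^+ 2 * (c^-1 + a^-1) - 2 * kap2 * s2.
Let H33 := s3 ^+ 2 * (a^-1 + b^-1) - 2 * kap3 * s3.
Let H12 := s1 * s2 / c.
Let H23 := s2 * s3 / a.
Let H31 := s3 * s1 / b.

(** Derivatives of the length of the side that runs from vertex i to vertex j, the only term of the
    perimeter that depends on both; [perimeter_d3_ijj] differentiates twice at the far end, where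
    the cosine enters with the opposite sign. *)
Definition perimeter_d3_iij (ki si kapi kj sj l : R) :=
  (2 * ki * si * sj / l - ki * sj * kapi - si ^+ 2 * kj / l) / l.

Definition perimeter_d3_ijj (ki si kj sj kapj l : R) :=
  (ki * sj ^+ 2 / l + si * kj * kapj - 2 * si * sj * kj / l) / l.

Let L112 := perimeter_d3_iij k1 s1 kap1 k2 s2 c.
Let L122 := perimeter_d3_ijj k1 s1 k2 s2 kap2 c.
Let L223 := perimeter_d3_iij k2 s2 kap2 k3 s3 a.
Let L233 := perimeter_d3_ijj k2 s2 k3 s3 kap3 a.
Let L331 := perimeter_d3_iij k3 s3 kap3 k1 s1 b.
Let L311 := perimeter_d3_ijj k3 s3 k1 s1 kap1 b.

(** Contraction of the third derivative with a vector in two of its arguments. There is no term in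
    [y * z] because no side depends on three vertices; [Likk] is taken twice at i and once at k,
    [Likk'] once at i and twice at k. *)
Definition perimeter_d3_row (Liii Liij Likk Lijj Likk' x y z : R) :=
  Liii * x ^+ 2 + 2 * Liij * x * y + 2 * Likk * x * z + Lijj * y ^+ 2 +
  Likk' * z ^+ 2.

Let Q1 x1 x2 x3 := perimeter_d3_row L111 L112 L311 L122 L331 x1 x2 x3.
Let Q2 x1 x2 x3 := perimeter_d3_row L222 L223 L122 L233 L112 x2 x3 x1.
Let Q3 x1 x2 x3 := perimeter_d3_row L333 L331 L233 L311 L223 x3 x1 x2.
Let C x1 x2 x3 y1 y2 y3 :=
  y1 * Q1 x1 x2 x3 + y2 * Q2 x1 x2 x3 + y3 * Q3 x1 x2 x3.

Hypotheses (s10 : 0 < s1) (s20 : 0 < s2) (s30 : 0 < s3).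
Hypotheses (a0 : 0 < a) (b0 : 0 < b) (c0 : 0 < c).
Hypotheses (abc : a < b + c) (bca : b < c + a) (cab : c < a + b).
Hypotheses (k12 : 0 < k1 * k2) (k13 : 0 < k1 * k3).

Variables (u1 u2 u3 v1 v2 v3 : R).
Hypotheses (Hu1 : H11 * u1 + H12 * u2 + H31 * u3 = 0)
  (Hu2 : H12 * u1 + H22 * u2 + H23 * u3 = 0)
  (Hu3 : H31 * u1 + H23 * u2 + H33 * u3 = 0)
  (Hv1 : H11 * v1 + H12 * v2 + H31 * v3 = 0)
  (Hv2 : H12 * v1 + H22 * v2 + H23 * v3 = 0)
  (Hv3 : H31 * v1 + H23 * v2 + H33 * v3 = 0).
Hypotheses (Cuu : C u1 u2 u3 u1 u2 u3 = 0) (Cuv : C u1 u2 u3 v1 v2 v3 = 0)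
  (Cvu : C v1 v2 v3 u1 u2 u3 = 0) (Cvv : C v1 v2 v3 v1 v2 v3 = 0).

(** The cross product of the two kernel vectors. Each row of the Hessian is orthogonal to both,
    hence proportional to it. *)
Let n1 := u2 * v3 - u3 * v2.
Let n2 := u3 * v1 - u1 * v3.
Let n3 := u1 * v2 - u2 * v1.

(** The third derivative is symmetric, so [Cuu], [Cuv], [Cvu] and [Cvv] give its values at all
    triples made of [u] and [v], and the cubic form vanishes on the plane they span. *)
Let C_comb (x y : R) :
  let w1 := x * u1 + y * v1 in let w2 := x * u2 + y * v2 in
  let w3 := x * u3 + y * v3 in C w1 w2 w3 w1 w2 w3 = 0.
Proof.
move=> w1 w2 w3; rewrite /w1 /w2 /w3 {w1 w2 w3}.
have -> : C (x * u1 + y * v1) (x * u2 + y * v2) (x * u3 + y * v3)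
    (x * u1 + y * v1) (x * u2 + y * v2) (x * u3 + y * v3) =
    x ^+ 3 * C u1 u2 u3 u1 u2 u3 + 3 * x ^+ 2 * y * C u1 u2 u3 v1 v2 v3 +
    3 * x * y ^+ 2 * C v1 v2 v3 u1 u2 u3 + y ^+ 3 * C v1 v2 v3 v1 v2 v3.
  by rewrite /C /Q1 /Q2 /Q3 /perimeter_d3_row; ring.
by rewrite Cuu Cuv Cvu Cvv; ring.
Qed.

(* Two independent directions in the kernel of the Hessian on which the third
   derivative vanishes force the rank of the Hessian to be one, which determines
   the curvatures, and the cubic form to vanish on the whole kernel; eliminating
   the [L iii] from its values at three vectors leaves a sum of terms of one sign. *)
Lemma perimeter_kernel_collinear : u1 * v2 - u2 * v1 = 0.
Proof.
rewrite -/n3; apply/eqP/negPn/negP => n30.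
have a_neq0 : a != 0 by rewrite gt_eqF.
have b_neq0 : b != 0 by rewrite gt_eqF.
have c_neq0 : c != 0 by rewrite gt_eqF.
have s1_neq0 : s1 != 0 by rewrite gt_eqF.
have s2_neq0 : s2 != 0 by rewrite gt_eqF.
have s3_neq0 : s3 != 0 by rewrite gt_eqF.
have neq := (a_neq0, b_neq0, c_neq0, s1_neq0, s2_neq0, s3_neq0).
have H12n3 : H12 * n3 = H31 * n2.
  rewrite -[H31 * n2]addr0 -[X in _ + X](mulr0 u1) -Hv1 /n3 /n2.
  rewrite -[LHS]addr0 -[X in _ + X](mulr0 v1) -Hu1; ring.
have row2 : H12 * n2 = H22 * n1.
  rewrite -[H22 * n1]addr0 -[X in _ + X](mulr0 u3) -Hv2 /n1 /n2.
  rewrite -[LHS]addr0 -[X in _ + X](mulr0 v3) -Hu2; ring.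
have row2' : H12 * n3 = H23 * n1.
  rewrite -[H23 * n1]addr0 -[X in _ + X](mulr0 (- u2)) -Hv2 /n1 /n3.
  rewrite -[LHS]addr0 -[X in _ + X](mulr0 (- v2)) -Hu2; ring.
have row1 : H11 * n2 = H12 * n1.
  rewrite -[H12 * n1]addr0 -[X in _ + X](mulr0 u3) -Hv1 /n1 /n2.
  rewrite -[LHS]addr0 -[X in _ + X](mulr0 v3) -Hu1; ring.
have row2'' : H22 * n3 = H23 * n2.
  rewrite -[H23 * n2]addr0 -[X in _ + X](mulr0 u1) -Hv2 /n3 /n2.
  rewrite -[LHS]addr0 -[X in _ + X](mulr0 v1) -Hu2; ring.
have row3 : H23 * n3 = H33 * n2.
  rewrite -[H33 * n2]addr0 -[X in _ + X](mulr0 u1) -Hv3 /n3 /n2.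
  rewrite -[LHS]addr0 -[X in _ + X](mulr0 v1) -Hu3; ring.
(* Proportionality to the rows, whose off-diagonal entries are [s1 * s2 / c] and its permutations,
   forces the cross product to be [t] times [(s1 * a, s2 * b, s3 * c)]. *)
pose t := n3 / (s3 * c).
have n3E : n3 = t * (s3 * c) by rewrite /t; field; rewrite !neq.
have t0 : t != 0 by rewrite /t mulf_neq0// invr_neq0// mulf_neq0.
clearbody t.
have n2E : n2 = t * (s2 * b).
  have -> : n2 = (H12 * n3) / H31 by rewrite H12n3 /H31; field; rewrite !neq.
  by rewrite n3E /H12 /H31; field; rewrite !neq.
have n1E : n1 = t * (s1 * a).
  have -> : n1 = (H12 * n3) / H23 by rewrite row2' /H23; field; rewrite !neq.
  by rewrite n3E /H12 /H23; field; rewrite !neq.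
have kap1E : kap1 = s1 * (b + c - a) / (2 * b * c).
  have : H11 = H12 * n1 / n2.
    by rewrite -row1 mulfK// n2E !mulf_eq0 !negb_or t0 !neq.
  have -> : kap1 = (s1 ^+ 2 * (b^-1 + c^-1) - H11) / (2 * s1).
    by rewrite /H11; field; rewrite !neq.
  move=> ->; rewrite n1E n2E /H12; by field; rewrite !neq t0.
have kap2E : kap2 = s2 * (c + a - b) / (2 * c * a).
  have : H22 = H23 * n2 / n3.
    by rewrite -row2'' mulfK// n3E !mulf_eq0 !negb_or t0 !neq.
  have -> : kap2 = (s2 ^+ 2 * (c^-1 + a^-1) - H22) / (2 * s2).
    by rewrite /H22; field; rewrite !neq.
  move=> ->; rewrite n2E n3E /H23; by field; rewrite !neq t0.
have kap3E : kap3 = s3 * (a + b - c) / (2 * a * b).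
  have : H33 = H23 * n3 / n2.
    by rewrite row3 mulfK// n2E !mulf_eq0 !negb_or t0 !neq.
  have -> : kap3 = (s3 ^+ 2 * (a^-1 + b^-1) - H33) / (2 * s3).
    by rewrite /H33; field; rewrite !neq.
  move=> ->; rewrite n2E n3E /H23; by field; rewrite !neq t0.
(* The kernel vectors with a zero coordinate, [(n2, - n1, 0)], [(0, n3, - n2)] and [(- n3, 0, n1)].
   With the weights [n3 ^+ 3], [n1 ^+ 3], [n2 ^+ 3], the sum of the cubic values contains no [L iii]
   any more. *)
have e1 := C_comb (- v3) u3.
have e2 := C_comb (- v1) u1.
have e3 := C_comb (- v2) u2.
rewrite /= in e1 e2 e3.
have e : - L112 * n2 * n3 ^+ 2 + L122 * n1 * n3 ^+ 2 - L223 * n3 * n1 ^+ 2 +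
    L233 * n2 * n1 ^+ 2 - L331 * n1 * n2 ^+ 2 + L311 * n3 * n2 ^+ 2 = 0.
  have nn : 3 * n1 * n2 * n3 != 0.
    by rewrite n1E n2E n3E !mulf_eq0 !negb_or t0 !neq pnatr_eq0.
  apply: (mulfI nn); rewrite mulr0.
  transitivity (n3 ^+ 3 * 0 + n1 ^+ 3 * 0 + n2 ^+ 3 * 0 : R); last by ring.
  rewrite -{1}e1 -{1}e2 -{1}e3 /C /Q1 /Q2 /Q3 /perimeter_d3_row /n1 /n2 /n3.
  ring.
(* Once the curvatures are substituted, the sum is a combination of the cosines whose coefficients
   are positive by the triangle inequality; the cosines have a common sign, negative if the triangle
   turns clockwise. *)
have : t ^+ 3 * (s1 * s2 * s3 * (k1 * s2 * s3 * (b + c - a) +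
    k2 * s3 * s1 * (c + a - b) + k3 * s1 * s2 * (a + b - c))) = 0.
  rewrite -[RHS]oppr0 -e n1E n2E n3E /L112 /L122 /L223 /L233 /L331 /L311.
  rewrite /perimeter_d3_iij /perimeter_d3_ijj kap1E kap2E kap3E.
  by field; rewrite !neq.
apply/eqP; apply: mulf_neq0; first exact: expf_neq0.
apply: mulf_neq0; first by rewrite !mulf_eq0 !negb_or !neq.
have p1 : 0 < b + c - a by rewrite subr_gt0.
have p2 : 0 < c + a - b by rewrite subr_gt0.
have p3 : 0 < a + b - c by rewrite subr_gt0.
move: (b + c - a) (c + a - b) (a + b - c) p1 p2 p3 => r1 r2 r3 p1 p2 p3.
have [k10|k10|k10] := ltgtP 0 k1.
- have k20 : 0 < k2 by rewrite -(pmulr_rgt0 _ k10).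
  have k30 : 0 < k3 by rewrite -(pmulr_rgt0 _ k10).
  by rewrite gt_eqF// !addr_gt0// !mulr_gt0.
- have k20 : k2 < 0 by rewrite -(nmulr_rgt0 _ k10).
  have k30 : k3 < 0 by rewrite -(nmulr_rgt0 _ k10).
  rewrite lt_eqF// -oppr_gt0 !opprD -!mulNr.
  by rewrite !addr_gt0// !mulr_gt0// ?oppr_gt0.
- by move: k12; rewrite -k10 mul0r ltxx.
Qed.

End PerimeterAlgebra.

(** * Second order expansions along a filter *)

(* Second order expansion along a filter in a small parameter [sg]: the first order
   coefficient [X1] is kept as a function, because it converges more slowly than
   the expansion can tolerate; [l1] is its limit. *)
Section Jets.
Context {R : realType} {T : Type} (U : set_system T) {FU : ProperFilter U}.
Variable sg : T -> R.

Definition jet X (X0 : R) (X1 : T -> R) (l1 X2 : R) : Prop :=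
  X1 @ U --> l1 /\ exists2 r : T -> R, r @ U --> X2 &
    \forall q \near U, X q = X0 + sg q * X1 q + sg q ^+ 2 * r q.

Lemma jetD X Y X0 X1 l1 X2 Y0 Y1 m1 Y2 : jet X X0 X1 l1 X2 -> jet Y Y0 Y1 m1 Y2 ->
  jet (fun q => X q + Y q) (X0 + Y0) (fun q => X1 q + Y1 q) (l1 + m1) (X2 + Y2).
Proof.
move=> [cX1 [r cr Xr]] [cY1 [s cs Ys]]; split; first exact: cvgD.
exists (fun q => r q + s q); first exact: cvgD.
by near=> q; rewrite (near Xr q)// (near Ys q)//; ring.
Unshelve. all: by end_near. Qed.

Lemma jetZ a X X0 X1 l1 X2 : jet X X0 X1 l1 X2 ->
  jet (fun q => a * X q) (a * X0) (fun q => a * X1 q) (a * l1) (a * X2).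
Proof.
move=> [cX1 [r cr Xr]]; split; first by apply: cvgM => //; exact: cvg_cst.
exists (fun q => a * r q); first by apply: cvgM => //; exact: cvg_cst.
by near=> q; rewrite (near Xr q)//; ring.
Unshelve. all: by end_near. Qed.

Lemma jetB X Y X0 X1 l1 X2 Y0 Y1 m1 Y2 : jet X X0 X1 l1 X2 -> jet Y Y0 Y1 m1 Y2 ->
  jet (fun q => X q - Y q) (X0 - Y0) (fun q => X1 q - Y1 q) (l1 - m1) (X2 - Y2).
Proof.
move=> [cX1 [r cr Xr]] [cY1 [s cs Ys]]; split; first exact: cvgB.
exists (fun q => r q - s q); first exact: cvgB.
by near=> q; rewrite (near Xr q)// (near Ys q)//; ring.
Unshelve. all: by end_near. Qed.

Hypothesis sg0 : sg @ U --> (0 : R).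

Lemma jetM X Y X0 X1 l1 X2 Y0 Y1 m1 Y2 : jet X X0 X1 l1 X2 -> jet Y Y0 Y1 m1 Y2 ->
  jet (fun q => X q * Y q) (X0 * Y0) (fun q => X0 * Y1 q + X1 q * Y0)
    (X0 * m1 + l1 * Y0) (X0 * Y2 + X2 * Y0 + l1 * m1).
Proof.
move=> [cX1 [r cr Xr]] [cY1 [s cs Ys]]; split.
  by apply: cvgD; apply: cvgM => //; exact: cvg_cst.
exists (fun q => X0 * s q + r q * Y0 + X1 q * Y1 q +
    sg q * (X1 q * s q + r q * Y1 q + sg q * (r q * s q))).
  rewrite -[X in _ --> X]addr0; apply: cvgD.
    by apply: cvgD; [apply: cvgD|]; apply: cvgM => //; exact: cvg_cst.
  rewrite -[X in _ --> X](mul0r (l1 * Y2 + X2 * m1 + 0 * (X2 * Y2))).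
  apply: cvgM => //; apply: cvgD; first by apply: cvgD; exact: cvgM.
  by apply: cvgM => //; exact: cvgM.
by near=> q; rewrite (near Xr q)// (near Ys q)//; ring.
Unshelve. all: by end_near. Qed.

Lemma jet_ext X Y X0 X1 l1 X2 : (\forall q \near U, X q = Y q) ->
  jet X X0 X1 l1 X2 -> jet Y X0 X1 l1 X2.
Proof.
move=> XY [cX1 [r cr Xr]]; split=> //; exists r => //.
by near=> q; rewrite -(near XY q)// (near Xr q).
Unshelve. all: by end_near. Qed.

Hypothesis sg_neq0 : \forall q \near U, sg q != 0.

Section Vanishing.
Variables (X : T -> R) (X0 : R) (X1 : T -> R) (l1 X2 : R).
Hypotheses (jX : jet X X0 X1 l1 X2) (X00 : X0 = 0).
Hypothesis Xeq0 : \forall q \near U, X q = 0.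

Lemma jet_vanish1 : l1 = 0.
Proof.
have [cX1 [r cr Xr]] := jX.
have : X1 @ U --> (0 : R).
  have : (fun q => - (sg q * r q)) @ U --> (0 : R).
    by rewrite -oppr0 -(mul0r X2); apply: cvgN; exact: cvgM.
  apply: cvg_trans; apply: near_eq_cvg; near=> q.
  have sq : sg q != 0 by near: q.
  have Xq0 : X q = 0 by near: q.
  have : X q = X0 + sg q * X1 q + sg q ^+ 2 * r q by near: q.
  by rewrite Xq0 X00 => Xq; apply: (mulfI sq); rewrite -[LHS]add0r Xq; ring.
by move=> /(cvg_unique _ cX1) ->.
Unshelve. all: by end_near. Qed.

(** Division by [sg ^+ 2] requires [X1] itself to vanish: a mere limit zero would leave a quotient
    [X1 / sg] that need not be bounded. *)
Lemma jet_vanish2 : (forall q, X1 q = 0) -> X2 = 0.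
Proof.
move=> X10; have [_ [r cr Xr]] := jX.
have : r @ U --> (0 : R).
  apply: cvg_near_cst; near=> q.
  have sq : sg q != 0 by near: q.
  have Xq0 : X q = 0 by near: q.
  have : X q = X0 + sg q * X1 q + sg q ^+ 2 * r q by near: q.
  rewrite Xq0 X00 X10 mulr0 !add0r => /esym/eqP.
  by rewrite mulf_eq0 expf_eq0/= (negPf sq) => /eqP.
by move=> /(cvg_unique _ cr) ->.
Unshelve. all: by end_near. Qed.

End Vanishing.

End Jets.

Definition perimeter_d2 (R : realFieldType) (s b c kapi : R) : R :=
  s ^+ 2 * (b^-1 + c^-1) - 2 * kapi * s.

Section VertexJet.
Context {R : realType} {T : Type} (U : set_system T) {FU : ProperFilter U}.
Variable sg : T -> R.
Hypothesis sg0 : sg @ U --> (0 : R).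
Variables (k1 s1 k2 s2 k3 s3 b c kap1 kap2 kap3 dkap1 : R).
Variables (x1 x2 x3 : T -> R) (u1 u2 u3 : R).
Hypotheses (s10 : s1 != 0) (b0 : b != 0) (c0 : c != 0).

Definition perimeter_d3_iii : R :=
  2 * s1 * (kap1 * k1 / (2 * b) - kap1 * k1 / (2 * c) + k1 * s1 / c ^+ 2 -
    k1 * s1 / b ^+ 2 - dkap1) +
  k1 * ((s1 / c - kap1) ^+ 2 - (s1 / b - kap1) ^+ 2).

(* In complex notation, [X] is the chord from the vertex to the next one, divided
   by its unperturbed direction, [Y] is the chord from the previous vertex, likewise,
   and [Z] is the unit tangent divided by the unperturbed one; the reflection law
   says that [X * Y * conj Z ^ 2] is real. *)
Lemma vertex_jet (XR XI YR YI ZR ZI : T -> R) :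
  jet U sg XR c (fun q => x2 q * k2 - x1 q * k1) (u2 * k2 - u1 * k1)
    (- (u2 ^+ 2 / 2 * kap2 * s2) - u1 ^+ 2 / 2 * kap1 * s1) ->
  jet U sg XI 0 (fun q => x2 q * s2 + x1 q * s1) (u2 * s2 + u1 * s1)
    (u2 ^+ 2 / 2 * kap2 * k2 - u1 ^+ 2 / 2 * kap1 * k1) ->
  jet U sg YR b (fun q => x1 q * k1 - x3 q * k3) (u1 * k1 - u3 * k3)
    (- (u1 ^+ 2 / 2 * kap1 * s1) - u3 ^+ 2 / 2 * kap3 * s3) ->
  jet U sg YI 0 (fun q => x1 q * s1 + x3 q * s3) (u1 * s1 + u3 * s3)
    (u1 ^+ 2 / 2 * kap1 * k1 - u3 ^+ 2 / 2 * kap3 * k3) ->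
  jet U sg ZR 1 (fun=> 0) 0 (- (u1 ^+ 2 / 2 * kap1 ^+ 2)) ->
  jet U sg ZI 0 (fun q => x1 q * kap1) (u1 * kap1) (u1 ^+ 2 / 2 * dkap1) ->
  (\forall q \near U, (XR q * YI q + XI q * YR q) * (ZR q ^+ 2 - ZI q ^+ 2) -
    (XR q * YR q - XI q * YI q) * (2 * (ZR q * ZI q)) = 0) ->
  exists2 V : R, jet U sg (fun=> 0) 0
    (fun q => perimeter_d2 s1 b c kap1 * x1 q + s1 * s2 / c * x2 q + s3 * s1 / b * x3 q)
    (perimeter_d2 s1 b c kap1 * u1 + s1 * s2 / c * u2 + s3 * s1 / b * u3) V &
  perimeter_d2 s1 b c kap1 * u1 + s1 * s2 / c * u2 + s3 * s1 / b * u3 = 0 ->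
  2 * V = perimeter_d3_row perimeter_d3_iii
    (perimeter_d3_iij k1 s1 kap1 k2 s2 c) (perimeter_d3_ijj k3 s3 k1 s1 kap1 b)
    (perimeter_d3_ijj k1 s1 k2 s2 kap2 c) (perimeter_d3_iij k3 s3 kap3 k1 s1 b)
    u1 u2 u3.
Proof.
move=> jXR jXI jYR jYI jZR jZI F0.
set H11 := perimeter_d2 s1 b c kap1.
have M X Y X0 X1 l1 X2 Y0 Y1 m1 Y2 := @jetM R T U FU sg sg0 X Y X0 X1 l1 X2 Y0 Y1 m1 Y2.
have D X Y X0 X1 l1 X2 Y0 Y1 m1 Y2 := @jetD R T U FU sg X Y X0 X1 l1 X2 Y0 Y1 m1 Y2.
have B X Y X0 X1 l1 X2 Y0 Y1 m1 Y2 := @jetB R T U FU sg X Y X0 X1 l1 X2 Y0 Y1 m1 Y2.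
have Z a X X0 X1 l1 X2 := @jetZ R T U FU sg a X X0 X1 l1 X2.
have jXY := D _ _ _ _ _ _ _ _ _ _ (M _ _ _ _ _ _ _ _ _ _ jXR jYI)
  (M _ _ _ _ _ _ _ _ _ _ jXI jYR).
have jXY' := B _ _ _ _ _ _ _ _ _ _ (M _ _ _ _ _ _ _ _ _ _ jXR jYR)
  (M _ _ _ _ _ _ _ _ _ _ jXI jYI).
have jZ := B _ _ _ _ _ _ _ _ _ _ (M _ _ _ _ _ _ _ _ _ _ jZR jZR)
  (M _ _ _ _ _ _ _ _ _ _ jZI jZI).
have jZ' := Z 2 _ _ _ _ _ (M _ _ _ _ _ _ _ _ _ _ jZR jZI).
(* The factor [s1 / (b * c)] normalizes the first order coefficient to the row of the Hessian. *)
have jF := Z (s1 / (b * c)) _ _ _ _ _ (B _ _ _ _ _ _ _ _ _ _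
  (M _ _ _ _ _ _ _ _ _ _ jXY jZ) (M _ _ _ _ _ _ _ _ _ _ jXY' jZ')).
move: jF.
match goal with |- jet _ _ _ ?x0 ?x1 ?l ?x2 -> _ =>
  pose f0 := x0; pose f1 := x1; pose l1 := l; pose V := x2 end.
rewrite -/f0 -/f1 -/l1 -/V => jF.
have f00 : f0 = 0 by rewrite /f0; ring.
have f1E : f1 = fun q => H11 * x1 q + s1 * s2 / c * x2 q + s3 * s1 / b * x3 q.
  by apply/funext => q; rewrite /f1 /H11 /perimeter_d2; field; rewrite b0 c0.
have l1E : l1 = H11 * u1 + s1 * s2 / c * u2 + s3 * s1 / b * u3.
  by rewrite /l1 /H11 /perimeter_d2; field; rewrite b0 c0.
rewrite f00 f1E l1E in jF.
exists V; first by apply: jet_ext jF; near=> q; rewrite -[RHS](mulr0 (s1 / (b * c))); congr (_ * _);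
  rewrite -!expr2; near: q.
move=> H0; apply/eqP; rewrite -subr_eq0; apply/eqP.
(* [P] and [- Q] are the first variations of the angles of the outgoing and incoming chords with the
   tangent. [2 * V] equals the row of the third derivative only up to a multiple of the Hessian
   equation [H0]; with this multiplier spelled out, an identity of rational functions remains. *)
set P := (s1 * u1 + s2 * u2) / c - kap1 * u1.
set Q := (s1 * u1 + s3 * u3) / b - kap1 * u1.
rewrite -(mulr0 ((2 * s1 * ((k2 * u2 - k1 * u1) / c + (k1 * u1 - k3 * u3) / b) -
   k1 * (P - Q)) / s1)) -H0 /V /P /Q /H11 /perimeter_d2.
rewrite /perimeter_d3_row /perimeter_d3_iii /perimeter_d3_iij /perimeter_d3_ijj.
by field; rewrite b0 c0 s10.
Unshelve. all: by end_near. Qed.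

End VertexJet.

(** * Calculus in one variable *)

Section Calculus.
Context {R : realType}.
Implicit Types (f : R -> R) (t : R).

Lemma is_derive_continuous f (df t : R) : is_derive t 1 f df -> {for t, continuous f}.
Proof. by move=> [fd _]; apply: differentiable_continuous; exact/derivable1_diffP. Qed.

Lemma mean_value f (df : R -> R) (x y : R) :
  (forall z : R, `|z - x| <= `|y - x| -> is_derive z 1 f (df z)) ->
  exists z, `|z - x| <= `|y - x| /\ f y - f x = df z * (y - x).
Proof.
move=> fd.
have cf (A : set R) : (forall z, A z -> `|z - x| <= `|y - x|) -> {within A, continuous f}.
  move=> Axy; apply: continuous_in_subspaceT => z; rewrite inE => /Axy zx.
  exact: is_derive_continuous (fd z zx).
have [xy|/ltW yx] := leP x y.
- have le z : z \in `[x, y]%R -> `|z - x| <= `|y - x|.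
    by rewrite in_itv/= => /andP[xz zy]; rewrite !ger0_norm ?subr_ge0// lerB.
  have [z zxy E] := MVT_segment xy (fun z h => fd z (le z (subset_itv_oo_cc h))) (cf _ le).
  by exists z; split=> //; exact: le.
- have le z : z \in `[y, x]%R -> `|z - x| <= `|y - x|.
    rewrite in_itv/= => /andP[xz zy].
    by rewrite distrC (distrC y) !ger0_norm ?subr_ge0// lerB.
  have [z zxy E] := MVT_segment yx (fun z h => fd z (le z (subset_itv_oo_cc h))) (cf _ le).
  by exists z; split; [exact: le|rewrite -opprB E; ring].
Qed.

Lemma derive_small f (df t e : R) : is_derive t 1 f df -> 0 < e ->
  exists2 d, 0 < d & forall h, `|h| < d ->
    `|f (t + h) - f t - h * df| <= e * `|h|.
Proof.
move=> fd e0; have [/cvg_ex[l fl] fE] := fd.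
have {}fl : h^-1 *: ((f \o shift t) (h *: 1) - f t) @[h --> 0^'] --> df.
  by rewrite -fE; apply: cvg_trans; [exact: fl|rewrite /derive (cvg_lim _ fl)].
move/cvgrPdist_le : fl => /(_ _ e0); rewrite /dnbhs near_withinE.
move=> /nbhs_ballP[d /= d0 H]; exists d => // h hd.
have [->|h0] := eqVneq h 0; first by rewrite addr0 subrr mul0r subrr normr0 mulr0.
have := H h; rewrite /ball/= sub0r normrN => /(_ hd h0).
rewrite /= /GRing.scale/= mulr1 (addrC h) => Hh.
have -> : f (t + h) - f t - h * df = - (h * (df - h^-1 * (f (t + h) - f t))).
  by field.
by rewrite normrN normrM mulrC ler_wpM2r.
Qed.

(** Peano's form of the remainder, as [df] is assumed differentiable at [t] only: the mean value
    theorem for [f] minus its Taylor polynomial reduces the remainder to the first order error of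
    [df] at [t]. *)
Lemma taylor2 f (df : R -> R) (d2f t : R) :
  (forall z : R, is_derive z 1 f (df z)) -> is_derive t 1 df d2f ->
  exists2 eps : R -> R, eps h @[h --> (0 : R)] --> (0 : R) &
    forall h, f (t + h) = f t + h * df t + h ^+ 2 * (d2f / 2 + eps h).
Proof.
move=> fd dfd.
pose eps (h : R) := if h == 0 then 0 else
  (f (t + h) - f t - h * df t) / h ^+ 2 - d2f / 2.
exists eps; last first.
  move=> h; rewrite /eps; case: eqVneq => [->|h0].
    by rewrite addr0; ring.
  by field.
apply/cvgrPdist_le => e e0; have [d d0 Hd] := derive_small dfd e0.
apply/nbhs_ballP; exists d => //= h; rewrite /ball/= sub0r normrN sub0r normrN => hd.
rewrite /eps; case: eqVneq => [_|h0]; first by rewrite normr0 ltW.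
pose g (y : R) := f y - (y - t) * df t - (y - t) ^+ 2 * (d2f / 2).
have gd (z : R) : is_derive z 1 g (df z - df t - (z - t) * d2f).
  have := fd z => fdz.
  rewrite /g; apply: is_derive_eq; rewrite /GRing.scale/=.
  by field.
have [z [zt gE]] := mean_value (x := t) (y := t + h) (fun z _ => gd z).
rewrite (addrC t) addrK in zt.
have gE' : f (t + h) - f t - h * df t - h ^+ 2 * (d2f / 2) =
    h * (df z - df t - (z - t) * d2f).
  have -> : h * (df z - df t - (z - t) * d2f) =
    (df z - df t - (z - t) * d2f) * (t + h - t) by ring.
  by rewrite -gE /g; field.
have -> : (f (t + h) - f t - h * df t) / h ^+ 2 - d2f / 2 =
    (df z - df t - (z - t) * d2f) / h.
  rewrite (_ : f (t + h) - f t - h * df t =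
    h * (df z - df t - (z - t) * d2f) + h ^+ 2 * (d2f / 2)); last by rewrite -gE'; ring.
  by field.
rewrite normrM normfV ler_pdivrMr ?normr_gt0//.
have := Hd (z - t) (le_lt_trans zt hd); rewrite (addrC t) subrK => /le_trans; apply.
by rewrite ler_wpM2l// ltW.
Qed.

Lemma cvg_pair1 (T : Type) (U : set_system T) (FU : Filter U) (h : T -> R * R) (l : R * R) :
  h @ U --> l -> (h z).1 @[z --> U] --> l.1.
Proof. by move=> hl; apply: (cvg_comp _ _ hl); case: l {hl} => a b; exact: cvg_fst. Qed.

Lemma cvg_pair2 (T : Type) (U : set_system T) (FU : Filter U) (h : T -> R * R) (l : R * R) :
  h @ U --> l -> (h z).2 @[z --> U] --> l.2.
Proof. by move=> hl; apply: (cvg_comp _ _ hl); case: l {hl} => a b; exact: cvg_snd. Qed.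

Lemma is_derive_cvg f (t l : R) :
  h^-1 *: (f (h *: 1 + t) - f t) @[h --> 0^'] --> l -> is_derive t 1 f l.
Proof.
move=> fl; split; first by apply/cvg_ex; exists l.
exact/cvg_lim.
Qed.

Lemma is_derive_fst (F : R -> R * R) t : derivable F t 1 ->
  is_derive t 1 (fun z => (F z).1) (F^`() t).1.
Proof.
move=> Fd; apply: is_derive_cvg.
have : h^-1 *: ((F \o shift t) (h *: 1) - F t) @[h --> 0^'] --> F^`() t.
  by rewrite derive1E; exact: Fd.
by move=> /cvg_pair1.
Qed.

Lemma is_derive_snd (F : R -> R * R) t : derivable F t 1 ->
  is_derive t 1 (fun z => (F z).2) (F^`() t).2.
Proof.
move=> Fd; apply: is_derive_cvg.
have : h^-1 *: ((F \o shift t) (h *: 1) - F t) @[h --> 0^'] --> F^`() t.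
  by rewrite derive1E; exact: Fd.
by move=> /cvg_pair2.
Qed.

End Calculus.

Section JetTaylor.
Context {R : realType} {T : Type} (U : set_system T) {FU : ProperFilter U}.
Variable sg : T -> R.

Lemma jet_eq (X : T -> R) (X0 Y0 : R) (X1 Y1 : T -> R) (l1 m1 X2 Y2 : R) :
  jet U sg X X0 X1 l1 X2 -> X0 = Y0 -> X1 =1 Y1 -> l1 = m1 -> X2 = Y2 ->
  jet U sg X Y0 Y1 m1 Y2.
Proof. by move=> + <- /funext <- <- <-. Qed.

Lemma jet_taylor (f df : R -> R) (d2f t : R) (x : T -> R) (u : R) :
  sg @ U --> (0 : R) -> x @ U --> u ->
  (forall z : R, is_derive z 1 f (df z)) -> is_derive t 1 df d2f ->
  jet U sg (fun z => f (t + sg z * x z)) (f t) (fun z => x z * df t) (u * df t)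
    (u ^+ 2 / 2 * d2f).
Proof.
move=> sg0 xu fd dfd; have [eps eps0 fE] := taylor2 fd dfd.
split; first by apply: cvgM => //; exact: cvg_cst.
have cx : (fun z => sg z * x z) @ U --> (0 : R).
  by rewrite -(mul0r u); exact: cvgM.
have ceps : eps (sg z * x z) @[z --> U] --> (0 : R) := cvg_comp _ _ cx eps0.
exists (fun z => x z * x z * (d2f / 2 + eps (sg z * x z))).
  have -> : u ^+ 2 / 2 * d2f = u * u * (d2f / 2 + 0) by field.
  by apply: (cvgM (cvgM xu xu)); apply: cvgD => //; exact: cvg_cst.
by apply: nearW => z; rewrite fE; ring.
Qed.

End JetTaylor.

Lemma is_derive_dot (R : realType) (f f1 g g1 : R -> R) (t a a1 b b1 : R) :
  is_derive t 1 f a -> is_derive t 1 f1 a1 -> is_derive t 1 g b ->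
  is_derive t 1 g1 b1 ->
  is_derive t 1 (fun z => f z * f1 z + g z * g1 z)
    (f t * a1 + a * f1 t + (g t * b1 + b * g1 t)).
Proof.
by move=> *; apply: is_derive_eq; rewrite /GRing.scale/= (mulrC a) (mulrC b).
Qed.

(* Sealed: the conversion of [gx i t] with [gx j t] would unfold the derivatives. *)
HB.lock Definition gx (R : realType) (gamma : R -> R * R) (k : nat) (t : R) : R :=
  (gamma^`(k) t).1.
HB.lock Definition gy (R : realType) (gamma : R -> R * R) (k : nat) (t : R) : R :=
  (gamma^`(k) t).2.

(** * Moving frames and expansions of chords *)

Section Curve.
Context {R : realType} (l : R) (gamma : R -> R * R) (D : set (R * R)).
Hypothesis htable : billiard_table l gamma D.
Hypothesis hC3 : curve_Cn 3 gamma.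
Implicit Types (t : R) (p q : R * R).

Local Notation gx := (gx gamma).
Local Notation gy := (gy gamma).
Definition curvature t : R := gx 1 t * gy 2 t - gy 1 t * gx 2 t.
Definition dcurvature t : R := gx 1 t * gy 3 t - gy 1 t * gx 3 t.

Lemma gx_derive k t : (k < 3)%N -> is_derive t 1 (gx k) (gx k.+1 t).
Proof.
move=> k3; rewrite !gx.unlock; apply: is_derive_fst.
by have [/(_ k t k3)] := hC3.
Qed.

Lemma gy_derive k t : (k < 3)%N -> is_derive t 1 (gy k) (gy k.+1 t).
Proof.
move=> k3; rewrite !gy.unlock; apply: is_derive_snd.
by have [/(_ k t k3)] := hC3.
Qed.

Lemma gx0E t : gx 0 t = (gamma t).1. Proof. by rewrite gx.unlock. Qed.
Lemma gy0E t : gy 0 t = (gamma t).2. Proof. by rewrite gy.unlock. Qed.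
Lemma gx1E t : (tangent gamma t).1 = gx 1 t. Proof. by rewrite gx.unlock. Qed.
Lemma gy1E t : (tangent gamma t).2 = gy 1 t. Proof. by rewrite gy.unlock. Qed.

Lemma tangent_unit t : gx 1 t ^+ 2 + gy 1 t ^+ 2 = 1.
Proof.
have : eucl_dist (tangent gamma t) 0 ^+ 2 = 1.
  by rewrite (table_arclength htable) expr1n.
by rewrite eucl_dist_sqr !subr0 gx1E gy1E.
Qed.

Lemma tangent_d2 t : gx 1 t * gx 2 t + gy 1 t * gy 2 t = 0.
Proof.
have dx := gx_derive t (isT : (1 < 3)%N); have dy := gy_derive t (isT : (1 < 3)%N).
have := is_derive_dot dx dx dy dy.
have -> : (fun z => gx 1 z * gx 1 z + gy 1 z * gy 1 z) = cst 1.
  by apply/funext => z; rewrite -!expr2 tangent_unit.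
move=> [_]; rewrite derive_cst; move: (gx 1 t) (gx 2 t) (gy 1 t) (gy 2 t) => *; lra.
Qed.

Lemma tangent_d3 t :
  gx 2 t ^+ 2 + gy 2 t ^+ 2 + gx 1 t * gx 3 t + gy 1 t * gy 3 t = 0.
Proof.
have dx := gx_derive t (isT : (1 < 3)%N); have dy := gy_derive t (isT : (1 < 3)%N).
have dx2 := gx_derive t (isT : (2 < 3)%N); have dy2 := gy_derive t (isT : (2 < 3)%N).
have := is_derive_dot dx dx2 dy dy2.
have -> : (fun z => gx 1 z * gx 2 z + gy 1 z * gy 2 z) = cst 0.
  by apply/funext => z; rewrite tangent_d2.
move=> [_]; rewrite derive_cst => h; transitivity (gx 1 t * gx 3 t + gx 2 t * gx 2 t +
  (gy 1 t * gy 3 t + gy 2 t * gy 2 t)); first by ring.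
exact: esym h.
Qed.

Lemma gx2E t : gx 2 t = - curvature t * gy 1 t.
Proof.
have h1 := tangent_unit t; have h2 := tangent_d2 t.
rewrite -[LHS]mul1r -h1 /curvature.
have -> : (gx 1 t ^+ 2 + gy 1 t ^+ 2) * gx 2 t =
  gx 1 t * (gx 1 t * gx 2 t + gy 1 t * gy 2 t) -
  (gx 1 t * gy 2 t - gy 1 t * gx 2 t) * gy 1 t by ring.
by rewrite h2; ring.
Qed.

Lemma gy2E t : gy 2 t = curvature t * gx 1 t.
Proof.
have h1 := tangent_unit t; have h2 := tangent_d2 t.
rewrite -[LHS]mul1r -h1 /curvature.
have -> : (gx 1 t ^+ 2 + gy 1 t ^+ 2) * gy 2 t =
  gy 1 t * (gx 1 t * gx 2 t + gy 1 t * gy 2 t) +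
  (gx 1 t * gy 2 t - gy 1 t * gx 2 t) * gx 1 t by ring.
by rewrite h2; ring.
Qed.

Lemma tangent_d3E t : gx 1 t * gx 3 t + gy 1 t * gy 3 t = - curvature t ^+ 2.
Proof.
have := tangent_d3 t; rewrite gx2E gy2E => h.
have h1 := tangent_unit t.
have -> : curvature t ^+ 2 =
    (- curvature t * gy 1 t) ^+ 2 + (curvature t * gx 1 t) ^+ 2.
  by rewrite -[LHS]mulr1 -h1; ring.
by move: h; lra.
Qed.

Lemma outgoingE p : outgoing gamma p =
  (cos p.2 * gx 1 p.1 - sin p.2 * gy 1 p.1,
   cos p.2 * gy 1 p.1 + sin p.2 * gx 1 p.1).
Proof. by rewrite /outgoing/rot90 [LHS]surjective_pairing/= !(gx1E, gy1E) /GRing.scale/= mulrN. Qed.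

Lemma incomingE p : incoming gamma p =
  (cos p.2 * gx 1 p.1 + sin p.2 * gy 1 p.1,
   cos p.2 * gy 1 p.1 - sin p.2 * gx 1 p.1).
Proof. by rewrite /incoming/rot90 [LHS]surjective_pairing/= !(gx1E, gy1E) /GRing.scale/= mulrN opprK. Qed.

Lemma outgoing_unit p :
  (outgoing gamma p).1 ^+ 2 + (outgoing gamma p).2 ^+ 2 = 1.
Proof.
rewrite outgoingE/=.
have -> : (cos p.2 * gx 1 p.1 - sin p.2 * gy 1 p.1) ^+ 2 +
    (cos p.2 * gy 1 p.1 + sin p.2 * gx 1 p.1) ^+ 2 =
  (cos p.2 ^+ 2 + sin p.2 ^+ 2) * (gx 1 p.1 ^+ 2 + gy 1 p.1 ^+ 2) by ring.
by rewrite cos2Dsin2 tangent_unit mul1r.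
Qed.

Section Frames.
Variable p : R * R.
Let h1 := tangent_unit p.1.

Lemma outgoing_frame1 (e := outgoing gamma p) :
  (e.1 * gx 1 p.1 + e.2 * gy 1 p.1 = cos p.2) *
  (- e.2 * gx 1 p.1 + e.1 * gy 1 p.1 = - sin p.2).
Proof.
rewrite /e outgoingE/=; split; [rewrite -[RHS]mulr1|rewrite -[RHS]mulr1]; rewrite -h1; ring.
Qed.

Lemma outgoing_frame2 (e := outgoing gamma p) :
  (e.1 * gx 2 p.1 + e.2 * gy 2 p.1 = curvature p.1 * sin p.2) *
  (- e.2 * gx 2 p.1 + e.1 * gy 2 p.1 = curvature p.1 * cos p.2).
Proof.
rewrite /e outgoingE/= gx2E gy2E; split; rewrite -[RHS]mulr1 -h1; ring.
Qed.

Lemma incoming_frame1 (e := incoming gamma p) :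
  (e.1 * gx 1 p.1 + e.2 * gy 1 p.1 = cos p.2) *
  (- e.2 * gx 1 p.1 + e.1 * gy 1 p.1 = sin p.2).
Proof.
rewrite /e incomingE/=; split; rewrite -[RHS]mulr1 -h1; ring.
Qed.

Lemma incoming_frame2 (e := incoming gamma p) :
  (e.1 * gx 2 p.1 + e.2 * gy 2 p.1 = - (curvature p.1 * sin p.2)) *
  (- e.2 * gx 2 p.1 + e.1 * gy 2 p.1 = curvature p.1 * cos p.2).
Proof.
rewrite /e incomingE/= gx2E gy2E; split; rewrite -[RHS]mulr1 -h1; ring.
Qed.

End Frames.

(** In complex notation, [dot_chord] and [cross_chord] are the real and imaginary parts of the chord
    divided by the unit vector [e]; they provide the functions [XR], [XI], [YR], [YI] of
    [vertex_jet]. *)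
Definition dot_chord (e : R * R) t t' : R :=
  e.1 * (gx 0 t' - gx 0 t) + e.2 * (gy 0 t' - gy 0 t).
Definition cross_chord (e : R * R) t t' : R :=
  - e.2 * (gx 0 t' - gx 0 t) + e.1 * (gy 0 t' - gy 0 t).

Section ChordJets.
Context {T : Type} (U : set_system T) {FU : ProperFilter U}.
Variable sg : T -> R.
Hypothesis sg0 : sg @ U --> (0 : R).
Variables (p q : R * R) (c : R) (x y : T -> R) (u v : R).
Hypotheses (xu : x @ U --> u) (yv : y @ U --> v).
Hypothesis pq : gamma q.1 = gamma p.1 + c *: outgoing gamma p.
Hypothesis outin : outgoing gamma p = incoming gamma q.

Let e := outgoing gamma p.

Let chord0 : (gx 0 q.1 - gx 0 p.1 = c * e.1) * (gy 0 q.1 - gy 0 p.1 = c * e.2).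
Proof. by rewrite !(gx0E, gy0E) pq/=; split; rewrite addrC addKr. Qed.

Let coord_jet (a b : R) :=
  jetD (jetZ a (jetB (jet_taylor sg0 yv (fun z => gx_derive z (isT : (0 < 3)%N)) (gx_derive q.1 (isT : (1 < 3)%N)))
                     (jet_taylor sg0 xu (fun z => gx_derive z (isT : (0 < 3)%N)) (gx_derive p.1 (isT : (1 < 3)%N)))))
       (jetZ b (jetB (jet_taylor sg0 yv (fun z => gy_derive z (isT : (0 < 3)%N)) (gy_derive q.1 (isT : (1 < 3)%N)))
                     (jet_taylor sg0 xu (fun z => gy_derive z (isT : (0 < 3)%N)) (gy_derive p.1 (isT : (1 < 3)%N))))).

Lemma dot_chord_jet :
  jet U sg (fun z => dot_chord e (p.1 + sg z * x z) (q.1 + sg z * y z)) c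
    (fun z => y z * cos q.2 - x z * cos p.2) (v * cos q.2 - u * cos p.2)
    (- (v ^+ 2 / 2 * curvature q.1 * sin q.2) - u ^+ 2 / 2 * curvature p.1 * sin p.2).
Proof.
have [fq1 _] := incoming_frame1 q; have [fp1 _] := outgoing_frame1 p.
have [fq2 _] := incoming_frame2 q; have [fp2 _] := outgoing_frame2 p.
rewrite -outin in fq1 fq2.
apply: jet_eq; first exact: (coord_jet e.1 e.2).
- rewrite !chord0; have := outgoing_unit p; rewrite -/e => eu.
  by rewrite -[RHS]mulr1 -eu; ring.
- by move=> z; rewrite -fq1 -fp1 -/e; ring.
- by rewrite -fq1 -fp1 -/e; ring.
- have -> : - (v ^+ 2 / 2 * curvature q.1 * sin q.2) =
    v ^+ 2 / 2 * - (curvature q.1 * sin q.2) by ring.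
  by rewrite -fq2 -(mulrA (u ^+ 2 / 2)) -fp2 -/e; ring.
Qed.

Lemma cross_chord_jet :
  jet U sg (fun z => cross_chord e (p.1 + sg z * x z) (q.1 + sg z * y z)) 0
    (fun z => y z * sin q.2 + x z * sin p.2) (v * sin q.2 + u * sin p.2)
    (v ^+ 2 / 2 * curvature q.1 * cos q.2 - u ^+ 2 / 2 * curvature p.1 * cos p.2).
Proof.
have [_ fq1] := incoming_frame1 q; have [_ fp1] := outgoing_frame1 p.
have [_ fq2] := incoming_frame2 q; have [_ fp2] := outgoing_frame2 p.
rewrite -outin in fq1 fq2.
have {}fp1 : sin p.2 = - (- e.2 * gx 1 p.1 + e.1 * gy 1 p.1) by rewrite fp1 opprK.
apply: jet_eq; first exact: (coord_jet (- e.2) e.1).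
- by rewrite !chord0; ring.
- by move=> z; rewrite -fq1 fp1 -/e; ring.
- by rewrite -fq1 fp1 -/e; ring.
- rewrite -!mulrA -fq2 -fp2 -/e; ring.
Qed.

Lemma tangent_dot_jet :
  jet U sg (fun z => gx 1 p.1 * gx 1 (p.1 + sg z * x z) +
                     gy 1 p.1 * gy 1 (p.1 + sg z * x z)) 1
    (fun=> 0) 0 (- (u ^+ 2 / 2 * curvature p.1 ^+ 2)).
Proof.
have h2 := tangent_d2 p.1.
apply: jet_eq.
  exact: (jetD (jetZ (gx 1 p.1) (jet_taylor sg0 xu (fun z => gx_derive z (isT : (1 < 3)%N))
      (gx_derive p.1 (isT : (2 < 3)%N))))
    (jetZ (gy 1 p.1) (jet_taylor sg0 xu (fun z => gy_derive z (isT : (1 < 3)%N))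
      (gy_derive p.1 (isT : (2 < 3)%N))))).
- by rewrite -!expr2 tangent_unit.
- by move=> z /=; rewrite -[RHS](mulr0 (x z)) -h2; ring.
- by rewrite -[RHS](mulr0 u) -h2; ring.
- by rewrite -mulrN -tangent_d3E; ring.
Qed.

Lemma tangent_cross_jet :
  jet U sg (fun z => - gy 1 p.1 * gx 1 (p.1 + sg z * x z) +
                     gx 1 p.1 * gy 1 (p.1 + sg z * x z)) 0
    (fun z => x z * curvature p.1) (u * curvature p.1) (u ^+ 2 / 2 * dcurvature p.1).
Proof.
apply: jet_eq.
  exact: (jetD (jetZ (- gy 1 p.1) (jet_taylor sg0 xu (fun z => gx_derive z (isT : (1 < 3)%N))
      (gx_derive p.1 (isT : (2 < 3)%N))))
    (jetZ (gx 1 p.1) (jet_taylor sg0 xu (fun z => gy_derive z (isT : (1 < 3)%N))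
      (gy_derive p.1 (isT : (2 < 3)%N))))).
- by ring.
- by move=> z /=; rewrite /curvature; ring.
- by rewrite /curvature; ring.
- by rewrite /dcurvature; ring.
Qed.

End ChordJets.

(* Cf. [vertex_jet]; all the unit directions involved cancel identically. *)
Lemma reflection_polynomial (p p' : R * R) (t' t'' a b : R) :
  gamma t' = gamma p'.1 + a *: outgoing gamma p' ->
  gamma p'.1 = gamma t'' + b *: incoming gamma p' ->
  let X := dot_chord (outgoing gamma p) p'.1 t' in
  let X' := cross_chord (outgoing gamma p) p'.1 t' in
  let Y := dot_chord (incoming gamma p) t'' p'.1 in
  let Y' := cross_chord (incoming gamma p) t'' p'.1 in
  let Z := gx 1 p.1 * gx 1 p'.1 + gy 1 p.1 * gy 1 p'.1 in
  let Z' := - gy 1 p.1 * gx 1 p'.1 + gx 1 p.1 * gy 1 p'.1 in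
  (X * Y' + X' * Y) * (Z ^+ 2 - Z' ^+ 2) - (X * Y - X' * Y') * (2 * (Z * Z')) = 0.
Proof.
move=> At Bt X X' Y Y' Z Z'.
have At1 : gx 0 t' - gx 0 p'.1 = a * (outgoing gamma p').1.
  by rewrite !gx0E At/= addrC addKr.
have At2 : gy 0 t' - gy 0 p'.1 = a * (outgoing gamma p').2.
  by rewrite !gy0E At/= addrC addKr.
have Bt1 : gx 0 p'.1 - gx 0 t'' = b * (incoming gamma p').1.
  by rewrite !gx0E Bt/= addrC addKr.
have Bt2 : gy 0 p'.1 - gy 0 t'' = b * (incoming gamma p').2.
  by rewrite !gy0E Bt/= addrC addKr.
rewrite /X /X' /Y /Y' /dot_chord /cross_chord At1 At2 Bt1 Bt2 /Z /Z'.
rewrite !outgoingE !incomingE/=; ring.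
Qed.

End Curve.

(** Compactness of a segment. Applied to several bounded functions it gives all limits along the
    same filter, with no extraction of subsequences. *)
Lemma ultra_bounded_cvg (R : realType) (T : Type) (U : set_system T)
    (f : T -> R) (M : R) : UltraFilter U ->
  (\forall z \near U, `|f z| <= M) -> exists l : R, f @ U --> l.
Proof.
move=> UU fM.
have FM : (f @ U) `[- M, M]%classic.
  by apply: filterS fM => z; rewrite /= in_itv/= ler_norml.
have [l [_ cl]] := @segment_compact R (- M) M (f @ U) _ FM.
exists l => B Bl; have [//|UnB] := in_ultra_setVsetC (f @^-1` B) UU.
by have [x []] := cl (~` B) B UnB Bl.
Qed.

(** * Elementary geometry of the triangle *)

Section TriangleFacts.
Context {R : realFieldType}.
Variables (x1 y1 x2 y2 x3 y3 k1 s1 k2 s2 k3 s3 a b c : R).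
Hypotheses (n1 : x1 ^+ 2 + y1 ^+ 2 = 1) (n2 : x2 ^+ 2 + y2 ^+ 2 = 1)
  (n3 : x3 ^+ 2 + y3 ^+ 2 = 1).
Hypotheses (ks1 : k1 ^+ 2 + s1 ^+ 2 = 1) (ks2 : k2 ^+ 2 + s2 ^+ 2 = 1)
  (ks3 : k3 ^+ 2 + s3 ^+ 2 = 1).
Hypotheses (cr12 : x1 * y2 - y1 * x2 = 2 * s2 * k2)
  (cr23 : x2 * y3 - y2 * x3 = 2 * s3 * k3)
  (cr31 : x3 * y1 - y3 * x1 = 2 * s1 * k1).
Hypotheses (d12 : x1 * x2 + y1 * y2 = k2 ^+ 2 - s2 ^+ 2)
  (d23 : x2 * x3 + y2 * y3 = k3 ^+ 2 - s3 ^+ 2)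
  (d31 : x3 * x1 + y3 * y1 = k1 ^+ 2 - s1 ^+ 2).
Hypotheses (cx : c * x1 + a * x2 + b * x3 = 0) (cy : c * y1 + a * y2 + b * y3 = 0).
Hypotheses (s10 : 0 < s1) (s20 : 0 < s2) (s30 : 0 < s3).
Hypotheses (a0 : 0 < a) (b0 : 0 < b) (c0 : 0 < c).

(** Law of cosines: the defect [(l2 + l3) ^+ 2 - l1 ^+ 2] equals [4 * l2 * l3 * s ^+ 2], which is
    positive because the trajectory is not tangent at the vertex. *)
Let side_lt (u v w z l1 l2 l3 k s : R) : u ^+ 2 + v ^+ 2 = 1 ->
  w ^+ 2 + z ^+ 2 = 1 -> k ^+ 2 + s ^+ 2 = 1 -> u * w + v * z = k ^+ 2 - s ^+ 2 ->
  l1 ^+ 2 = (l2 * u + l3 * w) ^+ 2 + (l2 * v + l3 * z) ^+ 2 ->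
  0 < s -> 0 < l1 -> 0 < l2 -> 0 < l3 -> l1 < l2 + l3.
Proof.
move=> uv wz ks d E s0 l10 l20 l30.
rewrite -ltr_sqr ?nnegrE ?addr_ge0 ?ltW// -subr_gt0.
have -> : l1 ^+ 2 = l2 ^+ 2 + l3 ^+ 2 + 2 * l2 * l3 * (1 - 2 * s ^+ 2).
  have -> : 1 - 2 * s ^+ 2 = u * w + v * z by rewrite d; move: ks; lra.
  by rewrite E -[l2 ^+ 2]mulr1 -[in l2 ^+ 2 * 1]uv -[l3 ^+ 2 in RHS]mulr1 -[in l3 ^+ 2 * 1]wz; ring.
have -> : (l2 + l3) ^+ 2 - (l2 ^+ 2 + l3 ^+ 2 + 2 * l2 * l3 * (1 - 2 * s ^+ 2)) =
  4 * l2 * l3 * s ^+ 2 by ring.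
by rewrite !mulr_gt0// exprn_gt0.
Qed.

Lemma triangle_sides : [/\ a < b + c, b < c + a & c < a + b].
Proof.
split.
- apply: (side_lt n3 n1 ks1 d31) => //.
  have -> : b * x3 + c * x1 = - a * x2 by move: cx; lra.
  have -> : b * y3 + c * y1 = - a * y2 by move: cy; lra.
  by rewrite -[LHS]mulr1 -n2; ring.
- apply: (side_lt n1 n2 ks2 d12) => //.
  have -> : c * x1 + a * x2 = - b * x3 by move: cx; lra.
  have -> : c * y1 + a * y2 = - b * y3 by move: cy; lra.
  by rewrite -[LHS]mulr1 -n3; ring.
- apply: (side_lt n2 n3 ks3 d23) => //.
  have -> : a * x2 + b * x3 = - c * x1 by move: cx; lra.
  have -> : a * y2 + b * y3 = - c * y1 by move: cy; lra.
  by rewrite -[LHS]mulr1 -n1; ring.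
Qed.

(** Law of sines, from cross products with the closing relation: the products [s1 * k1], [s2 * k2],
    [s3 * k3], half the sines of the turning angles, are positive multiples of each other, so all
    three turns are to the same side. *)
Lemma triangle_orientation : 0 < k1 * k2 /\ 0 < k1 * k3.
Proof.
have e12 : a * (s2 * k2) = b * (s1 * k1).
  have : x1 * (c * y1 + a * y2 + b * y3) - y1 * (c * x1 + a * x2 + b * x3) =
    a * (x1 * y2 - y1 * x2) - b * (x3 * y1 - y3 * x1) by ring.
  by rewrite cx cy cr12 cr31; lra.
have e13 : c * (s2 * k2) = b * (s3 * k3).
  have : x2 * (c * y1 + a * y2 + b * y3) - y2 * (c * x1 + a * x2 + b * x3) =
    b * (x2 * y3 - y2 * x3) - c * (x1 * y2 - y1 * x2) by ring.
  by rewrite cx cy cr12 cr23; lra.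
(* If [k2] vanished, all three cosines would, and every reflection would reverse the direction;
   adding the two dot products [E1] and [E2] then gives [b = 0]. *)
have k2_neq0 : k2 != 0.
  apply/eqP => k20.
  have k10 : k1 = 0.
    by move: e12; rewrite k20 !mulr0 => /esym/eqP; rewrite !mulf_eq0 (gt_eqF b0) (gt_eqF s10)/= => /eqP.
  have k30 : k3 = 0.
    by move: e13; rewrite k20 !mulr0 => /esym/eqP; rewrite !mulf_eq0 (gt_eqF b0) (gt_eqF s30)/= => /eqP.
  have d12' : x1 * x2 + y1 * y2 = -1 by rewrite d12; move: ks2; rewrite k20 expr0n/= add0r sub0r => ->.
  have d23' : x2 * x3 + y2 * y3 = -1 by rewrite d23; move: ks3; rewrite k30 expr0n/= add0r sub0r => ->.
  have d31' : x3 * x1 + y3 * y1 = -1 by rewrite d31; move: ks1; rewrite k10 expr0n/= add0r sub0r => ->.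
  have E1 : x1 * (c * x1 + a * x2 + b * x3) + y1 * (c * y1 + a * y2 + b * y3) =
    c * (x1 ^+ 2 + y1 ^+ 2) + a * (x1 * x2 + y1 * y2) + b * (x3 * x1 + y3 * y1) by ring.
  have E2 : x2 * (c * x1 + a * x2 + b * x3) + y2 * (c * y1 + a * y2 + b * y3) =
    a * (x2 ^+ 2 + y2 ^+ 2) + c * (x1 * x2 + y1 * y2) + b * (x2 * x3 + y2 * y3) by ring.
  move: E1 E2 b0; rewrite cx cy n1 n2 d12' d23' d31'; lra.
have k22 : 0 < k2 ^+ 2 by rewrite lt_neqAle eq_sym sqrf_eq0 k2_neq0 sqr_ge0.
have k12 : 0 < k1 * k2.
  rewrite -(pmulr_rgt0 _ (mulr_gt0 b0 s10)).
  have -> : b * s1 * (k1 * k2) = a * s2 * k2 ^+ 2.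
    by transitivity (b * (s1 * k1) * k2); [ring|rewrite -e12; ring].
  exact: mulr_gt0 (mulr_gt0 a0 s20) k22.
split=> //; rewrite -(pmulr_rgt0 _ (mulr_gt0 b0 s30)).
have -> : b * s3 * (k1 * k3) = c * s2 * (k1 * k2).
  by transitivity (b * (s3 * k3) * k1); [ring|rewrite -e13; ring].
exact: mulr_gt0 (mulr_gt0 c0 s20) k12.
Qed.

End TriangleFacts.

Section Triangle.
Context {R : realType} (l : R) (gamma : R -> R * R) (D : set (R * R)).
Hypothesis htable : billiard_table l gamma D.
Hypothesis hC3 : curve_Cn 3 gamma.
Local Notation gx := (gx gamma).
Local Notation gy := (gy gamma).
Local Notation kap := (curvature gamma).
Local Notation dkap := (dcurvature gamma).

(* The billiard map without the condition that the trajectory stays in D. *)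
Definition chord_step (p q : R * R) (c : R) : Prop :=
  gamma q.1 = gamma p.1 + c *: outgoing gamma p /\
  outgoing gamma p = incoming gamma q.

Variables (p q r : R * R) (c a b : R).
Hypotheses (pq : chord_step p q c) (qr : chord_step q r a) (rp : chord_step r p b).
Hypotheses (c0 : 0 < c) (a0 : 0 < a) (b0 : 0 < b).
Let k1 := cos p.2. Let s1 := sin p.2.
Let k2 := cos q.2. Let s2 := sin q.2.
Let k3 := cos r.2. Let s3 := sin r.2.
Hypotheses (s10 : 0 < s1) (s20 : 0 < s2) (s30 : 0 < s3).
Let kap1 := kap p.1. Let kap2 := kap q.1. Let kap3 := kap r.1.
Let H11 := perimeter_d2 s1 b c kap1.
Let H22 := perimeter_d2 s2 c a kap2.
Let H33 := perimeter_d2 s3 a b kap3.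
Let H12 := s1 * s2 / c.
Let H23 := s2 * s3 / a.
Let H31 := s3 * s1 / b.
Let L111 := perimeter_d3_iii k1 s1 b c kap1 (dkap p.1).
Let L222 := perimeter_d3_iii k2 s2 c a kap2 (dkap q.1).
Let L333 := perimeter_d3_iii k3 s3 a b kap3 (dkap r.1).
Let L112 := perimeter_d3_iij k1 s1 kap1 k2 s2 c.
Let L122 := perimeter_d3_ijj k1 s1 k2 s2 kap2 c.
Let L223 := perimeter_d3_iij k2 s2 kap2 k3 s3 a.
Let L233 := perimeter_d3_ijj k2 s2 k3 s3 kap3 a.
Let L331 := perimeter_d3_iij k3 s3 kap3 k1 s1 b.
Let L311 := perimeter_d3_ijj k3 s3 k1 s1 kap1 b.

(* What the second order expansion of the reflection law says about the limit
   directions [w] of the set of period three orbits at [p]; the variations of the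
   other two vertices are [u2] and [u3]. *)
Definition orbit_dir (w : R * R) : Prop := exists u2 u3 : R,
  [/\ c * (kap1 * w.1 + w.2) = s1 * w.1 + s2 * u2,
      b * (kap1 * w.1 - w.2) = s1 * w.1 + s3 * u3,
      [/\ H11 * w.1 + H12 * u2 + H31 * u3 = 0,
          H12 * w.1 + H22 * u2 + H23 * u3 = 0 &
          H31 * w.1 + H23 * u2 + H33 * u3 = 0] &
      forall v1 v2 v3 : R,
        H11 * v1 + H12 * v2 + H31 * v3 = 0 ->
        H12 * v1 + H22 * v2 + H23 * v3 = 0 ->
        H31 * v1 + H23 * v2 + H33 * v3 = 0 ->
        v1 * perimeter_d3_row L111 L112 L311 L122 L331 w.1 u2 u3 +
        v2 * perimeter_d3_row L222 L223 L122 L233 L112 u2 u3 w.1 +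
        v3 * perimeter_d3_row L333 L331 L233 L311 L223 u3 w.1 u2 = 0].

Let frames (x : R * R) (i := incoming gamma x) (o := outgoing gamma x) :
  (i.1 * o.2 - i.2 * o.1 = 2 * sin x.2 * cos x.2) *
  (i.1 * o.1 + i.2 * o.2 = cos x.2 ^+ 2 - sin x.2 ^+ 2).
Proof.
rewrite /i /o incomingE outgoingE/=; have := tangent_unit htable x.1.
move: (gx 1 x.1) (gy 1 x.1) (cos x.2) (sin x.2) => X Y C S XY; split.
  by transitivity (2 * S * C * (X ^+ 2 + Y ^+ 2)); [ring|rewrite XY mulr1].
by transitivity ((C ^+ 2 - S ^+ 2) * (X ^+ 2 + Y ^+ 2)); [ring|rewrite XY mulr1].
Qed.

(** The first relation of [orbit_dir] expresses [w.2] by [w.1] and [u2], which reduces the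
    determinant of [w] and [w'] to the one of [perimeter_kernel_collinear]. Both directions give
    kernel vectors, so each serves as test vector in its own cubic condition and in that of the
    other. *)
Lemma orbit_dir_collinear w w' : orbit_dir w -> orbit_dir w' ->
  w.1 * w'.2 - w.2 * w'.1 = 0.
Proof.
have [g1 h1] := pq; have [g2 h2] := qr; have [g3 h3] := rp.
have o1 := outgoing_unit htable p; have o2 := outgoing_unit htable q.
have o3 := outgoing_unit htable r.
have [f1 f1'] := frames p; have [f2 f2'] := frames q; have [f3 f3'] := frames r.
rewrite -h3 in f1 f1'; rewrite -h1 in f2 f2'; rewrite -h2 in f3 f3'.
rewrite g2 g1 in g3.
have /(congr1 (fun z => z.1)) /= X := g3.
have /(congr1 (fun z => z.2)) /= Y := g3.
rewrite /GRing.scale/= in X Y.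
have {}X : c * (outgoing gamma p).1 + a * (outgoing gamma q).1 +
    b * (outgoing gamma r).1 = 0.
  by apply: (addrI (gamma p.1).1); rewrite addr0 !addrA; exact: esym X.
have {}Y : c * (outgoing gamma p).2 + a * (outgoing gamma q).2 +
    b * (outgoing gamma r).2 = 0.
  by apply: (addrI (gamma p.1).2); rewrite addr0 !addrA; exact: esym Y.
have [abc bca cab] := triangle_sides o1 o2 o3 (cos2Dsin2 _) (cos2Dsin2 _)
  (cos2Dsin2 _) f2' f3' f1' X Y s10 s20 s30 a0 b0 c0.
have [k12 k13] := triangle_orientation o1 o2 (cos2Dsin2 _) (cos2Dsin2 _)
  (cos2Dsin2 _) f2 f3 f1 f2' f3' f1' X Y s10 s20 s30 a0 b0 c0.
move=> [u2 [u3 [A2 A3 [A11 A22 A33] AC]]] [v2 [v3 [B2 B3 [B11 B22 B33] BC]]].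
have col := perimeter_kernel_collinear s10 s20 s30 a0 b0 c0 abc bca cab k12 k13
  A11 A22 A33 B11 B22 B33 (AC _ _ _ A11 A22 A33) (AC _ _ _ B11 B22 B33)
  (BC _ _ _ A11 A22 A33) (BC _ _ _ B11 B22 B33).
apply: (mulfI (lt0r_neq0 c0)); rewrite mulr0.
transitivity (s2 * (w.1 * v2 - u2 * w'.1)); last by rewrite col mulr0.
transitivity (w.1 * (c * (kap1 * w'.1 + w'.2)) - w'.1 * (c * (kap1 * w.1 + w.2))).
  by move: kap1 (w.1) (w.2) (w'.1) (w'.2) => *; ring.
rewrite A2 B2; move: s1 s2 (w.1) (w'.1) => *; ring.
Qed.

End Triangle.

(** * Limit directions of three-period orbits *)

Section OrbitLimit.
Context {R : realType} (l : R) (gamma : R -> R * R) (D : set (R * R)).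
Hypothesis htable : billiard_table l gamma D.
Hypothesis hC3 : curve_Cn 3 gamma.
Local Notation gx := (gx gamma).
Local Notation gy := (gy gamma).
Local Notation kap := (curvature gamma).

Lemma is_derive_cos_all (z : R) : is_derive z 1 cos (- sin z).
Proof. exact: is_derive_cos. Qed.

Lemma is_derive_sin_all (z : R) : is_derive z 1 sin (cos z).
Proof. exact: is_derive_sin. Qed.

Lemma is_derive_Nsin (z : R) : is_derive z 1 (fun z : R => - sin z) (- cos z).
Proof. exact: is_deriveN. Qed.

Section Turn.
Context {T : Type} (U : set_system T) {FU : ProperFilter U}.
Variables (sg : T -> R).
Hypothesis sg0 : sg @ U --> (0 : R).
Variables (x y : T -> R) (u v : R).
Hypotheses (xu : x @ U --> u) (yv : y @ U --> v).
Variables (t th k s : R).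

(* The direction, in the frame of the unit vector [f], of the vector making the
   angle [sn * th] with the tangent. *)
Lemma turn_jet (f : R * R) (sn : R) :
  let t' z := t + sg z * x z in let th' z := th + sg z * y z in
  let A z := f.1 * gx 1 (t' z) + f.2 * gy 1 (t' z) in
  let B z := - f.2 * gx 1 (t' z) + f.1 * gy 1 (t' z) in
  let A0 := f.1 * gx 1 t + f.2 * gy 1 t in
  let B0 := - f.2 * gx 1 t + f.1 * gy 1 t in
  let A1 := f.1 * gx 2 t + f.2 * gy 2 t in
  let B1 := - f.2 * gx 2 t + f.1 * gy 2 t in
  let d1 u v := cos th * (u * A1) - v * sin th * A0
      - sn * (sin th * (u * B1) + v * cos th * B0) in
  let d1' u v := cos th * (u * B1) - v * sin th * B0
      + sn * (sin th * (u * A1) + v * cos th * A0) in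
  exists X2 Y2 : R,
  jet U sg (fun z => cos (th' z) * A z - sn * sin (th' z) * B z)
    (cos th * A0 - sn * sin th * B0) (fun z => d1 (x z) (y z)) (d1 u v) X2 /\
  jet U sg (fun z => cos (th' z) * B z + sn * sin (th' z) * A z)
    (cos th * B0 + sn * sin th * A0) (fun z => d1' (x z) (y z)) (d1' u v) Y2.
Proof.
have dgx z := gx_derive hC3 z (isT : (1 < 3)%N).
have dgy z := gy_derive hC3 z (isT : (1 < 3)%N).
have dgx2 := gx_derive hC3 t (isT : (2 < 3)%N).
have dgy2 := gy_derive hC3 t (isT : (2 < 3)%N).
have jT f' df d2f t' x' u' := @jet_taylor R T U FU sg f' df d2f t' x' u' sg0.
have jx := jT _ _ _ _ _ _ xu dgx dgx2; have jy := jT _ _ _ _ _ _ xu dgy dgy2.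
have jA := @jetD _ _ _ FU _ _ _ _ _ _ _ _ _ _ _ (@jetZ _ _ _ FU _ f.1 _ _ _ _ _ jx)
  (@jetZ _ _ _ FU _ f.2 _ _ _ _ _ jy).
have jB := @jetD _ _ _ FU _ _ _ _ _ _ _ _ _ _ _ (@jetZ _ _ _ FU _ (- f.2) _ _ _ _ _ jx)
  (@jetZ _ _ _ FU _ f.1 _ _ _ _ _ jy).
have jC := jT _ _ _ _ _ _ yv is_derive_cos_all (is_derive_Nsin th).
have jS := @jetZ _ _ _ FU _ sn _ _ _ _ _
  (jT _ cos _ _ _ _ yv is_derive_sin_all (is_derive_cos_all th)).
have jM X Y X0 X1 l1 X2 Y0 Y1 m1 Y2 := @jetM R T U FU sg sg0 X Y X0 X1 l1 X2 Y0 Y1 m1 Y2.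
have j1 := @jetB _ _ _ FU _ _ _ _ _ _ _ _ _ _ _ (jM _ _ _ _ _ _ _ _ _ _ jC jA)
  (jM _ _ _ _ _ _ _ _ _ _ jS jB).
have j2 := @jetD _ _ _ FU _ _ _ _ _ _ _ _ _ _ _ (jM _ _ _ _ _ _ _ _ _ _ jC jB)
  (jM _ _ _ _ _ _ _ _ _ _ jS jA).
move=> t' th' A B A0 B0 A1 B1 d1 d1'.
rewrite /A /B /t' /th' /d1 /d1' /A0 /B0 /A1 /B1.
do 2 eexists; split.
  apply: jet_eq; first exact: j1; last reflexivity.
  - by [].
  - by move=> z; move: (x z) (y z) (f.1) (f.2) (gx 1 t) (gy 1 t) (gx 2 t) (gy 2 t)
      (cos th) (sin th) => *; ring.
  - move: (f.1) (f.2) (gx 1 t) (gy 1 t) (gx 2 t) (gy 2 t) (cos th) (sin th) => *; ring.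
apply: jet_eq; first exact: j2; last reflexivity.
- by [].
- by move=> z; move: (x z) (y z) (f.1) (f.2) (gx 1 t) (gy 1 t) (gx 2 t) (gy 2 t)
    (cos th) (sin th) => *; ring.
- move: (f.1) (f.2) (gx 1 t) (gy 1 t) (gx 2 t) (gy 2 t) (cos th) (sin th) => *; ring.
Qed.

End Turn.

Variables (p q r : R * R) (c a b : R).
Local Notation step := (chord_step gamma).
Hypotheses (pq : step p q c) (qr : step q r a) (rp : step r p b).
Hypotheses (c0 : 0 < c) (a0 : 0 < a) (b0 : 0 < b).
Hypotheses (s10 : 0 < sin p.2) (s20 : 0 < sin q.2) (s30 : 0 < sin r.2).

(** The scale [sg] is the largest displacement among the two coordinates of the point and the
    positions of the other two vertices, so the four quotients are bounded and converge. If [w] were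
    zero, the two relations between [w], [u2] and [u3] would annihilate all four limits, although
    one quotient always has modulus one. *)
Lemma orbit_dir_limit (T : Type) (U : set_system T) (UU : UltraFilter U)
  (P Q S : T -> R * R) :
  (\forall z \near U, exists c', step (P z) (Q z) c') ->
  (\forall z \near U, exists a', step (Q z) (S z) a') ->
  (\forall z \near U, exists b', step (S z) (P z) b') ->
  (P z).1 @[z --> U] --> p.1 -> (P z).2 @[z --> U] --> p.2 ->
  (Q z).1 @[z --> U] --> q.1 -> (S z).1 @[z --> U] --> r.1 ->
  (\forall z \near U, P z != p) ->
  exists (sg : T -> R) (w : R * R),
    [/\ \forall z \near U, 0 < sg z, (w.1 != 0) || (w.2 != 0),
        orbit_dir gamma p q r c a b w,
        ((P z).1 - p.1) / sg z @[z --> U] --> w.1 &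
        ((P z).2 - p.2) / sg z @[z --> U] --> w.2].
Proof.
move=> sPQ sQS sSP cP1 cP2 cQ cS Pp.
pose d1 z := `|(P z).1 - p.1|. pose d2 z := `|(P z).2 - p.2|.
pose d3 z := `|(Q z).1 - q.1|. pose d4 z := `|(S z).1 - r.1|.
pose sg z := Num.max (Num.max (d1 z) (d2 z)) (Num.max (d3 z) (d4 z)).
have sgd z : [/\ d1 z <= sg z, d2 z <= sg z, d3 z <= sg z & d4 z <= sg z].
  by split; rewrite /sg !le_max lexx ?orbT.
have sg_gt0 : \forall z \near U, 0 < sg z.
  apply: filterS Pp => z Pz; rewrite /sg !lt_max !normr_gt0 !subr_eq0.
  have [E1|//] := eqVneq (P z).1 p.1; have [E2|//] := eqVneq (P z).2 p.2.
  by case/eqP: Pz; rewrite [LHS]surjective_pairing E1 E2 -surjective_pairing.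
have sg_neq0 : \forall z \near U, sg z != 0.
  by apply: filterS sg_gt0 => z; exact: lt0r_neq0.
have cd (f : T -> R) t : f @ U --> t -> `|f z - t| @[z --> U] --> (0 : R).
  move=> ft; rewrite -(normr0 R) -(subrr t); apply: cvg_norm.
  by apply: cvgB => //; exact: cvg_cst.
have sg0 : sg @ U --> (0 : R).
  apply/cvgrPdist_lt => e e0.
  have n1 : \forall z \near U, d1 z < e.
    by have /cvgrPdist_lt/(_ e e0) := cP1; apply: filterS => z; rewrite distrC.
  have n2 : \forall z \near U, d2 z < e.
    by have /cvgrPdist_lt/(_ e e0) := cP2; apply: filterS => z; rewrite distrC.
  have n3 : \forall z \near U, d3 z < e.
    by have /cvgrPdist_lt/(_ e e0) := cQ; apply: filterS => z; rewrite distrC.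
  have n4 : \forall z \near U, d4 z < e.
    by have /cvgrPdist_lt/(_ e e0) := cS; apply: filterS => z; rewrite distrC.
  near=> z; rewrite sub0r normrN ger0_norm; last by rewrite /sg !le_max normr_ge0.
  rewrite /sg !gt_max; apply/andP; split; apply/andP; split; by near: z.
pose x1 z := ((P z).1 - p.1) / sg z. pose y1 z := ((P z).2 - p.2) / sg z.
pose x2 z := ((Q z).1 - q.1) / sg z. pose x3 z := ((S z).1 - r.1) / sg z.
have le1 (f : T -> R) : (forall z, `|f z| <= sg z) ->
    \forall z \near U, `|f z / sg z| <= 1.
  move=> fsg; apply: filterS sg_gt0 => z sz.
  by rewrite normrM normfV (gtr0_norm sz) ler_pdivrMr// mul1r.
have [u1 cx1] := ultra_bounded_cvg UU (le1 (fun z => (P z).1 - p.1) (fun z => let: And4 h _ _ _ := sgd z in h)).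
have [w1 cy1] := ultra_bounded_cvg UU (le1 (fun z => (P z).2 - p.2) (fun z => let: And4 _ h _ _ := sgd z in h)).
have [u2 cx2] := ultra_bounded_cvg UU (le1 (fun z => (Q z).1 - q.1) (fun z => let: And4 _ _ h _ := sgd z in h)).
have [u3 cx3] := ultra_bounded_cvg UU (le1 (fun z => (S z).1 - r.1) (fun z => let: And4 _ _ _ h := sgd z in h)).
rewrite -/x1 -/y1 -/x2 -/x3 in cx1 cy1 cx2 cx3.
have [g1 h1] := pq; have [g2 h2] := qr; have [g3 h3] := rp.
have FU : ProperFilter U by exact: ultra_proper.
have PE : \forall z \near U, [/\ (P z).1 = p.1 + sg z * x1 z, (P z).2 = p.2 + sg z * y1 z,
    (Q z).1 = q.1 + sg z * x2 z & (S z).1 = r.1 + sg z * x3 z].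
  apply: filterS sg_neq0 => z sz.
  by split; rewrite /x1 /y1 /x2 /x3 mulrCA divff// mulr1 addrC subrK.

have ext X Y X0 X1 l1 X2 : jet U sg X X0 X1 l1 X2 -> (\forall z \near U, X z = Y z) ->
    jet U sg Y X0 X1 l1 X2 by move=> jX XY; exact: jet_ext XY jX.
have jc12 := ext _ (fun z => dot_chord gamma (outgoing gamma p) (P z).1 (Q z).1) _ _ _ _
  (dot_chord_jet htable hC3 sg0 cx1 cx2 g1 h1) ltac:(by apply: filterS PE => z [-> _ -> _]).
have jd12 := ext _ (fun z => cross_chord gamma (outgoing gamma p) (P z).1 (Q z).1) _ _ _ _
  (cross_chord_jet htable hC3 sg0 cx1 cx2 g1 h1) ltac:(by apply: filterS PE => z [-> _ -> _]).
have jc23 := ext _ (fun z => dot_chord gamma (outgoing gamma q) (Q z).1 (S z).1) _ _ _ _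
  (dot_chord_jet htable hC3 sg0 cx2 cx3 g2 h2) ltac:(by apply: filterS PE => z [_ _ -> ->]).
have jd23 := ext _ (fun z => cross_chord gamma (outgoing gamma q) (Q z).1 (S z).1) _ _ _ _
  (cross_chord_jet htable hC3 sg0 cx2 cx3 g2 h2) ltac:(by apply: filterS PE => z [_ _ -> ->]).
have jc31 := ext _ (fun z => dot_chord gamma (outgoing gamma r) (S z).1 (P z).1) _ _ _ _
  (dot_chord_jet htable hC3 sg0 cx3 cx1 g3 h3) ltac:(by apply: filterS PE => z [-> _ _ ->]).
have jd31 := ext _ (fun z => cross_chord gamma (outgoing gamma r) (S z).1 (P z).1) _ _ _ _
  (cross_chord_jet htable hC3 sg0 cx3 cx1 g3 h3) ltac:(by apply: filterS PE => z [-> _ _ ->]).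
have jZ1 := ext _ (fun z => gx 1 p.1 * gx 1 (P z).1 + gy 1 p.1 * gy 1 (P z).1) _ _ _ _
  (tangent_dot_jet htable hC3 sg0 p cx1) ltac:(by apply: filterS PE => z [-> _ _ _]).
have jW1 := ext _ (fun z => - gy 1 p.1 * gx 1 (P z).1 + gx 1 p.1 * gy 1 (P z).1) _ _ _ _
  (tangent_cross_jet hC3 sg0 p cx1) ltac:(by apply: filterS PE => z [-> _ _ _]).
have jZ2 := ext _ (fun z => gx 1 q.1 * gx 1 (Q z).1 + gy 1 q.1 * gy 1 (Q z).1) _ _ _ _
  (tangent_dot_jet htable hC3 sg0 q cx2) ltac:(by apply: filterS PE => z [_ _ -> _]).
have jW2 := ext _ (fun z => - gy 1 q.1 * gx 1 (Q z).1 + gx 1 q.1 * gy 1 (Q z).1) _ _ _ _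
  (tangent_cross_jet hC3 sg0 q cx2) ltac:(by apply: filterS PE => z [_ _ -> _]).
have jZ3 := ext _ (fun z => gx 1 r.1 * gx 1 (S z).1 + gy 1 r.1 * gy 1 (S z).1) _ _ _ _
  (tangent_dot_jet htable hC3 sg0 r cx3) ltac:(by apply: filterS PE => z [_ _ _ ->]).
have jW3 := ext _ (fun z => - gy 1 r.1 * gx 1 (S z).1 + gx 1 r.1 * gy 1 (S z).1) _ _ _ _
  (tangent_cross_jet hC3 sg0 r cx3) ltac:(by apply: filterS PE => z [_ _ _ ->]).
have refl (x w : R * R) (X Y W : T -> R * R) : outgoing gamma w = incoming gamma x ->
    (\forall z \near U, exists c', step (X z) (Y z) c') ->
    (\forall z \near U, exists b', step (W z) (X z) b') ->
    \forall z \near U,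
      (dot_chord gamma (outgoing gamma x) (X z).1 (Y z).1 *
       cross_chord gamma (outgoing gamma w) (W z).1 (X z).1 +
       cross_chord gamma (outgoing gamma x) (X z).1 (Y z).1 *
       dot_chord gamma (outgoing gamma w) (W z).1 (X z).1) *
      ((gx 1 x.1 * gx 1 (X z).1 + gy 1 x.1 * gy 1 (X z).1) ^+ 2 -
       (- gy 1 x.1 * gx 1 (X z).1 + gx 1 x.1 * gy 1 (X z).1) ^+ 2) -
      (dot_chord gamma (outgoing gamma x) (X z).1 (Y z).1 *
       dot_chord gamma (outgoing gamma w) (W z).1 (X z).1 -
       cross_chord gamma (outgoing gamma x) (X z).1 (Y z).1 *
       cross_chord gamma (outgoing gamma w) (W z).1 (X z).1) *
      (2 * ((gx 1 x.1 * gx 1 (X z).1 + gy 1 x.1 * gy 1 (X z).1) *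
            (- gy 1 x.1 * gx 1 (X z).1 + gx 1 x.1 * gy 1 (X z).1))) = 0.
  move=> wx XY WX; rewrite wx.
  apply: filterS2 XY WX => z [c' [E1 _]] [b' [E2 F2]].
  by rewrite F2 in E2; exact: reflection_polynomial E1 E2.
(* The reflection law at the three vertices in turn: the data rotate cyclically, so the three first
   order coefficients are the rows of one symmetric matrix. *)
have [V1 JV1 QV1] := @vertex_jet R T U FU sg sg0
  _ _ _ _ _ _ _ _ _ _ _ _ _ _ _ _ _ _
  (lt0r_neq0 s10) (lt0r_neq0 b0) (lt0r_neq0 c0) _ _ _ _ _ _
  jc12 jd12 jc31 jd31 jZ1 jW1 (refl _ _ _ _ _ h3 sPQ sSP).
have [V2 JV2 QV2] := @vertex_jet R T U FU sg sg0
  _ _ _ _ _ _ _ _ _ _ _ _ _ _ _ _ _ _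
  (lt0r_neq0 s20) (lt0r_neq0 c0) (lt0r_neq0 a0) _ _ _ _ _ _
  jc23 jd23 jc12 jd12 jZ2 jW2 (refl _ _ _ _ _ h1 sQS sPQ).
have [V3 JV3 QV3] := @vertex_jet R T U FU sg sg0
  _ _ _ _ _ _ _ _ _ _ _ _ _ _ _ _ _ _
  (lt0r_neq0 s30) (lt0r_neq0 a0) (lt0r_neq0 b0) _ _ _ _ _ _
  jc31 jd31 jc23 jd23 jZ3 jW3 (refl _ _ _ _ _ h2 sSP sQS).
have near0 : \forall z \near U, (fun=> 0) z = 0 :> R by exact: nearW.
have e1 := @jet_vanish1 R T U FU sg sg0 sg_neq0 _ _ _ _ _ JV1 erefl near0.
have e2 := @jet_vanish1 R T U FU sg sg0 sg_neq0 _ _ _ _ _ JV2 erefl near0.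
have e3 := @jet_vanish1 R T U FU sg sg0 sg_neq0 _ _ _ _ _ JV3 erefl near0.
have {}QV1 := QV1 e1; have {}QV2 := QV2 e2; have {}QV3 := QV3 e3.
(* The tangent at the moving point, turned by the angle there, is parallel to the chord; the first
   order of this identity gives the variation of the angle, once for the outgoing and once for the
   incoming chord. *)
have [X2 [Y2 [jo jo']]] := turn_jet sg0 cx1 cy1 p.1 p.2 (outgoing gamma p) 1.
have [X3 [Y3 [ji ji']]] := turn_jet sg0 cx1 cy1 p.1 p.2 (outgoing gamma r) (-1).
have jM X Y X0 X1 l1 Z2 Y0 Y1 m1 W2 := @jetM R T U FU sg sg0 X Y X0 X1 l1 Z2 Y0 Y1 m1 W2.
have jB X Y X0 X1 l1 Z2 Y0 Y1 m1 W2 := @jetB R T U FU sg X Y X0 X1 l1 Z2 Y0 Y1 m1 W2.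
have jo2 := jB _ _ _ _ _ _ _ _ _ _ (jM _ _ _ _ _ _ _ _ _ _ jc12 jo')
  (jM _ _ _ _ _ _ _ _ _ _ jd12 jo).
have ji2 := jB _ _ _ _ _ _ _ _ _ _ (jM _ _ _ _ _ _ _ _ _ _ jc31 ji')
  (jM _ _ _ _ _ _ _ _ _ _ jd31 ji).
have [fo1 fo1'] := outgoing_frame1 htable p.
have [fo2 fo2'] := outgoing_frame2 htable hC3 p.
have [fi1 fi1'] := incoming_frame1 htable p; rewrite -h3 in fi1 fi1'.
have [fi2 fi2'] := incoming_frame2 htable hC3 p; rewrite -h3 in fi2 fi2'.
have cs := cos2Dsin2 p.2.
have chord (X Y : R * R) c' : step X Y c' ->
    (gx 0 Y.1 - gx 0 X.1 = c' * (outgoing gamma X).1) *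
    (gy 0 Y.1 - gy 0 X.1 = c' * (outgoing gamma X).2).
  by move=> [XY _]; rewrite !(gx0E, gy0E) XY/=; split; rewrite addrC addKr.
have near2 : \forall z \near U, dot_chord gamma (outgoing gamma p) (P z).1 (Q z).1 *
    (cos (p.2 + sg z * y1 z) * (- (outgoing gamma p).2 * gx 1 (p.1 + sg z * x1 z) +
       (outgoing gamma p).1 * gy 1 (p.1 + sg z * x1 z)) +
     1 * sin (p.2 + sg z * y1 z) * ((outgoing gamma p).1 * gx 1 (p.1 + sg z * x1 z) +
       (outgoing gamma p).2 * gy 1 (p.1 + sg z * x1 z))) -
    cross_chord gamma (outgoing gamma p) (P z).1 (Q z).1 *
    (cos (p.2 + sg z * y1 z) * ((outgoing gamma p).1 * gx 1 (p.1 + sg z * x1 z) +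
       (outgoing gamma p).2 * gy 1 (p.1 + sg z * x1 z)) -
     1 * sin (p.2 + sg z * y1 z) * (- (outgoing gamma p).2 * gx 1 (p.1 + sg z * x1 z) +
       (outgoing gamma p).1 * gy 1 (p.1 + sg z * x1 z))) = 0.
  apply: filterS2 PE sPQ => z [<- <- _ _] [c' /chord[E1 E2]].
  rewrite /dot_chord /cross_chord E1 E2 outgoingE [outgoing gamma (P z)]outgoingE/=.
  move: (gx 1 p.1) (gy 1 p.1) (gx 1 (P z).1) (gy 1 (P z).1) => *; ring.
have near3 : \forall z \near U, dot_chord gamma (outgoing gamma r) (S z).1 (P z).1 *
    (cos (p.2 + sg z * y1 z) * (- (outgoing gamma r).2 * gx 1 (p.1 + sg z * x1 z) +
       (outgoing gamma r).1 * gy 1 (p.1 + sg z * x1 z)) +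
     - 1 * sin (p.2 + sg z * y1 z) * ((outgoing gamma r).1 * gx 1 (p.1 + sg z * x1 z) +
       (outgoing gamma r).2 * gy 1 (p.1 + sg z * x1 z))) -
    cross_chord gamma (outgoing gamma r) (S z).1 (P z).1 *
    (cos (p.2 + sg z * y1 z) * ((outgoing gamma r).1 * gx 1 (p.1 + sg z * x1 z) +
       (outgoing gamma r).2 * gy 1 (p.1 + sg z * x1 z)) -
     - 1 * sin (p.2 + sg z * y1 z) * (- (outgoing gamma r).2 * gx 1 (p.1 + sg z * x1 z) +
       (outgoing gamma r).1 * gy 1 (p.1 + sg z * x1 z))) = 0.
  apply: filterS2 PE sSP => z [<- <- _ _] [b' SP].
  have [E1 E2] := chord _ _ _ SP; have [_ SPin] := SP.
  rewrite /dot_chord /cross_chord E1 E2 SPin [incoming gamma (P z)]incomingE/=.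
  move: (outgoing gamma r).1 (outgoing gamma r).2 (gx 1 (P z).1) (gy 1 (P z).1) => *; ring.
have vanish1 X X0 X1 l1 Z2 := @jet_vanish1 R T U FU sg sg0 sg_neq0 X X0 X1 l1 Z2.
have R2 : c * (kap p.1 * u1 + w1) = sin p.2 * u1 + sin q.2 * u2.
  have := vanish1 _ _ _ _ _ jo2 _ near2.
  rewrite fo1 fo1' fo2 fo2' => E; apply/eqP; rewrite -subr_eq0; apply/eqP.
  rewrite -[LHS]mulr1 -cs -[RHS]E; last by move: (cos p.2) (sin p.2) => *; ring.
  by move: (kap p.1) (cos p.2) (sin p.2) (cos q.2) (sin q.2) => *; ring.
have R3 : b * (kap p.1 * u1 - w1) = sin p.2 * u1 + sin r.2 * u3.
  have := vanish1 _ _ _ _ _ ji2 _ near3.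
  rewrite fi1 fi1' fi2 fi2' => E; apply/eqP; rewrite -subr_eq0; apply/eqP.
  rewrite -[LHS]mulr1 -cs -[RHS]E; last by move: (cos p.2) (sin p.2) => *; ring.
  by move: (kap p.1) (cos p.2) (sin p.2) (cos r.2) (sin r.2) => *; ring.
exists sg, (u1, w1); split=> //=.
- apply/negPn/negP; rewrite negb_or !negbK => /andP[/eqP u10 /eqP w10].
  have u20 : u2 = 0.
    move: R2; rewrite u10 w10 !mulr0 addr0 mulr0 add0r => /esym/eqP.
    by rewrite mulf_eq0 (gt_eqF s20) => /eqP.
  have u30 : u3 = 0.
    move: R3; rewrite u10 w10 !mulr0 subr0 mulr0 add0r => /esym/eqP.
    by rewrite mulf_eq0 (gt_eqF s30) => /eqP.
  have small (f : T -> R) : f z / sg z @[z --> U] --> (0 : R) ->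
      \forall z \near U, `|f z| < sg z.
    move=> /cvgrPdist_lt/(_ 1 ltr01); apply: filterS2 sg_gt0 => z sz.
    by rewrite sub0r normrN normrM normfV (gtr0_norm sz) ltr_pdivrMr// mul1r.
  rewrite u10 in cx1; rewrite w10 in cy1; rewrite u20 in cx2; rewrite u30 in cx3.
  have [z [[h1' h2'] [h3' h4']]] := filter_ex (filterI
    (filterI (small _ cx1) (small _ cy1)) (filterI (small _ cx2) (small _ cx3))).
  have : sg z < sg z by rewrite {1}/sg !gt_max h1' h2' h3' h4'.
  by rewrite ltxx.
- exists u2, u3; split=> //=.
    by split; [rewrite -[RHS]e1|rewrite -[RHS]e2|rewrite -[RHS]e3]; ring.
  move=> v1 v2 v3 E1 E2 E3.
  (* As the Hessian is symmetric and [v] is in its kernel, the first order coefficient of this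
     combination vanishes at every [z], as [jet_vanish2] requires. *)
  have jV := @jetD _ _ _ FU _ _ _ _ _ _ _ _ _ _ _
    (@jetZ _ _ _ FU _ v1 _ _ _ _ _ JV1)
    (@jetD _ _ _ FU _ _ _ _ _ _ _ _ _ _ _ (@jetZ _ _ _ FU _ v2 _ _ _ _ _ JV2)
      (@jetZ _ _ _ FU _ v3 _ _ _ _ _ JV3)).
  have := @jet_vanish2 R T U FU sg sg_neq0 _ _ _ _ _ jV.
  rewrite -QV1 -QV2 -QV3 => V0.
  have {}V0 : v1 * V1 + (v2 * V2 + v3 * V3) = 0.
    apply: V0 => [||z]; first by rewrite !mulr0 !addr0.
      by apply: nearW => z; rewrite !mulr0 !addr0.
    transitivity (x1 z * 0 + x2 z * 0 + x3 z * 0); last by rewrite !mulr0 !addr0.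
    rewrite -[X in _ = x1 z * X + _ + _]E1 -[X in _ = _ + x2 z * X + _]E2.
    rewrite -[X in _ = _ + _ + x3 z * X]E3; ring.
  by rewrite -[RHS](mulr0 2) -V0; ring.
Unshelve. all: by end_near. Qed.

End OrbitLimit.

(** * Continuity of the billiard map *)

Section BilliardSteps.
Context {R : realType} (l : R) (gamma : R -> R * R) (D : set (R * R)).
Hypothesis htable : billiard_table l gamma D.
Hypothesis hC3 : curve_Cn 3 gamma.
Local Notation gx := (gx gamma).
Local Notation gy := (gy gamma).

Lemma gamma_notin t : ~ D (gamma t).
Proof.
move=> Dt; have : (closure D `\` interior D) (gamma t).
  by rewrite (table_boundary htable); exists t.
by move=> [_]; apply; move: (table_open htable); rewrite openE; apply.
Qed.

Lemma gamma_shift (k : int) t : gamma (t + k%:~R * l) = gamma t.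
Proof.
have nat_shift (n : nat) s : gamma (s + n%:R * l) = gamma s.
  elim: n s => [|n IH] s; first by rewrite mul0r addr0.
  by rewrite -natr1 mulrDl mul1r addrA (table_closed htable).
case: k => n; first exact: nat_shift.
rewrite NegzE mulrNz mulNr; have := nat_shift n.+1 (t - n.+1%:R * l).
by rewrite subrK => ->.
Qed.

Lemma tangent_shift (k : int) t : tangent gamma (t + k%:~R * l) = tangent gamma t.
Proof.
have E : (fun h : R => h^-1 *: (gamma (h + (t + k%:~R * l)) - gamma (t + k%:~R * l))) =
    (fun h => h^-1 *: (gamma (h + t) - gamma t)).
  by apply/funext => h; rewrite addrA !gamma_shift.
by rewrite /tangent /derive1 E.
Qed.

Lemma outgoing_shift (k : int) p :
  outgoing gamma (p.1 + k%:~R * l, p.2) = outgoing gamma p.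
Proof. by rewrite /outgoing /= tangent_shift. Qed.

Lemma incoming_shift (k : int) p :
  incoming gamma (p.1 + k%:~R * l, p.2) = incoming gamma p.
Proof. by rewrite /incoming /= tangent_shift. Qed.

Lemma billiard_map_shiftl (k : int) p q : billiard_map gamma D p q ->
  billiard_map gamma D (p.1 + k%:~R * l, p.2) q.
Proof.
move=> [Hp Hq [tau tau0 [H1 H2 H3]]]; split; [exact: Hp|exact: Hq|exists tau; first exact: tau0].
by rewrite outgoing_shift gamma_shift; split.
Qed.

Lemma billiard_map_shiftr (k : int) p q : billiard_map gamma D p q ->
  billiard_map gamma D p (q.1 + k%:~R * l, q.2).
Proof.
move=> [Hp Hq [tau tau0 [H1 H2 H3]]]; split; [exact: Hp|exact: Hq|exists tau; first exact: tau0].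
by rewrite incoming_shift gamma_shift; split.
Qed.

(** Rounding to the nearest integer, hence the [2^-1]. Lifts taken in such a window are bounded, so
    they converge along ultrafilters, and [gamma_window_inj] identifies their limits. *)
Lemma int_shift_window (t t0 : R) :
  exists k : int, `|t + k%:~R * l - t0| <= l / 2.
Proof.
have l0 := table_length htable.
exists (- Num.floor ((t - t0) / l + 2^-1)).
have /andP[f1 f2] := floor_itv ((t - t0) / l + 2^-1).
move: f1 f2; rewrite intrD1 mulrNz; move: (Num.floor _)%:~R => k f1 f2.
have E : t - t0 = (t - t0) / l * l by rewrite divfK ?gt_eqF.
have -> : t + - k * l - t0 = ((t - t0) / l - k) * l.
  by rewrite mulrBl -E; ring.
rewrite normrM (gtr0_norm l0) [l / 2]mulrC ler_wpM2r ?(ltW l0)//.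
by rewrite ler_norml; apply/andP; split; lra.
Qed.

Lemma gamma_window_inj t t' : `|t' - t| <= l / 2 -> gamma t = gamma t' -> t' = t.
Proof.
move=> win /(table_simple htable)[k tk]; have l0 := table_length htable.
suff k0 : k = 0 by rewrite tk k0 mul0r addr0.
apply/eqP; rewrite -[k == 0]negbK; apply/negP => k0.
have : 1 <= `|k%:~R : R|.
  by rewrite -intr_norm -[1]/(1%:~R) ler_int -gtz0_ge1 normr_gt0.
move: win; rewrite tk addrC addKr normrM (gtr0_norm l0).
move: (`|_|) => x xl x1.
have : l <= x * l by rewrite ler_peMl// ltW.
by move: l0; lra.
Qed.

Lemma sin_phase_gt0 (p : R * R) : phase_strip p -> 0 < sin p.2.
Proof. by move=> H; apply: sin_gt0_pi; rewrite /phase_strip/= in H. Qed.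

Lemma billiard_chord p q : billiard_map gamma D p q -> exists2 c, 0 < c &
  chord_step gamma p q c /\
  forall s, 0 < s < c -> D (gamma p.1 + s *: outgoing gamma p).
Proof. by move=> [_ _ [tau tau0 [H1 H2 H3]]]; exists tau. Qed.

Lemma gx_continuous k t : (k < 3)%N -> {for t, continuous (gx k)}.
Proof. move=> k3; exact: is_derive_continuous (gx_derive hC3 t k3). Qed.

Lemma gy_continuous k t : (k < 3)%N -> {for t, continuous (gy k)}.
Proof. move=> k3; exact: is_derive_continuous (gy_derive hC3 t k3). Qed.

Lemma gx_cvg (T : Type) (U : set_system T) {FU : Filter U} (f : T -> R) t k :
  (k < 3)%N -> f @ U --> t -> gx k (f z) @[z --> U] --> gx k t.
Proof. by move=> k3 ft; apply: cvg_comp ft _; exact: gx_continuous. Qed.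

Lemma gy_cvg (T : Type) (U : set_system T) {FU : Filter U} (f : T -> R) t k :
  (k < 3)%N -> f @ U --> t -> gy k (f z) @[z --> U] --> gy k t.
Proof. by move=> k3 ft; apply: cvg_comp ft _; exact: gy_continuous. Qed.

Lemma dot_chord_cvg (T : Type) (U : set_system T) {FU : Filter U}
    (e1 e2 f g : T -> R) (e : R * R) t t' :
  e1 @ U --> e.1 -> e2 @ U --> e.2 -> f @ U --> t -> g @ U --> t' ->
  dot_chord gamma (e1 z, e2 z) (f z) (g z) @[z --> U] --> dot_chord gamma e t t'.
Proof.
move=> ce1 ce2 cf cg; rewrite /dot_chord/=; apply: cvgD; apply: cvgM => //.
  by apply: cvgB; exact: gx_cvg.
by apply: cvgB; exact: gy_cvg.
Qed.

Lemma cross_chord_cvg (T : Type) (U : set_system T) {FU : Filter U}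
    (e1 e2 f g : T -> R) (e : R * R) t t' :
  e1 @ U --> e.1 -> e2 @ U --> e.2 -> f @ U --> t -> g @ U --> t' ->
  cross_chord gamma (e1 z, e2 z) (f z) (g z) @[z --> U] --> cross_chord gamma e t t'.
Proof.
move=> ce1 ce2 cf cg; rewrite /cross_chord/=; apply: cvgD; apply: cvgM => //.
- exact: cvgN.
- by apply: cvgB; exact: gx_cvg.
- by apply: cvgB; exact: gy_cvg.
Qed.

(** Two scalar equations in place of a vector equation: they pass to limits and isolate the length
    [s]. *)
Lemma gamma_dot_cross (e : R * R) t t' (s : R) : e.1 ^+ 2 + e.2 ^+ 2 = 1 ->
  gamma t' = gamma t + s *: e <->
  dot_chord gamma e t t' = s /\ cross_chord gamma e t t' = 0.
Proof.
rewrite /dot_chord /cross_chord !gx0E !gy0E => e1; split.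
  move=> ->; rewrite /= !(addrC (gamma t).1) !(addrC (gamma t).2) !addrK /GRing.scale/=.
  by split; [rewrite -[RHS]mulr1 -e1; ring|ring].
move: (gamma t) (gamma t') => [x y] [x' y'] /= [<- E].
have e1' : 1 = e.1 ^+ 2 + e.2 ^+ 2 by [].
have X : x' - x = (e.1 * (x' - x) + e.2 * (y' - y)) * e.1 -
    (- e.2 * (x' - x) + e.1 * (y' - y)) * e.2.
  by rewrite -[LHS]mulr1 e1'; ring.
have Y : y' - y = (e.1 * (x' - x) + e.2 * (y' - y)) * e.2 +
    (- e.2 * (x' - x) + e.1 * (y' - y)) * e.1.
  by rewrite -[LHS]mulr1 e1'; ring.
rewrite E mul0r subr0 in X; rewrite E mul0r addr0 in Y.
by rewrite [RHS]surjective_pairing/= /GRing.scale/= -X -Y !subrKC.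
Qed.

(* A chord cannot collapse, since it makes an angle bounded away from zero with
   the tangent. *)
Lemma chord_not_collapsing (T : Type) (U : set_system T) {FU : ProperFilter U}
    (e1 e2 f g : T -> R) (e : R * R) t :
  e1 @ U --> e.1 -> e2 @ U --> e.2 -> f @ U --> t -> g @ U --> t ->
  (\forall z \near U, f z != g z) ->
  (\forall z \near U, cross_chord gamma (e1 z, e2 z) (f z) (g z) = 0) ->
  - e.2 * gx 1 t + e.1 * gy 1 t = 0.
Proof.
move=> ce1 ce2 cf cg fg cr.
have der z (x : R) : is_derive x 1 (fun x => - e2 z * gx 0 x + e1 z * gy 0 x)
    (- e2 z * gx 1 x + e1 z * gy 1 x).
  have dx := gx_derive hC3 x (isT : (0 < 3)%N).
  have dy := gy_derive hC3 x (isT : (0 < 3)%N).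
  have dc1 : is_derive x 1 (cst (- e2 z) : R -> R) 0 by exact: is_derive_cst.
  have dc2 : is_derive x 1 (cst (e1 z) : R -> R) 0 by exact: is_derive_cst.
  have := is_derive_dot dc1 dx dc2 dy.
  by rewrite /= !mul0r !addr0.
have [xi Hxi] := choice (fun z => mean_value (x := f z) (y := g z) (fun x _ => der z x)).
have cxi : xi @ U --> t.
  have fgt : `|g z - f z| @[z --> U] --> (0 : R).
    by rewrite -(normr0 R) -(subrr t); apply: cvg_norm; exact: cvgB.
  apply/cvgrPdist_lt => eps eps0.
  have := cf; move=> /cvgrPdist_lt/(_ (eps / 2)).
  rewrite divr_gt0// => /(_ isT) cf'.
  have := fgt; move=> /cvgrPdist_lt/(_ (eps / 2)).
  rewrite divr_gt0// => /(_ isT) fgt'.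
  apply: filterS2 cf' fgt' => z; rewrite sub0r normrN normr_id => h1 h2.
  have -> : t - xi z = (t - f z) - (xi z - f z) by ring.
  rewrite (le_lt_trans (ler_normB _ _))// [eps]splitr ltrD//.
  by rewrite (le_lt_trans (Hxi z).1).
have lim : - e2 z * gx 1 (xi z) + e1 z * gy 1 (xi z) @[z --> U] -->
    - e.2 * gx 1 t + e.1 * gy 1 t.
  apply: cvgD; apply: cvgM => //; [exact: cvgN|exact: gx_cvg|exact: gy_cvg].
apply: (cvg_unique _ lim) => //.
apply: cvg_near_cst; apply: filterS2 fg cr => z fgz crz.
apply/eqP; have := (Hxi z).2.
have -> : - e2 z * gx 0 (g z) + e1 z * gy 0 (g z) -
  (- e2 z * gx 0 (f z) + e1 z * gy 0 (f z)) =
  cross_chord gamma (e1 z, e2 z) (f z) (g z) by rewrite /cross_chord/=; ring.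
move=> /esym/eqP; rewrite crz mulf_eq0 => /orP[//|].
by rewrite subr_eq0 eq_sym (negPf fgz).
Qed.

End BilliardSteps.

Section StepContinuity.
Context {R : realType} (l : R) (gamma : R -> R * R) (D : set (R * R)).
Hypothesis htable : billiard_table l gamma D.
Hypothesis hC3 : curve_Cn 3 gamma.
Local Notation gx := (gx gamma).
Local Notation gy := (gy gamma).

(* A trajectory close to the one from p to q crosses the boundary near q, by the
   intermediate value theorem, so that it cannot stay in D for longer. *)
Lemma crossing (T : Type) (U : set_system T) (UU : UltraFilter U)
    (e1 e2 f : T -> R) (e : R * R) (t t' s s' : R) :
  e1 @ U --> e.1 -> e2 @ U --> e.2 -> f @ U --> t ->
  dot_chord gamma e t t' = s -> cross_chord gamma e t t' = 0 ->
  0 < s -> s < s' -> 0 < - e.2 * gx 1 t' + e.1 * gy 1 t' ->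
  \forall z \near U, exists2 t'', 0 < dot_chord gamma (e1 z, e2 z) (f z) t'' < s' &
    cross_chord gamma (e1 z, e2 z) (f z) t'' = 0.
Proof.
move=> ce1 ce2 cf dt ct s0 ss' tr0.
have FU : ProperFilter U by exact: ultra_proper.
pose h (a b : R) (x : R) := - b * gx 0 x + a * gy 0 x.
have dh (a b x : R) : is_derive x 1 (h a b) (- b * gx 1 x + a * gy 1 x).
  have dx := gx_derive hC3 x (isT : (0 < 3)%N).
  have dy := gy_derive hC3 x (isT : (0 < 3)%N).
  have dc1 : is_derive x 1 (cst (- b) : R -> R) 0 by exact: is_derive_cst.
  have dc2 : is_derive x 1 (cst a : R -> R) 0 by exact: is_derive_cst.
  by have := is_derive_dot dc1 dx dc2 dy; rewrite /= !mul0r !addr0.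
have hE (a b x y : R) : cross_chord gamma (a, b) x y = h a b y - h a b x.
  by rewrite /cross_chord /h/=; ring.
set m := - e.2 * gx 1 t' + e.1 * gy 1 t' in tr0.
have [d1 d10 Hd1] := derive_small (dh e.1 e.2 t') (divr_gt0 tr0 (ltr0n _ 2)).
have cdot : dot_chord gamma e t x @[x --> t'] --> s.
  rewrite -dt [e in dot_chord _ e]surjective_pairing.
  have := @dot_chord_cvg _ _ hC3 R (nbhs t') _ (cst e.1) (cst e.2) (cst t) id e t t'.
  rewrite -surjective_pairing; apply; [exact: cvg_cst..|exact: cvg_id].
have mn : 0 < Num.min s (s' - s) by rewrite lt_min s0 subr_gt0.
have := cdot; move=> /cvgrPdist_lt/(_ _ mn)/nbhs_ballP[d2 /= d20 Hd2].
(* Below [d1] the offset from the trajectory has opposite signs at the two ends of the interval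
   around [t']; below [d2] the length stays strictly between 0 and [s']. *)
pose d := Num.min d1 d2 / 2.
have d0 : 0 < d by rewrite divr_gt0// lt_min d10.
have dd1 : d < d1.
  rewrite /d ltr_pdivrMr//; have : Num.min d1 d2 <= d1 by rewrite ge_min lexx.
  by move=> /le_lt_trans; apply; rewrite ltr_pMr ?ltr1n.
have dd2 : d < d2.
  rewrite /d ltr_pdivrMr//; have : Num.min d1 d2 <= d2 by rewrite ge_min lexx orbT.
  move=> /le_lt_trans; apply; by rewrite ltr_pMr ?ltr1n.
have cross_at (x : R) : cross_chord gamma e t x = h e.1 e.2 x - h e.1 e.2 t'.
  by rewrite -[LHS]subr0 -ct [e in cross_chord _ e]surjective_pairing !hE; ring.
have pos : 0 < cross_chord gamma e t (t' + d).
  rewrite cross_at; have := Hd1 d; rewrite (gtr0_norm d0) => /(_ dd1).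
  rewrite ler_norml => /andP[+ _]; rewrite -/m; have := mulr_gt0 tr0 d0; lra.
have neg : cross_chord gamma e t (t' - d) < 0.
  rewrite cross_at; have := Hd1 (- d); rewrite normrN (gtr0_norm d0) => /(_ dd1).
  rewrite ler_norml => /andP[_]; rewrite -/m; have := mulr_gt0 tr0 d0; lra.
have cc (x : R) : cross_chord gamma (e1 z, e2 z) (f z) x @[z --> U] -->
    cross_chord gamma e t x.
  by apply: cross_chord_cvg => //; exact: cvg_cst.
have npos : \forall z \near U, 0 < cross_chord gamma (e1 z, e2 z) (f z) (t' + d).
  have /cvgrPdist_lt/(_ _ pos) := cc (t' + d); apply: filterS => z.
  by rewrite ltr_norml => /andP[_]; lra.
have nneg : \forall z \near U, cross_chord gamma (e1 z, e2 z) (f z) (t' - d) < 0.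
  have := cc (t' - d); move=> /cvgrPdist_lt/(_ (- cross_chord gamma e t (t' - d))).
  rewrite oppr_gt0 => /(_ neg); apply: filterS => z.
  by rewrite ltr_norml => /andP[+ _]; lra.
have ivt z : exists t'', 0 < cross_chord gamma (e1 z, e2 z) (f z) (t' + d) ->
    cross_chord gamma (e1 z, e2 z) (f z) (t' - d) < 0 ->
    `|t'' - t'| <= d /\ cross_chord gamma (e1 z, e2 z) (f z) t'' = 0.
  have [H|nH] := pselect (0 < cross_chord gamma (e1 z, e2 z) (f z) (t' + d) /\
    cross_chord gamma (e1 z, e2 z) (f z) (t' - d) < 0); last first.
    by exists 0 => h1 h2; case: nH.
  case: H => h1 h2; rewrite !hE subr_gt0 in h1; rewrite !hE subr_lt0 in h2.
  have [|||t'' + E] := @IVT R (h (e1 z) (e2 z)) (t' - d) (t' + d) (h (e1 z) (e2 z) (f z)).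
  - lra.
  - apply: continuous_subspaceT => x; exact: is_derive_continuous (dh _ _ x).
  - by rewrite ge_min le_max (ltW h1) (ltW h2) orbT.
  rewrite in_itv/= => /andP[i1 i2].
  exists t'' => _ _; rewrite hE E subrr; split=> //.
  by rewrite ler_norml; apply/andP; split; lra.
have [t2 Ht2] := choice ivt.
have nt2 : \forall z \near U, `|t2 z - t'| <= d /\
    cross_chord gamma (e1 z, e2 z) (f z) (t2 z) = 0.
  by apply: filterS2 npos nneg => z h1 h2; exact: Ht2.
(* The crossing parameters converge to a point within [d] of [t'], where [d2] controls the length;
   this replaces an estimate uniform in [z]. *)
have [t3 ct3] : exists t3 : R, t2 @ U --> t3.
  apply: (@ultra_bounded_cvg R T U t2 (`|t'| + d) UU).
  apply: filterS nt2 => z [h1 _]; rewrite -[X in `|X|](subrKC t').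
  by rewrite (le_trans (ler_normD _ _))// lerD2l.
have t3d : `|t3 - t'| <= d.
  have cn : `|t2 z - t'| @[z --> U] --> `|t3 - t'|.
    by apply: cvg_norm; apply: cvgB => //; exact: cvg_cst.
  by apply: cvgr_to_le cn _; apply: filterS nt2 => z [].
have cdz : dot_chord gamma (e1 z, e2 z) (f z) (t2 z) @[z --> U] --> dot_chord gamma e t t3.
  exact: dot_chord_cvg.
have := Hd2 t3; rewrite /ball/= distrC => /(_ (le_lt_trans t3d dd2)).
rewrite lt_min !ltr_norml => /andP[/andP[_ l1] /andP[l2 _]].
have l1' : 0 < dot_chord gamma e t t3 by lra.
have l2' : 0 < s' - dot_chord gamma e t t3 by lra.
have := cdz; move=> /cvgrPdist_lt/(_ _ l1') n1.
have := cdz; move=> /cvgrPdist_lt/(_ _ l2') n2.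
apply: filterS3 nt2 n1 n2 => z [_ c0]; rewrite !ltr_norml => /andP[_ m1] /andP[m2 _].
by exists (t2 z) => //; apply/andP; split; lra.
Qed.

(** The limit of the lengths cannot exceed the length from [p] to [q], as by [crossing] the nearby
    trajectories would have met the boundary before. If it were smaller, the limit point would be in
    [D], or, for length zero, [chord_not_collapsing] would apply. Directions rather than angles are
    propagated, so no angle has to be recovered from its cosine and sine. *)
Lemma billiard_step_cvg (T : Type) (U : set_system T) (UU : UltraFilter U)
    (P Q : T -> R * R) (p q : R * R) :
  billiard_map gamma D p q ->
  (\forall z \near U, billiard_map gamma D (P z) (Q z)) ->
  (P z).1 @[z --> U] --> p.1 ->
  (outgoing gamma (P z)).1 @[z --> U] --> (outgoing gamma p).1 ->
  (outgoing gamma (P z)).2 @[z --> U] --> (outgoing gamma p).2 ->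
  (\forall z \near U, `|(Q z).1 - q.1| <= l / 2) ->
  [/\ (Q z).1 @[z --> U] --> q.1,
      (outgoing gamma (Q z)).1 @[z --> U] --> (outgoing gamma q).1 &
      (outgoing gamma (Q z)).2 @[z --> U] --> (outgoing gamma q).2].
Proof.
move=> pq PQ cP ce1 ce2 Qwin.
have FU : ProperFilter U by exact: ultra_proper.
have l0 := table_length htable.
have [c0 c00 [[g1 g2] Dpq]] := billiard_chord pq.
have sp : 0 < sin p.2 by case: pq => /sin_phase_gt0.
have sq : 0 < sin q.2 by case: pq => _ /sin_phase_gt0.
have [t ct] : exists t : R, (Q z).1 @[z --> U] --> t.
  apply: (@ultra_bounded_cvg R T U (fun z => (Q z).1) (`|q.1| + l / 2) UU).
  apply: filterS Qwin => z h; rewrite -[X in `|X|](subrKC q.1).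
  by rewrite (le_trans (ler_normD _ _))// lerD2l.
have twin : `|t - q.1| <= l / 2.
  have cn : `|(Q z).1 - q.1| @[z --> U] --> `|t - q.1|.
    by apply: cvg_norm; apply: cvgB => //; exact: cvg_cst.
  exact: cvgr_to_le cn Qwin.
pose e := outgoing gamma p.
pose e' z := outgoing gamma (P z).
have e'1 z : (e' z).1 ^+ 2 + (e' z).2 ^+ 2 = 1 by exact: outgoing_unit htable (P z).
have e1 : e.1 ^+ 2 + e.2 ^+ 2 = 1 by exact: outgoing_unit htable p.
pose tau z := dot_chord gamma (e' z) (P z).1 (Q z).1.
have PQ' : \forall z \near U, [/\ 0 < tau z,
    cross_chord gamma (e' z) (P z).1 (Q z).1 = 0 &
    forall s, 0 < s < tau z -> D (gamma (P z).1 + s *: e' z)].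
  apply: filterS PQ => z /billiard_chord[c' c'0 [[+ _] DPQ]].
  move=> /(gamma_dot_cross gamma _ _ _ (e'1 z))[E1 E2].
  by rewrite /tau E1; split.
have e'E z : e' z = ((e' z).1, (e' z).2) by rewrite -surjective_pairing.
have ctau : tau z @[z --> U] --> dot_chord gamma e p.1 t.
  by rewrite /tau; under eq_fun do rewrite e'E; exact: dot_chord_cvg.
have ccross : cross_chord gamma (e' z) (P z).1 (Q z).1 @[z --> U] -->
    cross_chord gamma e p.1 t.
  by under eq_fun do rewrite e'E; exact: cross_chord_cvg.
have cross0 : cross_chord gamma e p.1 t = 0.
  apply: (cvg_unique _ ccross) => //.
  by apply: cvg_near_cst; apply: filterS PQ' => z [_ ->].
set tau1 := dot_chord gamma e p.1 t in ctau.
have tau10 : 0 <= tau1.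
  by apply: cvgr_to_ge ctau _; apply: filterS PQ' => z [/ltW].
have gt1 : gamma t = gamma p.1 + tau1 *: e by apply/(gamma_dot_cross gamma _ _ _ e1).
have tauE : tau1 = c0.
  apply/eqP; rewrite eq_le !leNgt; apply/andP; split; apply/negP => lt_tau.
  - have [E1 E2] := (gamma_dot_cross gamma p.1 q.1 c0 e1).1 g1.
    have tr : 0 < - e.2 * gx 1 q.1 + e.1 * gy 1 q.1.
      by rewrite /e g2; have [_ ->] := incoming_frame1 htable q.
    pose s' := (c0 + tau1) / 2.
    have cs' : c0 < s' by rewrite /s'; lra.
    have H := crossing UU ce1 ce2 cP E1 E2 c00 cs' tr.
    have lt_s : 0 < tau1 - s' by rewrite /s'; lra.
    have := ctau; move=> /cvgrPdist_lt/(_ _ lt_s) H2.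
    have [z [[[_ _ DPQ] [t'' /andP[d1 d2] cr]] lt3]] := filter_ex (filterI (filterI PQ' H) H2).
    rewrite -surjective_pairing -/(e' z) in d1 d2 cr.
    apply: (gamma_notin htable (t := t'')).
    rewrite ((gamma_dot_cross gamma (P z).1 t'' _ (e'1 z)).2 (conj erefl cr)).
    apply: DPQ; rewrite d1 (lt_trans d2)//.
    by move: lt3; rewrite ltr_norml => /andP[_]; lra.
  - move: tau10; rewrite le_eqVlt => /orP[/eqP tau10|tau10]; last first.
      apply: (gamma_notin htable (t := t)); rewrite gt1; apply: Dpq.
      by rewrite tau10.
    have /(table_simple htable)[k tk] : gamma p.1 = gamma t.
      by rewrite gt1 -tau10 scale0r addr0.
    have H : - e.2 * gx 1 p.1 + e.1 * gy 1 p.1 = 0.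
      apply: (@chord_not_collapsing _ _ hC3 _ U FU _ _ (fun z => (P z).1)
        (fun z => (Q z).1 - k%:~R * l) e p.1 ce1 ce2 cP).
      + by rewrite -[X in _ --> X](addrK (k%:~R * l)) -tk; apply: cvgB => //; exact: cvg_cst.
      + apply: filterS PQ' => z [tz _ _]; apply: contraTneq tz => PQz.
        have : gamma (Q z).1 = gamma (P z).1.
          by rewrite PQz -(gamma_shift htable k ((Q z).1 - _)) subrK.
        by rewrite /tau /dot_chord !gx0E !gy0E => ->; rewrite !subrr !mulr0 addr0 ltxx.
      + apply: filterS PQ' => z [_ + _]; rewrite /cross_chord !gx0E !gy0E/=.
        have -> // : gamma ((Q z).1 - k%:~R * l) = gamma (Q z).1.
        by rewrite -(gamma_shift htable k ((Q z).1 - _)) subrK.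
    have [_ E] := outgoing_frame1 htable p.
    by move: H; rewrite /e E => /eqP; rewrite oppr_eq0 gt_eqF.
have tq : t = q.1 by apply: (gamma_window_inj htable twin); rewrite g1 gt1 tauE.
rewrite tq in ct.
(* The incoming direction is reflected in the tangent by a polynomial formula in quantities known to
   converge. *)
have oQ : \forall z \near U, outgoing gamma (Q z) =
   (let: A := (e' z).1 * gx 1 (Q z).1 + (e' z).2 * gy 1 (Q z).1 in
    let: B := - (e' z).2 * gx 1 (Q z).1 + (e' z).1 * gy 1 (Q z).1 in
    (A * gx 1 (Q z).1 - B * gy 1 (Q z).1, A * gy 1 (Q z).1 + B * gx 1 (Q z).1)).
  apply: filterS PQ => z /billiard_chord[c' c'0 [[_ h] _]].
  have [A B] := incoming_frame1 htable (Q z).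
  by rewrite /e' h A B outgoingE.
have oq : outgoing gamma q =
   (let: A := e.1 * gx 1 q.1 + e.2 * gy 1 q.1 in
    let: B := - e.2 * gx 1 q.1 + e.1 * gy 1 q.1 in
    (A * gx 1 q.1 - B * gy 1 q.1, A * gy 1 q.1 + B * gx 1 q.1)).
  by have [A B] := incoming_frame1 htable q; rewrite /e g2 A B outgoingE.
have cgx : gx 1 (Q z).1 @[z --> U] --> gx 1 q.1 by exact: gx_cvg.
have cgy : gy 1 (Q z).1 @[z --> U] --> gy 1 q.1 by exact: gy_cvg.
have cA : (e' z).1 * gx 1 (Q z).1 + (e' z).2 * gy 1 (Q z).1 @[z --> U] -->
   e.1 * gx 1 q.1 + e.2 * gy 1 q.1.
  exact: cvgD (cvgM ce1 cgx) (cvgM ce2 cgy).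
have cB : - (e' z).2 * gx 1 (Q z).1 + (e' z).1 * gy 1 (Q z).1 @[z --> U] -->
   - e.2 * gx 1 q.1 + e.1 * gy 1 q.1.
  exact: cvgD (cvgM (cvgN ce2) cgx) (cvgM ce1 cgy).
rewrite oq; split; first exact: ct.
- apply: cvg_trans (cvgB (cvgM cA cgx) (cvgM cB cgy)).
  by apply: near_eq_cvg; apply: filterS oQ => z ->.
- apply: cvg_trans (cvgD (cvgM cA cgy) (cvgM cB cgx)).
  by apply: near_eq_cvg; apply: filterS oQ => z ->.
Qed.

End StepContinuity.

(** * The cone condition at three-period orbits *)

Section ThreePeriodCone.
Context {R : realType} (l : R) (gamma : R -> R * R) (D : set (R * R)).
Hypothesis htable : billiard_table l gamma D.
Hypothesis hC3 : curve_Cn 3 gamma.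

Lemma outgoing_cvg (T : Type) (U : set_system T) (FU : Filter U) (P : T -> R * R)
    (p : R * R) : (P z).1 @[z --> U] --> p.1 -> (P z).2 @[z --> U] --> p.2 ->
  (outgoing gamma (P z)).1 @[z --> U] --> (outgoing gamma p).1 /\
  (outgoing gamma (P z)).2 @[z --> U] --> (outgoing gamma p).2.
Proof.
move=> c1 c2; rewrite outgoingE.
have ccos : cos (P z).2 @[z --> U] --> cos p.2.
  by apply: cvg_comp c2 _; exact: continuous_cos.
have csin : sin (P z).2 @[z --> U] --> sin p.2.
  by apply: cvg_comp c2 _; exact: continuous_sin.
have cx : gx gamma 1 (P z).1 @[z --> U] --> gx gamma 1 p.1 by exact: gx_cvg.
have cy : gy gamma 1 (P z).1 @[z --> U] --> gy gamma 1 p.1 by exact: gy_cvg.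
split; under eq_fun do rewrite outgoingE.
  exact: (cvgB (cvgM ccos cx) (cvgM csin cy)).
exact: (cvgD (cvgM ccos cy) (cvgM csin cx)).
Qed.

Lemma three_period_window p q r : three_period gamma D p ->
  exists qr : (R * R) * (R * R),
    [/\ billiard_map gamma D p qr.1, billiard_map gamma D qr.1 qr.2,
        billiard_map gamma D qr.2 p, `|qr.1.1 - q| <= l / 2 & `|qr.2.1 - r| <= l / 2].
Proof.
move=> [q0 [r0 [m1 m2 m3]]].
have [k kq] := int_shift_window htable q0.1 q.
have [k' kr] := int_shift_window htable r0.1 r.
exists ((q0.1 + k%:~R * l, q0.2), (r0.1 + k'%:~R * l, r0.2)); split.
- exact: (billiard_map_shiftr htable k m1).
- exact: (billiard_map_shiftl htable k (billiard_map_shiftr htable k' m2)).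
- exact: (billiard_map_shiftl htable k' m3).
- exact: kq.
- exact: kr.
Qed.

(** By contradiction: the neighbourhoods of [p], restricted to the orbits outside a cone, refine to
    an ultrafilter, along which [orbit_dir_limit] yields a direction [w]. The form with coefficients
    [A] and [B] kills [w], whereas these orbits keep its values above [e] times the distance. *)
Lemma three_period_cone p : three_period gamma D p ->
  cone_at (three_period gamma D) p.
Proof.
move=> [q [r [pq qr rp]]].
have [c c0 [spq _]] := billiard_chord pq.
have [a a0 [sqr _]] := billiard_chord qr.
have [b b0 [srp _]] := billiard_chord rp.
have s1 : 0 < sin p.2 by case: pq => /sin_phase_gt0.
have s2 : 0 < sin q.2 by case: qr => /sin_phase_gt0.
have s3 : 0 < sin r.2 by case: rp => /sin_phase_gt0.
pose dir := orbit_dir gamma p q r c a b.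
have [A [B [AB0 ABdir]]] : exists A B : R, (A != 0) || (B != 0) /\
    forall w : R * R, (w.1 != 0) || (w.2 != 0) -> dir w -> A * w.1 + B * w.2 = 0.
  have [[w [w0 dw]]|nw] := pselect (exists w : R * R, (w.1 != 0) || (w.2 != 0) /\ dir w).
    exists (- w.2), w.1; split; first by rewrite oppr_eq0 orbC.
    move=> w' _ dw'.
    have := orbit_dir_collinear htable spq sqr srp c0 a0 b0 s1 s2 s3 dw dw'.
    by move=> <-; ring.
  (* Without any admissible direction the form is arbitrary: [p] is then isolated, as an
     accumulation of orbits would produce a direction. *)
  exists 1, 0; split; first by rewrite oner_eq0.
  by move=> w w0 dw; case: nw; exists w.
exists A, B; split=> // e e0; apply: contrapT => bad.
pose Bad : set (R * R) := [set z | three_period gamma D z /\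
  e * eucl_dist p z < `|A * (z.1 - p.1) + B * (z.2 - p.2)|].
have FW : Filter (within Bad (nbhs p)) by exact: within_filter.
have FF : ProperFilter (within Bad (nbhs p)).
  apply: Build_ProperFilter_ex FW.
  move=> V; rewrite /within/= => /nbhs_ballP[d /= d0 dV].
  apply: contrapT => V0; apply: bad; exists d => // z Pz pz.
  rewrite leNgt; apply/negP => Bz; apply: V0; exists z; apply: dV => //.
  by split; rewrite /ball/=; apply: le_lt_trans pz;
    [exact: ler_eucl_dist1|exact: ler_eucl_dist2].
have [U [UU FU]] := ultraFilterLemma FF.
have UF : ProperFilter U by exact: ultra_proper.
have UBad : U Bad by apply: FU; rewrite /within/=; exact: nearW.
have Up : id @ U --> p.
  by move=> V Vp; apply: FU; rewrite /within/=; apply: filterS Vp.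
have cp1 : z.1 @[z --> U] --> p.1 by exact: (cvg_pair1 _ Up).
have cp2 : z.2 @[z --> U] --> p.2 by exact: (cvg_pair2 _ Up).
have chQS z : exists QS : (R * R) * (R * R), three_period gamma D z ->
    [/\ billiard_map gamma D z QS.1, billiard_map gamma D QS.1 QS.2,
        billiard_map gamma D QS.2 z, `|QS.1.1 - q.1| <= l / 2 & `|QS.2.1 - r.1| <= l / 2].
  have [/(three_period_window q.1 r.1)[QS H]|nz] := pselect (three_period gamma D z).
    by exists QS.
  by exists (0, 0).
have [QS HQS] := choice chQS.
have nQS : \forall z \near U, [/\ billiard_map gamma D z (QS z).1,
    billiard_map gamma D (QS z).1 (QS z).2,
    billiard_map gamma D (QS z).2 z, `|(QS z).1.1 - q.1| <= l / 2 &
    `|(QS z).2.1 - r.1| <= l / 2].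
  by apply: filterS UBad => z [Pz _]; exact: HQS.
have [co1 co2] := outgoing_cvg _ cp1 cp2.
have [cQ cQ1 cQ2] := billiard_step_cvg htable hC3 UU pq
  (filterS (fun z h => let: And5 h _ _ _ _ := h in h) nQS) cp1 co1 co2
  (filterS (fun z h => let: And5 _ _ _ h _ := h in h) nQS).
have [cS _ _] := billiard_step_cvg htable hC3 UU qr
  (filterS (fun z h => let: And5 _ h _ _ _ := h in h) nQS) cQ cQ1 cQ2
  (filterS (fun z h => let: And5 _ _ _ _ h := h in h) nQS).
have step (X Y : R * R) : billiard_map gamma D X Y -> exists c', chord_step gamma X Y c'.
  by move=> /billiard_chord[c' _ [h _]]; exists c'.
have nPp : \forall z \near U, z != p.
  apply: filterS UBad => z [_]; apply: contraTneq => ->.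
  by rewrite !subrr !mulr0 addr0 normr0 eucl_distxx mulr0 ltxx.
have [sg [w [sg0 w0 dw cw1 cw2]]] := orbit_dir_limit htable hC3 spq sqr srp c0 a0 b0 s1 s2 s3 UU
  (filterS (fun z h => let: And5 h _ _ _ _ := h in step _ _ h) nQS)
  (filterS (fun z h => let: And5 _ h _ _ _ := h in step _ _ h) nQS)
  (filterS (fun z h => let: And5 _ _ h _ _ := h in step _ _ h) nQS)
  cp1 cp2 cQ cS
  nPp.
have Aw := ABdir w w0 dw.
have clim : `|A * ((z.1 - p.1) / sg z) + B * ((z.2 - p.2) / sg z)| @[z --> U] --> (0 : R).
  rewrite -(normr0 R) -Aw; apply: cvg_norm; apply: cvgD; apply: cvgM => //; exact: cvg_cst.
have bound (f : R * R -> R) (wi : R) : f z / sg z @[z --> U] --> wi ->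
    (forall z, `|f z| <= eucl_dist p z) -> wi = 0.
  move=> cf fd; apply/eqP; rewrite -normr_eq0 -(mulrI_eq0 _ (lregP (lt0r_neq0 e0))).
  rewrite eq_le mulr_ge0 ?(ltW e0)// andbT.
  have c1 : e * `|f z / sg z| - `|A * ((z.1 - p.1) / sg z) + B * ((z.2 - p.2) / sg z)|
      @[z --> U] --> e * `|wi| - 0.
    by apply: cvgB => //; apply: cvgM; [exact: cvg_cst|exact: cvg_norm].
  rewrite -subr_le0; rewrite subr0 in c1; rewrite subr0.
  apply: cvgr_to_le c1 _; apply: filterS2 sg0 UBad => z sz [_ hz].
  have -> : A * ((z.1 - p.1) / sg z) + B * ((z.2 - p.2) / sg z) =
    (A * (z.1 - p.1) + B * (z.2 - p.2)) / sg z by ring.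
  rewrite !normrM normfV (gtr0_norm sz) mulrA -mulrBl.
  rewrite pmulr_lle0 ?invr_gt0// subr_le0 (le_trans _ (ltW hz))//.
  by rewrite ler_wpM2l// ltW.
case/orP: w0 => /eqP; apply.
  by apply: bound cw1 _ => z; rewrite distrC ler_eucl_dist1.
by apply: bound cw2 _ => z; rewrite distrC ler_eucl_dist2.
Qed.

End ThreePeriodCone.

(** * Transport of cones by the embedding *)

Section StrictlyInStrip.
Context {R : realType}.
Implicit Types (f : R * R -> R) (p q : R * R).

Lemma partial1_is_derive f p : derivable f p (1, 0) ->
  is_derive p.1 1 (fun x : R => f (x, p.2)) ('D_((1 : R), (0 : R)) f p).
Proof.
move=> fd; apply: is_derive_cvg.
have E : (fun h : R => h^-1 *: (f (h *: 1 + p.1, p.2) - f (p.1, p.2))) =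
    (fun h => h^-1 *: ((f \o shift p) (h *: ((1 : R), (0 : R))) - f p)).
  apply/funext => h; rewrite /= -surjective_pairing; congr (_ *: (f _ - _)).
  by rewrite [RHS]surjective_pairing/= scaler0 add0r.
by rewrite E; exact: fd.
Qed.

Lemma partial2_is_derive f p : derivable f p (0, 1) ->
  is_derive p.2 1 (fun y : R => f (p.1, y)) ('D_((0 : R), (1 : R)) f p).
Proof.
move=> fd; apply: is_derive_cvg.
have E : (fun h : R => h^-1 *: (f (p.1, h *: 1 + p.2) - f (p.1, p.2))) =
    (fun h => h^-1 *: ((f \o shift p) (h *: ((0 : R), (1 : R))) - f p)).
  apply/funext => h; rewrite /= -surjective_pairing; congr (_ *: (f _ - _)).
  by rewrite [RHS]surjective_pairing/= scaler0 add0r.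
by rewrite E; exact: fd.
Qed.

(** The increment is taken along two sides of a rectangle, with the mean value theorem on each;
    continuity of the partial derivatives at [p] does the rest. *)
Lemma C1_differentiable f p : Cn_on 1 phase_strip f -> phase_strip p ->
  forall e, 0 < e -> exists2 d, 0 < d & forall q, eucl_dist p q < d ->
    `|f q - f p - ('D_((1 : R), (0 : R)) f p * (q.1 - p.1) +
                   'D_((0 : R), (1 : R)) f p * (q.2 - p.2))| <= e * eucl_dist p q.
Proof.
move=> [fd c1 c2] sp e e0.
set a := 'D_((1 : R), (0 : R)) f p; set b := 'D_((0 : R), (1 : R)) f p.
have e20 : 0 < e / 2 by rewrite divr_gt0.
have := c1 p sp; move=> /cvgrPdist_le/(_ _ e20)/nbhs_ballP[d1 /= d10 H1].
have := c2 p sp; move=> /cvgrPdist_le/(_ _ e20)/nbhs_ballP[d2 /= d20 H2].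
have /andP[p0 ppi] : 0 < p.2 < pi by [].
(* The last two bounds keep the rectangle inside the strip, where the partial derivatives exist. *)
exists (Num.min (Num.min d1 d2) (Num.min p.2 (pi - p.2))).
  by rewrite !lt_min d10 d20 p0 subr_gt0.
move=> q; rewrite !lt_min => /andP[/andP[q1 q2] /andP[q3 q4]].
have l1 := ler_eucl_dist1 p q; have l2 := ler_eucl_dist2 p q.
have close x y : `|x - p.1| <= `|q.1 - p.1| -> `|y - p.2| <= `|q.2 - p.2| ->
    [/\ phase_strip (x, y), `|'D_((1 : R), (0 : R)) f (x, y) - a| <= e / 2 &
        `|'D_((0 : R), (1 : R)) f (x, y) - b| <= e / 2].
  rewrite (distrC q.1) (distrC q.2) => x1 y1.
  have x2 := le_trans x1 l1; have y2 := le_trans y1 l2; split.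
  - have := le_lt_trans y2 q3; have := le_lt_trans y2 q4.
    rewrite !ltr_norml /phase_strip/= => /andP[_ +] /andP[+ _] => *.
    by apply/andP; split; lra.
  - rewrite distrC; apply: H1; split; rewrite /ball/= distrC.
      exact: le_lt_trans x2 q1.
    exact: le_lt_trans y2 q1.
  - rewrite distrC; apply: H2; split; rewrite /ball/= distrC.
      exact: le_lt_trans x2 q2.
    exact: le_lt_trans y2 q2.
have q2q : `|q.2 - p.2| <= `|q.2 - p.2| by [].
have p1q : `|p.1 - p.1| <= `|q.1 - p.1| by rewrite subrr normr0.
have [x [xq Ex]] := mean_value (x := p.1) (y := q.1) (f := fun x => f (x, q.2))
  (df := fun x => 'D_((1 : R), (0 : R)) f (x, q.2))
  (fun x xq => let: And3 s _ _ := close x q.2 xq q2q in partial1_is_derive (fd _ s).1).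
have [y [yq Ey]] := mean_value (x := p.2) (y := q.2) (f := fun y => f (p.1, y))
  (df := fun y => 'D_((0 : R), (1 : R)) f (p.1, y))
  (fun y yq => let: And3 s _ _ := close p.1 y p1q yq in partial2_is_derive (fd _ s).2).
have [_ ax _] := close x q.2 xq q2q; have [_ _ by'] := close p.1 y p1q yq.
rewrite -!surjective_pairing in Ex Ey.
have -> : f q - f p - (a * (q.1 - p.1) + b * (q.2 - p.2)) =
    ('D_((1 : R), (0 : R)) f (x, q.2) - a) * (q.1 - p.1) +
    ('D_((0 : R), (1 : R)) f (p.1, y) - b) * (q.2 - p.2).
  by rewrite !mulrBl -Ex -Ey; ring.
rewrite (le_trans (ler_normD _ _))// !normrM.
rewrite [e in leRHS](splitr e) mulrDl; apply: lerD; apply: ler_pM => //.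
  by rewrite distrC.
by rewrite distrC.
Qed.

End StrictlyInStrip.

Section ConeImage.
Context {R : realType}.
Variables (iota : R * R -> R * R) (p : R * R) (E : set (R * R)).
Variables (a1 b1 a2 b2 : R).
Hypothesis det0 : a1 * b2 - b1 * a2 != 0.
Hypothesis iota1 : forall e, 0 < e -> exists2 d, 0 < d & forall q, eucl_dist p q < d ->
  `|(iota q).1 - (iota p).1 - (a1 * (q.1 - p.1) + b1 * (q.2 - p.2))| <=
    e * eucl_dist p q.
Hypothesis iota2 : forall e, 0 < e -> exists2 d, 0 < d & forall q, eucl_dist p q < d ->
  `|(iota q).2 - (iota p).2 - (a2 * (q.1 - p.1) + b2 * (q.2 - p.2))| <=
    e * eucl_dist p q.
Hypothesis inverse : forall e, 0 < e -> exists2 d, 0 < d & forall q, E q ->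
  eucl_dist (iota p) (iota q) < d ->
  exists q', [/\ E q', iota q' = iota q & eucl_dist p q' < e].

(** The new form is the given one composed with the inverse of the Jacobian matrix. The hypothesis
    [inverse] allows another point [q'] with the same image, as a lifted embedding is injective only
    up to periods. *)
Lemma cone_at_image : cone_at E p -> cone_at (iota @` E) (iota p).
Proof.
move=> [A [B [AB0 cone]]].
pose det := a1 * b2 - b1 * a2.
have det_neq0 : det != 0 by exact: det0.
pose A' := (A * b2 - B * a2) / det; pose B' := (B * a1 - A * b1) / det.
have AE : A = A' * a1 + B' * a2 by rewrite /A' /B' /det; field.
have BE : B = A' * b1 + B' * b2 by rewrite /A' /B' /det; field.
clearbody A' B'; exists A', B'; split.
  apply: contraTT AB0; rewrite !negb_or !negbK => /andP[/eqP A0 /eqP B0].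
  by rewrite AE BE A0 B0 !mul0r addr0 eqxx.
move=> e e0.
pose M := `|a1| + `|b1| + `|a2| + `|b2|.
have nd : 0 < `|det| by rewrite normr_gt0.
have M0 : 0 < M.
  have [M0|//] := eqVneq M 0; last by rewrite lt_neqAle eq_sym !addr_ge0 ?normr_ge0// => ->.
  move: det_neq0; rewrite /det; have [h1 h2] : `|a1| = 0 /\ `|b1| = 0.
    move: M0; rewrite /M; have := normr_ge0 a1; have := normr_ge0 b1.
    have := normr_ge0 a2; have := normr_ge0 b2; lra.
  by rewrite (normr0_eq0 h1) (normr0_eq0 h2) !mul0r subrr eqxx.
(* [K] bounds the expansion of the inverse map: the factor 8 leads to [D <= (K * D' + D) / 4] for
   the distances before and after [iota], and the error [D / 4] is absorbed. *)
pose K := 8 * M / `|det|.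
have K0 : 0 < K by rewrite divr_gt0// mulr_gt0.
pose N := `|A'| + `|B'| + 1.
have N0 : 0 < N by rewrite ltr_wpDl// addr_ge0.
(* The first bound serves the comparison [D <= K * D']; the second makes the linearization errors,
   weighted by [N], cost at most half of [e]. *)
pose e2 := Num.min K^-1 (e / (2 * K * N)).
have e20 : 0 < e2 by rewrite lt_min invr_gt0 K0 (divr_gt0 e0 (mulr_gt0 (mulr_gt0 (ltr0Sn _ 1) K0) N0)).
have e10 : 0 < e / (2 * K) by rewrite divr_gt0// mulr_gt0.
have [d1 d10 H1] := cone _ e10.
have [d2 d20 H2] := iota1 e20; have [d3 d30 H3] := iota2 e20.
have [|d d0 Hd] := inverse (e := Num.min d1 (Num.min d2 d3)).
  by rewrite !lt_min d10 d20.
exists d => // _ [q0 Eq0 <-] /(Hd _ Eq0)[q [Eq <-]].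
rewrite !lt_min => /and3P[/(H1 _ Eq) h1 /H2 h2 /H3 h3].
set X := q.1 - p.1 in h1 h2 h3 *; set Y := q.2 - p.2 in h1 h2 h3 *.
set U := (iota q).1 - (iota p).1 in h2 *; set V := (iota q).2 - (iota p).2 in h3 *.
set r1 := U - _ in h2; set r2 := V - _ in h3.
set D := eucl_dist p q in h1 h2 h3; set D' := eucl_dist (iota p) (iota q).
have D0 : 0 <= D by exact: eucl_dist_ge0.
have UD : `|U| <= D' by rewrite distrC ler_eucl_dist1.
have VD : `|V| <= D' by rewrite distrC ler_eucl_dist2.
have DXY : D <= `|X| + `|Y| by rewrite /D eucl_distC eucl_dist_le_l1.
have e2D : e2 * D <= K^-1 * D by rewrite ler_wpM2r// ge_min lexx.
have XE : det * X = b2 * (U - r1) - b1 * (V - r2) by rewrite /r1 /r2 /det; ring.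
have YE : det * Y = a1 * (V - r2) - a2 * (U - r1) by rewrite /r1 /r2 /det; ring.
have bnd (z w s t S : R) : `|z| + `|w| <= M -> `|s| <= S -> `|t| <= S ->
    `|z * s - w * t| <= M * S.
  move=> zw sS tS; rewrite (le_trans (ler_normB _ _))// !normrM.
  have S0 := le_trans (normr_ge0 _) sS.
  rewrite (@le_trans _ _ (`|z| * S + `|w| * S))//; first by rewrite lerD// ler_wpM2l.
  by rewrite -mulrDl ler_wpM2r.
have Ur : `|U - r1| <= D' + K^-1 * D.
  by rewrite (le_trans (ler_normB _ _))// lerD// (le_trans h2).
have Vr : `|V - r2| <= D' + K^-1 * D.
  by rewrite (le_trans (ler_normB _ _))// lerD// (le_trans h3).
have Xb : `|det| * `|X| <= M * (D' + K^-1 * D).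
  rewrite -normrM XE; apply: bnd => //; rewrite /M.
  have := normr_ge0 a1; have := normr_ge0 a2; lra.
have Yb : `|det| * `|Y| <= M * (D' + K^-1 * D).
  rewrite -normrM YE; apply: bnd => //; rewrite /M.
  have := normr_ge0 b1; have := normr_ge0 b2; lra.
have ME : M = K * `|det| / 8 by rewrite /K; field; rewrite gt_eqF.
have DKD : D <= K * D'.
  have : `|det| * D <= 2 * (M * (D' + K^-1 * D)).
    by rewrite (le_trans (ler_wpM2l (ltW nd) DXY))// mulrDr; lra.
  have -> : 2 * (M * (D' + K^-1 * D)) = `|det| * ((K * D' + D) / 4).
    by rewrite ME; field; rewrite gt_eqF.
  rewrite ler_pM2l//.
  have : 0 <= K * D' by rewrite mulr_ge0 ?(ltW K0) ?eucl_dist_ge0.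
  lra.
have -> : A' * U + B' * V = (A * X + B * Y) + (A' * r1 + B' * r2).
  by rewrite /r1 /r2 AE BE; ring.
have rb : `|A' * r1 + B' * r2| <= N * (e2 * D).
  rewrite (le_trans (ler_normD _ _))// !normrM.
  have t0 : 0 <= e2 * D by rewrite mulr_ge0// ltW.
  apply: (le_trans (lerD (ler_wpM2l (normr_ge0 A') h2) (ler_wpM2l (normr_ge0 B') h3))).
  by rewrite -mulrDl ler_wpM2r// /N lerDl.
have rb' : N * (e2 * D) <= e / (2 * K) * D.
  have -> : e / (2 * K) * D = N * (e / (2 * K * N) * D) by field; rewrite !gt_eqF.
  by rewrite ler_wpM2l ?(ltW N0)// ler_wpM2r// ge_min lexx orbT.
rewrite (le_trans (ler_normD _ _))//.
have : e / (2 * K) * D <= e / 2 * D'.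
  have -> : e / 2 * D' = e / (2 * K) * (K * D') by field; rewrite gt_eqF.
  by rewrite ler_wpM2l// ltW.
have -> : e * D' = e / 2 * D' + e / 2 * D' by field.
lra.
Qed.

End ConeImage.

Section EmbeddedThreePeriod.
Context {R : realType} (l : R) (gamma : R -> R * R) (D : set (R * R)).
Hypothesis htable : billiard_table l gamma D.
Hypothesis hC3 : curve_Cn 3 gamma.
Variable iota : R * R -> R * R.
Hypothesis hiota : annulus_embedding l iota.

Lemma three_period_strip p : three_period gamma D p -> phase_strip p.
Proof. by move=> [q [r [[]]]]. Qed.

Lemma three_period_shift p p' : same_phase_point l p p' ->
  three_period gamma D p -> three_period gamma D p'.
Proof.
move=> [[k p1] p2] [q [r [m1 m2 m3]]]; exists q, r.
have -> : p' = (p.1 + k%:~R * l, p.2) by rewrite -p1 -p2 -surjective_pairing.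
split; [exact: (billiard_map_shiftl htable k m1)|exact: m2|].
exact: (billiard_map_shiftr htable k m3).
Qed.

Lemma embedded_three_period_cone p : three_period gamma D p ->
  cone_at (iota @` three_period gamma D) (iota p).
Proof.
move=> Pp; have sp := three_period_strip Pp.
have [s1 s2] := embedding_smooth hiota 1.
apply: (cone_at_image (embedding_immersion hiota sp)
  (C1_differentiable s1 sp) (C1_differentiable s2 sp)).
- move=> e e0; have [d d0 Hd] := embedding_inverse hiota sp e0.
  exists d => // q Pq /(Hd _ (three_period_strip Pq))[q' qq' pq'].
  have Pq' := three_period_shift qq' Pq.
  exists q'; split=> //; apply/esym.
  exact/(embedding_injective hiota (three_period_strip Pq) (three_period_strip Pq')).
- exact: (three_period_cone htable hC3).
Qed.

End EmbeddedThreePeriod.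

(** * Decomposition into countably many compact sets *)

Section BoundaryCrossing.
Context {R : realType} (l : R) (gamma : R -> R * R) (D : set (R * R)).
Hypothesis htable : billiard_table l gamma D.
Hypothesis hC3 : curve_Cn 3 gamma.
Local Notation gx := (gx gamma).
Local Notation gy := (gy gamma).

(** Without a boundary point on the segment, being in [D] and being in its closure would be the same
    along it, so a nonempty subset of the unit interval would be open and closed in it. *)
Lemma segment_meets_boundary (x w : R * R) : D x -> ~ D w ->
  exists u t : R, 0 <= u <= 1 /\ gamma t = x + u *: (w - x).
Proof.
move=> Dx Dw; apply: contrapT => nocross.
pose f (u : R) : R * R := x + u *: (w - x).
have cf : continuous f.
  move=> u; apply: cvgD; first exact: cvg_cst.
  by apply: cvgZr_tmp; exact: cvg_id.
pose A : set R := `[0, 1]%classic `&` f @^-1` D.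
have AE : A = `[0, 1]%classic `&` f @^-1` closure D.
  apply/seteqP; split => u [u01 Du]; split=> //; first exact: subset_closure.
  apply: contrapT => nD; apply: nocross.
  have : (closure D `\` interior D) (f u) by split=> // /interior_subset.
  rewrite (table_boundary htable) => -[t _ tE]; exists u, t; split=> //.
have A01 : A = `[0, 1]%classic.
  apply: (@segment_connected R 0 1).
  - exists 0; split; first by rewrite /= in_itv/= lexx ler01.
    by rewrite /preimage/= /f scale0r addr0.
  - exists (f @^-1` D) => //.
    by move/continuousP : cf; apply; exact: table_open htable.
  - exists (f @^-1` closure D); last by [].
    by move/continuous_closedP : cf; apply; exact: closed_closure.
have : A 1 by rewrite A01 /= in_itv/= lexx ler01.
by move=> [_]; rewrite /preimage/= /f scale1r subrKC.
Qed.

(* The points of a segment issued transversally from the boundary are at a distance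
   from the complement of D which is at least proportional to the distance to
   the end of the segment. *)
Lemma transversal_end (T : Type) (U : set_system T) (UU : UltraFilter U)
    (s eps : T -> R) (w : T -> R * R) (e : R * R) (t : R) :
  s @ U --> (0 : R) -> eps @ U --> (0 : R) -> (e.1 != 0) || (e.2 != 0) ->
  (\forall z \near U, [/\ 0 < s z, D (gamma t + s z *: e), ~ D (w z) &
     eucl_dist (gamma t + s z *: e) (w z) <= s z * eps z]) ->
  - e.2 * gx 1 t + e.1 * gy 1 t = 0.
Proof.
move=> cs ceps e0 H.
have FU : ProperFilter U by exact: ultra_proper.
(* The segment from the point of [D] to [w z] contains a boundary point [gamma t'], whose secant
   from [gamma t], divided by [s z], tends to [e]. Then [chord_not_collapsing], applied to these
   secants, shows that [e] is tangent. *)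
have ch z : exists t' : R, `|t' - t| <= l / 2 /\
    (D (gamma t + s z *: e) -> ~ D (w z) ->
     `|gx 0 t' - (gx 0 t + s z * e.1)| <= eucl_dist (gamma t + s z *: e) (w z) /\
     `|gy 0 t' - (gy 0 t + s z * e.2)| <= eucl_dist (gamma t + s z *: e) (w z)).
  have [[Dx Dw]|nD] := pselect (D (gamma t + s z *: e) /\ ~ D (w z)); last first.
    exists t; rewrite subrr normr0 divr_ge0 ?(ltW (table_length htable))//.
    by split=> // Dx Dw; case: nD.
  have [u [t' [/andP[u0 u1] tE]]] := segment_meets_boundary Dx Dw.
  have [k kt] := int_shift_window htable t' t.
  exists (t' + k%:~R * l); split=> // _ _.
  rewrite !gx0E !gy0E (gamma_shift htable) tE/= -![_ *: e.1]/(_ * _) -![_ *: e.2]/(_ * _).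
  rewrite !(addrC (_ + s z * _)) !addrK.
  have le (a b c : R) : `|b - a| <= c -> `|u *: (a - b)| <= c.
    move=> h; rewrite /GRing.scale/= normrM (ger0_norm u0) distrC.
    by rewrite (le_trans _ h)// ler_piMl.
  split; apply: le.
    exact: (ler_eucl_dist1 (gamma t + s z *: e) (w z)).
  exact: (ler_eucl_dist2 (gamma t + s z *: e) (w z)).
have [t' Ht'] := choice ch.
have nt' : \forall z \near U, [/\ 0 < s z,
    `|(gx 0 (t' z) - gx 0 t) / s z - e.1| <= eps z &
    `|(gy 0 (t' z) - gy 0 t) / s z - e.2| <= eps z].
  apply: filterS H => z [sz Dx Dw le].
  have [h1 h2] := (Ht' z).2 Dx Dw; have nz : s z != 0 by rewrite gt_eqF.
  split=> //.
    have -> : (gx 0 (t' z) - gx 0 t) / s z - e.1 =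
      (gx 0 (t' z) - (gx 0 t + s z * e.1)) / s z by field.
    by rewrite normrM normfV (gtr0_norm sz) ler_pdivrMr// [eps z * _]mulrC (le_trans h1).
  have -> : (gy 0 (t' z) - gy 0 t) / s z - e.2 =
    (gy 0 (t' z) - (gy 0 t + s z * e.2)) / s z by field.
  by rewrite normrM normfV (gtr0_norm sz) ler_pdivrMr// [eps z * _]mulrC (le_trans h2).
have squeeze (f : T -> R) (x : R) : (\forall z \near U, `|f z - x| <= eps z) -> f @ U --> x.
  move=> fx; apply/cvgrPdist_lt => d d0.
  have := ceps; move=> /cvgrPdist_lt/(_ _ d0); apply: filterS2 fx => z fx.
  rewrite sub0r normrN distrC => /(le_lt_trans (ler_norm _)); exact: le_lt_trans.
have cE1 : (gx 0 (t' z) - gx 0 t) / s z @[z --> U] --> e.1.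
  by apply: squeeze; apply: filterS nt' => z [].
have cE2 : (gy 0 (t' z) - gy 0 t) / s z @[z --> U] --> e.2.
  by apply: squeeze; apply: filterS nt' => z [].
have [t1 ct1] : exists t1 : R, t' @ U --> t1.
  apply: (@ultra_bounded_cvg R T U t' (`|t| + l / 2) UU); apply: nearW => z.
  rewrite -[X in `|X|](subrKC t) (le_trans (ler_normD _ _))// lerD2l.
  exact: (Ht' z).1.
have coord (g : R -> R) (a : R) : (forall z : R, {for z, continuous g}) ->
    (g (t' z) - g t) / s z @[z --> U] --> a -> g t1 = g t.
  move=> cg ca.
  have c0 : (g (t' z) - g t) / s z * s z @[z --> U] --> a * 0 by exact: cvgM.
  have c1 : g (t' z) - g t @[z --> U] --> g t1 - g t.
    by apply: cvgB; [exact: (cvg_comp _ _ ct1 (cg t1))|exact: cvg_cst].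
  have : g t1 - g t = a * 0.
    apply: (cvg_unique _ c1) => //; apply: cvg_trans c0; apply: near_eq_cvg.
    by apply: filterS H => z [sz _ _ _]; rewrite divfK// gt_eqF.
  by rewrite mulr0 => /eqP; rewrite subr_eq0 => /eqP.
have x1 : gx 0 t1 = gx 0 t by apply: (coord _ _ _ cE1) => z; apply: gx_continuous.
have y1 : gy 0 t1 = gy 0 t by apply: (coord _ _ _ cE2) => z; apply: gy_continuous.
have t1E : t1 = t.
  apply: (gamma_window_inj htable).
    have cn : `|t' z - t| @[z --> U] --> `|t1 - t|.
      by apply: cvg_norm; apply: cvgB => //; exact: cvg_cst.
    by apply: cvgr_to_le cn _; apply: nearW => z; exact: (Ht' z).1.
  rewrite [LHS]surjective_pairing [RHS]surjective_pairing.
  by rewrite -!gx0E -!gy0E x1 y1.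
rewrite t1E in ct1.
apply: (@chord_not_collapsing _ _ hC3 _ U FU _ _ (cst t) t' e t cE1 cE2 _ ct1).
- exact: cvg_cst.
- have nz (f : T -> R) (a : R) : a != 0 -> f @ U --> a -> \forall z \near U, f z != 0.
    move=> a0 fa; have aa : 0 < `|a| by rewrite normr_gt0.
    have := fa; move=> /cvgrPdist_lt/(_ _ aa); apply: filterS => z.
    by apply: contraTneq => ->; rewrite subr0 ltxx.
  case/orP: e0 => [e0|e0].
    apply: filterS (nz _ _ e0 cE1) => z; apply: contra => /eqP <-.
    by rewrite subrr mul0r.
  apply: filterS (nz _ _ e0 cE2) => z; apply: contra => /eqP <-.
  by rewrite subrr mul0r.
- by apply: nearW => z; rewrite /cross_chord/=; ring.
Qed.

End BoundaryCrossing.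

Lemma eucl_dist_cvg (R : realType) (T : Type) (U : set_system T) {FU : Filter U}
    (f : T -> R * R) (p w : R * R) :
  (f z).1 @[z --> U] --> p.1 -> (f z).2 @[z --> U] --> p.2 ->
  eucl_dist (f z) w @[z --> U] --> eucl_dist p w.
Proof.
move=> c1 c2; rewrite /eucl_dist.
have c0 : ((f z).1 - w.1) ^+ 2 + ((f z).2 - w.2) ^+ 2 @[z --> U] -->
    (p.1 - w.1) ^+ 2 + (p.2 - w.2) ^+ 2.
  have d1 : (f z).1 - w.1 @[z --> U] --> p.1 - w.1 by apply: cvgB => //; exact: cvg_cst.
  have d2 : (f z).2 - w.2 @[z --> U] --> p.2 - w.2 by apply: cvgB => //; exact: cvg_cst.
  exact: (cvgD (cvgM d1 d1) (cvgM d2 d2)).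
exact: (cvg_comp _ _ c0 (@sqrt_continuous R _)).
Qed.

Section QuantitativeSteps.
Context {R : realType} (l : R) (gamma : R -> R * R) (D : set (R * R)).
Hypothesis htable : billiard_table l gamma D.
Hypothesis hC3 : curve_Cn 3 gamma.
Local Notation gx := (gx gamma).
Local Notation gy := (gy gamma).
Implicit Types (p q r : R * R) (d : R).

(** The factor [s * (1 - s)] vanishes at the ends, where the trajectory touches the boundary. If no
    [d] works, the parameters of the violations have a limit as [d] tends to 0: at an end,
    [transversal_end] contradicts transversality (with the direction reversed at [q]), elsewhere the
    openness of [D] is contradicted. *)
Lemma billiard_clearance p q (c : R) : phase_strip p -> phase_strip q -> 0 < c ->
  (forall s, 0 < s < c -> D (gamma p.1 + s *: outgoing gamma p)) ->
  gamma q.1 = gamma p.1 + c *: outgoing gamma p ->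
  outgoing gamma p = incoming gamma q ->
  exists2 d, 0 < d & forall s w, 0 <= s <= 1 -> ~ D w ->
    d * (s * (1 - s)) <= eucl_dist (gamma p.1 + (s * c) *: outgoing gamma p) w.
Proof.
move=> sp sq c0 Dpq g1 g2; apply: contrapT => bad.
set e := outgoing gamma p in Dpq g1 g2 bad.
have e_unit : e.1 ^+ 2 + e.2 ^+ 2 = 1 by exact: outgoing_unit htable p.
have e0 : (e.1 != 0) || (e.2 != 0).
  rewrite -negb_and; apply/negP => /andP[/eqP h1 /eqP h2].
  by move: e_unit; rewrite h1 h2 expr0n/= addr0 => /esym/eqP; rewrite oner_eq0.
have ch (d : R) : exists sw : R * (R * R), 0 < d ->
    [/\ 0 <= sw.1 <= 1, ~ D sw.2 &
     eucl_dist (gamma p.1 + (sw.1 * c) *: e) sw.2 < d * (sw.1 * (1 - sw.1))].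
  have [d0|nd] := pselect (0 < d); last by exists (0, 0).
  apply: contrapT => H; apply: bad; exists d => // s w s01 Dw.
  by rewrite leNgt; apply/negP => lt; apply: H; exists (s, w) => _; split.
have [sw Hsw] := choice ch; pose s d := (sw d).1; pose w d := (sw d).2.
have {}Hsw d : 0 < d -> [/\ 0 < s d, s d < 1, ~ D (w d) &
    eucl_dist (gamma p.1 + (s d * c) *: e) (w d) < d * (s d * (1 - s d))].
  move=> d0; have [/andP[s0 s1] Dw lt] := Hsw d d0.
  have ss : 0 < s d * (1 - s d).
    by rewrite -(pmulr_rgt0 _ d0) (le_lt_trans _ lt)// eucl_dist_ge0.
  rewrite /s in ss *; split=> //.
    by rewrite lt_neqAle s0 andbT; apply: contraTneq ss => <-; rewrite mul0r ltxx.
  rewrite lt_neqAle s1 andbT; apply: contraTneq ss => ->.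
  by rewrite subrr mulr0 ltxx.
have [U [UU FU]] := ultraFilterLemma (at_right_proper_filter (0 : R)).
have UF : ProperFilter U by exact: ultra_proper.
have U0 : \forall d \near U, 0 < d by apply: FU; exact: nbhs_right_gt.
have cU : id @ U --> (0 : R).
  by move=> V V0; apply: FU; exact: (@cvg_within _ (nbhs (0:R)) _ _ V V0).
have [t ct] : exists t : R, s @ U --> t.
  apply: (@ultra_bounded_cvg R R U s 1 UU); apply: filterS U0 => d /Hsw[s0 s1 _ _].
  by rewrite ger0_norm ltW.
have t0 : 0 <= t by apply: cvgr_to_ge ct _; apply: filterS U0 => d /Hsw[/ltW].
have t1 : t <= 1 by apply: cvgr_to_le ct _; apply: filterS U0 => d /Hsw[_ /ltW].
have ceps : d / c @[d --> U] --> (0 : R).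
  by rewrite -(mul0r c^-1); apply: cvgM => //; exact: cvg_cst.
have Dseg d : 0 < d -> D (gamma p.1 + (s d * c) *: e).
  by move=> /Hsw[s0 s1 _ _]; apply: Dpq; rewrite mulr_gt0//= gtr_pMl.
move: t0; rewrite le_eqVlt => /orP[/eqP t0|t0].
  have csc : s d * c @[d --> U] --> (0 : R).
    by rewrite -(mul0r c) t0; apply: cvgM => //; exact: cvg_cst.
  have : - e.2 * gx 1 p.1 + e.1 * gy 1 p.1 = 0.
    apply: (transversal_end htable hC3 UU csc ceps e0 (w := w)).
    apply: filterS U0 => d d0; have [s0 s1 Dw lt] := Hsw d d0.
    split; [by rewrite mulr_gt0|exact: Dseg|exact: Dw|].
    have -> : s d * c * (d / c) = d * s d by field; rewrite gt_eqF.
    by rewrite (le_trans (ltW lt))// ler_pM2l// ler_piMr ?(ltW s0)// gerBl ltW.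
  have [_ ->] := outgoing_frame1 htable p => /eqP.
  by rewrite oppr_eq0 gt_eqF// sin_phase_gt0.
move: t1; rewrite le_eqVlt => /orP[/eqP t1|t1].
  have csc : (1 - s d) * c @[d --> U] --> (0 : R).
    rewrite -(mul0r c) -(subrr 1) -[X in _ - X]t1; apply: cvgM; last exact: cvg_cst.
    by apply: cvgB => //; exact: cvg_cst.
  have e0' : ((- e).1 != 0) || ((- e).2 != 0) by rewrite /= !oppr_eq0.
  have E d : gamma q.1 + ((1 - s d) * c) *: (- e) = gamma p.1 + (s d * c) *: e.
    by rewrite g1 scalerN -addrA -scalerBl; congr (_ + _ *: _); ring.
  have : - (- e).2 * gx 1 q.1 + (- e).1 * gy 1 q.1 = 0.
    apply: (transversal_end htable hC3 UU csc ceps e0' (w := w)).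
    apply: filterS U0 => d d0; have [s0 s1 Dw lt] := Hsw d d0; rewrite E.
    split; [by rewrite mulr_gt0// subr_gt0|exact: Dseg|exact: Dw|].
    have -> : (1 - s d) * c * (d / c) = d * (1 - s d) by field; rewrite gt_eqF.
    by rewrite (le_trans (ltW lt))// ler_pM2l// ler_piMl ?subr_ge0 ?(ltW s1).
  have [_ E2] := incoming_frame1 htable q; rewrite -g2 in E2.
  have -> : - (- e).2 * gx 1 q.1 + (- e).1 * gy 1 q.1 = - sin q.2.
    by rewrite -E2 /=; ring.
  by move/eqP; rewrite oppr_eq0 gt_eqF// sin_phase_gt0.
have Dt : D (gamma p.1 + (t * c) *: e).
  by apply: Dpq; rewrite mulr_gt0//= gtr_pMl.
have /nbhs_ballP[r /= r0 Dr] : nbhs (gamma p.1 + (t * c) *: e) D.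
  by move: (table_open htable); rewrite openE; apply.
have r20 : 0 < r / 2 by rewrite divr_gt0.
have := ct; move=> /cvgrPdist_lt/(_ (r / 2 / c)); rewrite divr_gt0// => /(_ isT) n1.
have := cU; move=> /cvgrPdist_lt/(_ _ r20) n2.
have [d [[d0 dt] dd]] := filter_ex (filterI (filterI U0 n1) n2).
have [s0 s1 Dw lt] := Hsw d d0; apply: Dw; apply: Dr.
rewrite sub0r normrN gtr0_norm// in dd.
have h1 : eucl_dist (gamma p.1 + (s d * c) *: e) (w d) < r / 2.
  rewrite (lt_trans lt)// (le_lt_trans _ dd)// ler_piMr ?(ltW d0)//.
  by rewrite mulr_ile1// ?subr_ge0 ?(ltW s0) ?(ltW s1)// gerBl ltW.
have h2 (a : R) : `|a| <= 1 -> `|(t * c) * a - (s d * c) * a| < r / 2.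
  move=> a1; rewrite -!mulrBl !normrM (gtr0_norm c0) (le_lt_trans _ (_ : `|t - s d| * c < _))//.
    by rewrite ler_piMr// mulr_ge0// ltW.
  by rewrite -ltr_pdivlMr.
have unit_le (a b : R) : a ^+ 2 + b ^+ 2 = 1 -> `|a| <= 1.
  by move=> ab; rewrite -(@expr_le1 _ 2)// real_normK ?num_real// -ab lerDl sqr_ge0.
have l1 := h2 _ (unit_le _ _ e_unit).
have l2 := h2 e.2 (unit_le _ e.1 (etrans (addrC _ _) e_unit)).
have := le_lt_trans (ler_eucl_dist1 _ _) h1; have := le_lt_trans (ler_eucl_dist2 _ _) h1.
rewrite /= -![_ *: e.1]/(_ * _) -![_ *: e.2]/(_ * _) => l3 l4.
split; rewrite /ball/= [r]splitr.
  apply: le_lt_trans (ler_distD ((gamma p.1).1 + (s d * c) * e.1) _ _) _.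
  by rewrite ltrD// opprD addrACA subrr add0r.
apply: le_lt_trans (ler_distD ((gamma p.1).2 + (s d * c) * e.2) _ _) _.
by rewrite ltrD// opprD addrACA subrr add0r.
Qed.

(** Equations and non-strict inequalities survive limits; the clearance stands for the condition of
    lying in the open set [D], which does not. *)
Definition uniform_step (d : R) p q : Prop :=
  [/\ d <= p.2 <= pi - d, d <= q.2 <= pi - d &
    exists c, [/\ d <= c <= d^-1, gamma q.1 = gamma p.1 + c *: outgoing gamma p,
      outgoing gamma p = incoming gamma q &
      forall s w, 0 <= s <= 1 -> ~ D w ->
        d * (s * (1 - s)) <= eucl_dist (gamma p.1 + (s * c) *: outgoing gamma p) w]].

Lemma uniform_step_billiard_map d p q : 0 < d -> uniform_step d p q ->
  billiard_map gamma D p q.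
Proof.
move=> d0 [/andP[p1 p2] /andP[q1 q2] [c [/andP[c1 _] g1 g2 clear]]].
have lt : pi - d < pi by rewrite gtrBl.
split; [|by rewrite /phase_strip/= (lt_le_trans d0 q1) (le_lt_trans q2 lt)|].
  by rewrite /phase_strip/= (lt_le_trans d0 p1) (le_lt_trans p2 lt).
have c0 : 0 < c by exact: lt_le_trans c1.
exists c => //; split; [|exact: g1|exact: g2] => s /andP[s0 sc].
(* A point outside [D] would be at distance zero from itself, against the clearance. *)
apply: contrapT => /(clear (s / c)); rewrite divfK ?gt_eqF// eucl_distxx.
have sc0 : 0 < s / c by rewrite divr_gt0.
have sc1 : s / c < 1 by rewrite ltr_pdivrMr ?mul1r.
rewrite (ltW sc0) (ltW sc1) => /(_ isT); apply/negP.
by rewrite -ltNge mulr_gt0// mulr_gt0// subr_gt0.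
Qed.

Lemma le_uniform_step d d' p q : 0 < d' -> d' <= d -> uniform_step d p q ->
  uniform_step d' p q.
Proof.
move=> d0 dd [/andP[p1 p2] /andP[q1 q2] [c [/andP[c1 c2] g1 g2 clear]]].
have le : pi - d <= pi - d' by rewrite lerB.
split; [by rewrite (le_trans dd p1) (le_trans p2)|by rewrite (le_trans dd q1) (le_trans q2)|].
exists c; split; [|exact: g1|exact: g2|].
  by rewrite (le_trans dd c1) (le_trans c2)// lef_pV2// posrE (lt_le_trans d0).
move=> s w s01 Dw; apply: le_trans (clear s w s01 Dw).
by case/andP: s01 => s0 s1; rewrite ler_wpM2r// mulr_ge0// subr_ge0.
Qed.

Lemma billiard_map_uniform_step p q : billiard_map gamma D p q ->
  exists2 d, 0 < d & uniform_step d p q.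
Proof.
move=> [sp sq [c c0 [Dpq g1 g2]]].
have [e e0 clear] := billiard_clearance sp sq c0 Dpq g1 g2.
move: (sp) (sq); rewrite /phase_strip/= => /andP[p0 p1] /andP[q0 q1].
exists (\big[Num.min/e]_(x <- [:: p.2; pi - p.2; q.2; pi - q.2; c; c^-1]) x).
  by rewrite !big_cons big_nil !lt_min p0 q0 !subr_gt0 p1 q1 c0 invr_gt0 c0.
set d := \big[_/_]_(_ <- _) _.
have d0 : 0 < d.
  by rewrite /d !big_cons big_nil !lt_min p0 q0 !subr_gt0 p1 q1 c0 invr_gt0 c0.
have := lexx d; rewrite {2}/d !big_cons big_nil !le_min.
move=> /and5P[h1 h2 h3 h4 /and3P[h5 h6 h7]].
have pi_le (x : R) : d <= pi - x -> x <= pi - d by lra.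
split; [by rewrite h1 pi_le|by rewrite h3 pi_le|].
exists c; split; [|exact: g1|exact: g2|].
  by rewrite h5 -[c]invrK lef_pV2 ?posrE ?invr_gt0.
move=> s w s01 Dw; apply: le_trans (clear s w s01 Dw).
by case/andP: s01 => s0 s1; rewrite ler_wpM2r// mulr_ge0// subr_ge0.
Qed.

Lemma uniform_step_shift (j k : int) d p q : uniform_step d p q ->
  uniform_step d (p.1 + j%:~R * l, p.2) (q.1 + k%:~R * l, q.2).
Proof.
move=> [h1 h2 [c [h3 g1 g2 clear]]]; split; [exact: h1|exact: h2|exists c].
by rewrite (outgoing_shift htable) (incoming_shift htable) !(gamma_shift htable); split.
Qed.

Lemma incoming_outgoing p : incoming gamma p = outgoing gamma (p.1, - p.2).
Proof. by rewrite /incoming /outgoing/= cosN sinN scaleNr. Qed.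

Lemma uniform_step_cvg (T : Type) (U : set_system T) (UU : UltraFilter U)
    (P Q : T -> R * R) d p q : 0 < d ->
  (\forall z \near U, uniform_step d (P z) (Q z)) ->
  (P z).1 @[z --> U] --> p.1 -> (P z).2 @[z --> U] --> p.2 ->
  (Q z).1 @[z --> U] --> q.1 -> (Q z).2 @[z --> U] --> q.2 ->
  uniform_step d p q.
Proof.
move=> d0 PQ cP1 cP2 cQ1 cQ2.
have UF : ProperFilter U by exact: ultra_proper.
have [co1 co2] := outgoing_cvg hC3 _ cP1 cP2.
have [ci1 ci2] : (incoming gamma (Q z)).1 @[z --> U] --> (incoming gamma q).1 /\
    (incoming gamma (Q z)).2 @[z --> U] --> (incoming gamma q).2.
  rewrite incoming_outgoing.
  have := @outgoing_cvg _ _ hC3 T U _ (fun z => ((Q z).1, - (Q z).2)) (q.1, - q.2)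
    cQ1 (cvgN cQ2).
  by move=> [h1 h2]; split; under eq_fun do rewrite incoming_outgoing.
have ch z : exists c, uniform_step d (P z) (Q z) ->
    [/\ d <= c <= d^-1, gamma (Q z).1 = gamma (P z).1 + c *: outgoing gamma (P z) &
      forall s w, 0 <= s <= 1 -> ~ D w ->
        d * (s * (1 - s)) <= eucl_dist (gamma (P z).1 + (s * c) *: outgoing gamma (P z)) w].
  have [[_ _ [c [h1 h2 _ h3]]]|n] := pselect (uniform_step d (P z) (Q z)); last by exists 0.
  by exists c.
have [c Hc] := choice ch.
have {}Hc : \forall z \near U, [/\ d <= c z <= d^-1,
      gamma (Q z).1 = gamma (P z).1 + c z *: outgoing gamma (P z) &
      forall s w, 0 <= s <= 1 -> ~ D w ->
        d * (s * (1 - s)) <= eucl_dist (gamma (P z).1 + (s * c z) *: outgoing gamma (P z)) w].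
  by apply: filterS PQ => z; exact: Hc.
have cle : \forall z \near U, d <= c z <= d^-1 by apply: filterS Hc => z [].
have [c0 cc] : exists c0 : R, c @ U --> c0.
  apply: (@ultra_bounded_cvg R T U c d^-1 UU); apply: filterS cle => z /andP[h1 h2].
  by rewrite ger0_norm// (le_trans (ltW d0)).
have eq_lim (f g : T -> R) (a b : R) : (\forall z \near U, f z = g z) ->
    f @ U --> a -> g @ U --> b -> a = b.
  move=> fg fa gb; apply: (cvg_unique _ fa) => //.
  by apply: cvg_trans gb; apply: near_eq_cvg; apply: filterS fg => z ->.
have point (s : R) : (gamma (P z).1 + (s * c z) *: outgoing gamma (P z)).1 @[z --> U] -->
      (gamma p.1 + (s * c0) *: outgoing gamma p).1 /\
    (gamma (P z).1 + (s * c z) *: outgoing gamma (P z)).2 @[z --> U] -->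
      (gamma p.1 + (s * c0) *: outgoing gamma p).2.
  have csc : s * c z @[z --> U] --> s * c0 by apply: cvgM => //; exact: cvg_cst.
  have cx : (gamma (P z).1).1 @[z --> U] --> (gamma p.1).1.
    by rewrite -gx0E; under eq_fun do rewrite -gx0E; exact: gx_cvg.
  have cy : (gamma (P z).1).2 @[z --> U] --> (gamma p.1).2.
    by rewrite -gy0E; under eq_fun do rewrite -gy0E; exact: gy_cvg.
  split; [exact: (cvgD cx (cvgM csc co1))|exact: (cvgD cy (cvgM csc co2))].
have angle (f : T -> R) (a : R) : (\forall z \near U, d <= f z <= pi - d) ->
    f @ U --> a -> d <= a <= pi - d.
  move=> fd fa; apply/andP; split.
    by apply: cvgr_to_ge fa _; apply: filterS fd => z /andP[].
  by apply: cvgr_to_le fa _; apply: filterS fd => z /andP[].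
split.
- by apply: angle cP2; apply: filterS PQ => z [].
- by apply: angle cQ2; apply: filterS PQ => z [].
exists c0; split.
- apply/andP; split.
    by apply: cvgr_to_ge cc _; apply: filterS cle => z /andP[].
  by apply: cvgr_to_le cc _; apply: filterS cle => z /andP[].
- have [h1 h2] := point 1; rewrite mul1r in h1 h2.
  rewrite [LHS]surjective_pairing [RHS]surjective_pairing; congr (_, _).
    have cx : gx 0 (Q z).1 @[z --> U] --> gx 0 q.1 by exact: gx_cvg.
    rewrite -gx0E; apply: eq_lim cx h1.
    by apply: filterS Hc => z [_ h _]; rewrite gx0E h mul1r.
  have cy : gy 0 (Q z).1 @[z --> U] --> gy 0 q.1 by exact: gy_cvg.
  rewrite -gy0E; apply: eq_lim cy h2.
  by apply: filterS Hc => z [_ h _]; rewrite gy0E h mul1r.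
- have io : \forall z \near U, outgoing gamma (P z) = incoming gamma (Q z).
    by apply: filterS PQ => z [_ _ [? [_ _ h _]]]; exact: h.
  rewrite [LHS]surjective_pairing [RHS]surjective_pairing; congr (_, _).
    by apply: eq_lim co1 ci1; apply: filterS io => z ->.
  by apply: eq_lim co2 ci2; apply: filterS io => z ->.
- move=> s w s01 Dw; have [h1 h2] := point s.
  apply: cvgr_to_ge (@eucl_dist_cvg _ _ _ _ _ _ w h1 h2) _.
  by apply: filterS Hc => z [_ _ h]; exact: h.
Qed.

Definition uniform_three_period d : set (R * R) :=
  [set p | `|p.1| <= l / 2 /\ exists q r, [/\ `|q.1| <= l / 2, `|r.1| <= l / 2,
    uniform_step d p q, uniform_step d q r & uniform_step d r p]].

Variable iota : R * R -> R * R.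
Hypothesis hiota : annulus_embedding l iota.

(** Compactness is proved on the image directly: along an ultrafilter the six coordinates of an
    orbit converge, and as the angles stay between [d] and [pi - d] the limit is in the open strip,
    where [iota] is continuous. *)
Lemma closed_uniform_three_period d : 0 < d -> closed (iota @` uniform_three_period d).
Proof.
move=> d0; apply: compact_closed; first exact: norm_hausdorff.
rewrite compact_ultra => U UU UE.
have UF : ProperFilter U by exact: ultra_proper.
have ch y : exists x : (R * R) * (R * R) * (R * R), (iota @` uniform_three_period d) y ->
    let: (p, q, r) := x in [/\ iota p = y, [/\ `|p.1| <= l / 2, `|q.1| <= l / 2 & `|r.1| <= l / 2],
    uniform_step d p q, uniform_step d q r & uniform_step d r p].
  have [[p [pl [q [r [ql rl pq qr rp]]]] py]|n] := pselect ((iota @` uniform_three_period d) y).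
    by exists (p, q, r) => _; split.
  by exists (0, 0, 0).
have [x Hx] := choice ch.
pose P y := (x y).1.1; pose Q y := (x y).1.2; pose S y := (x y).2.
have {}Hx : \forall y \near U, [/\ iota (P y) = y,
    [/\ `|(P y).1| <= l / 2, `|(Q y).1| <= l / 2 & `|(S y).1| <= l / 2],
    uniform_step d (P y) (Q y), uniform_step d (Q y) (S y) & uniform_step d (S y) (P y)].
  by apply: filterS UE => y /Hx; rewrite /P /Q /S; case: (x y) => -[].
have angle (f : R * R -> R) : (\forall y \near U, d <= f y <= pi - d) ->
    exists a : R, f @ U --> a.
  move=> fd; apply: (@ultra_bounded_cvg R _ U f pi UU); apply: filterS fd => y /andP[f0 f1].
  by rewrite ger0_norm ?(le_trans (ltW d0))// (le_trans f1)// gerBl ltW.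
have side (f : R * R -> R) : (\forall y \near U, `|f y| <= l / 2) ->
    exists2 a : R, `|a| <= l / 2 & f @ U --> a.
  move=> fl; have [a ca] := @ultra_bounded_cvg R _ U f (l / 2) UU fl.
  by exists a => //; apply: cvgr_to_le (cvg_norm ca) fl.
have [p1 p1l cp1] := side (fun y => (P y).1) (filterS (fun y '(And5 _ (And3 h _ _) _ _ _) => h) Hx).
have [q1 q1l cq1] := side (fun y => (Q y).1) (filterS (fun y '(And5 _ (And3 _ h _) _ _ _) => h) Hx).
have [r1 r1l cr1] := side (fun y => (S y).1) (filterS (fun y '(And5 _ (And3 _ _ h) _ _ _) => h) Hx).
have [p2 cp2] := angle (fun y => (P y).2) (filterS (fun y '(And5 _ _ (And3 h _ _) _ _) => h) Hx).
have [q2 cq2] := angle (fun y => (Q y).2) (filterS (fun y '(And5 _ _ _ (And3 h _ _) _) => h) Hx).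
have [r2 cr2] := angle (fun y => (S y).2) (filterS (fun y '(And5 _ _ _ _ (And3 h _ _)) => h) Hx).
have pq : uniform_step d (p1, p2) (q1, q2).
  by apply: (@uniform_step_cvg _ U UU P Q d (_, _) (_, _) d0 _ cp1 cp2 cq1 cq2); apply: filterS Hx => y [].
have qr : uniform_step d (q1, q2) (r1, r2).
  by apply: (@uniform_step_cvg _ U UU Q S d (_, _) (_, _) d0 _ cq1 cq2 cr1 cr2); apply: filterS Hx => y [].
have rp : uniform_step d (r1, r2) (p1, p2).
  by apply: (@uniform_step_cvg _ U UU S P d (_, _) (_, _) d0 _ cr1 cr2 cp1 cp2); apply: filterS Hx => y [].
have [sp _ _] := uniform_step_billiard_map d0 pq.
exists (iota (p1, p2)); split.
  by exists (p1, p2) => //; split=> //; exists (q1, q2), (r1, r2).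
have [ci1 ci2] := embedding_smooth hiota 0.
have cP : P y @[y --> U] --> (p1, p2).
  apply: cvg_trans (cvg_pair cp1 cp2); apply: near_eq_cvg; apply: nearW => y.
  by rewrite -surjective_pairing.
have c1 : (iota (P y)).1 @[y --> U] --> (iota (p1, p2)).1.
  exact: (cvg_comp _ _ cP (ci1 _ sp)).
have c2 : (iota (P y)).2 @[y --> U] --> (iota (p1, p2)).2.
  exact: (cvg_comp _ _ cP (ci2 _ sp)).
have : id @ U --> iota (p1, p2).
  rewrite [X in _ --> X]surjective_pairing.
  apply: cvg_trans (cvg_pair c1 c2); apply: near_eq_cvg; apply: filterS Hx => y [E _ _ _ _].
  by rewrite -surjective_pairing E.
exact.
Qed.

Lemma three_period_bigcup_closed : exists F : (set (R * R))^nat,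
  (forall n, closed (F n)) /\ iota @` three_period gamma D = \bigcup_n F n.
Proof.
exists (fun n => iota @` uniform_three_period n.+1%:R^-1); split.
  by move=> n; apply: closed_uniform_three_period; rewrite invr_gt0.
apply/seteqP; split => [y [p [q [r [pq qr rp]]] <-]|y [n _ [p [_ [q [r [_ _ pq qr rp]]]] <-]]].
  have sp : phase_strip p by case: pq.
  have [d1 d10 /[dup] pq' _] := billiard_map_uniform_step pq.
  have [d2 d20 qr'] := billiard_map_uniform_step qr.
  have [d3 d30 rp'] := billiard_map_uniform_step rp.
  have m0 : 0 < Num.min d1 (Num.min d2 d3) by rewrite !lt_min d10 d20.
  have [n _ /(_ n (leqnn n))] := near_infty_natSinv_lt (PosNum m0).
  rewrite /= !lt_min => /and3P[n1 n2 n3].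
  have n0 : 0 < n.+1%:R^-1 :> R by rewrite invr_gt0.
  exists n => //.
  (* Shifts by periods bring the three lifts into the bounded window without changing the steps or
     the image under [iota]. *)
  have [i il] := int_shift_window htable p.1 0; rewrite subr0 in il.
  have [j jl] := int_shift_window htable q.1 0; rewrite subr0 in jl.
  have [k kl] := int_shift_window htable r.1 0; rewrite subr0 in kl.
  exists (p.1 + i%:~R * l, p.2).
    split; first exact: il.
    exists (q.1 + j%:~R * l, q.2), (r.1 + k%:~R * l, r.2).
    split; [exact: jl|exact: kl|..]; apply: uniform_step_shift.
    - exact: le_uniform_step n0 (ltW n1) pq'.
    - exact: le_uniform_step n0 (ltW n2) qr'.
    - exact: le_uniform_step n0 (ltW n3) rp'.
  apply/(embedding_injective hiota) => //; split; last by [].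
  by exists (- i); rewrite /= mulrNz mulNr addrK.
have n0 : 0 < n.+1%:R^-1 :> R by rewrite invr_gt0.
exists p => //; exists q, r; split; exact: (uniform_step_billiard_map n0).
Qed.

End QuantitativeSteps.

(* iota ranges over all smooth embeddings of the phase space in the plane. *)
Theorem theorem1p2 (R : realType) (l : R) (gamma : R -> R * R)
    (D : set (R * R)) (iota : R * R -> R * R)
    (htable : billiard_table l gamma D)
    (hC3 : curve_Cn 3 gamma)
    (hiota : annulus_embedding l iota)
    (hdim : has_hausdorff_dim (iota @` three_period gamma D) 1) :
  hausdorff_ae 1 (iota @` three_period gamma D)
    (has_tangent_line 1 (iota @` three_period gamma D)).
Proof.
apply: cone_ae_tangent_line.
  have [F [Fcl ->]] := three_period_bigcup_closed htable hC3 hiota.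
  exact: Fsigma_caratheodory.
move=> _ [p Pp <-]; exact: (embedded_three_period_cone htable).
Qed.
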